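(* Let $\Lambda$ be a basic Artin algebra with Jacobson radical $J$ and $e\in\Lambda$ an idempotent such that $\operatorname{pdim}_\Lambda\Lambda(1-e)/J(1-e)<\infty$, $\operatorname{pdim}_{e\Lambda e}e\Lambda(1-e)<\infty$, and $\mathcal{P}^{<\infty}(e\Lambda e\text{-mod})$ is contravariantly finite in $e\Lambda e\text{-mod}$. Decompose $e=e_1+\cdots+e_m$ and $1-e=e_{m+1}+\cdots+e_n$ into orthogonal primitive idempotents of $\Lambda$, let $S_i=\Lambda e_i/Je_i$, and let $\mathcal{A}_i$ be the minimal $\mathcal{P}^{<\infty}(\Lambda\text{-mod})$-approximation of the injective envelope $E(S_i)$ for $1\le i\le n$. Let $T\in\Lambda\text{-mod}$ be the basic strong tilting module. Then $\operatorname{add}(\bigoplus_{1\le i\le m}\mathcal{A}_i)$ contains precisely $m$ isomorphism classes of indecomposable modules, represented by $T_1,\dots,T_m$ say. If $T'=\bigoplus_{1\le i\le m}T_i$, then the direct summand $T'$ of $T$ is an object of $\mathcal{G}$, and $eT'$ is the basic strong tilting object in $e\Lambda e\text{-mod}$, up to isomorphism. Supplementary direct summands $T_{m+1},\dots,T_n$ of $T$ such that $T=T'\oplus\bigoplus_{m+1\le i\le n}T_i$ (up to isomorphism) are as follows: for $m+1\le i\le n$, the minimal $\mathcal{P}^{<\infty}(\Lambda\text{-mod})$-approximation $\mathcal{A}_i$ of $E(S_i)$ decomposes in the form $\mathcal{A}_i=T_i\oplus U_i$ with $\Delta(\operatorname{soc}T_i)\cong S_i$ and $U_i\in\operatorname{add}(T')$.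 In particular, $\Delta(\operatorname{soc}T)\cong S_{m+1}\oplus\cdots\oplus S_n$.
   Context: For an Artin algebra $A$, $A\text{-mod}$ is the category of finitely generated left $A$-modules and $\mathcal{P}^{<\infty}(A\text{-mod})$ its full subcategory of modules of finite projective dimension. $A$ is basic if $A/J(A)$ is a product of division rings; a module is basic if it has no indecomposable direct summand of multiplicity $>1$. $\operatorname{add}(M)$ denotes the direct summands of finite direct sums of copies of $M$. A (right) $\mathcal{P}^{<\infty}(A\text{-mod})$-approximation of $M\in A\text{-mod}$ is a map $\phi:X\to M$ with $X\in\mathcal{P}^{<\infty}(A\text{-mod})$ through which every homomorphism from an object of $\mathcal{P}^{<\infty}(A\text{-mod})$ to $M$ factors. It is minimal if every endomorphism $u$ of $X$ with $\phi\circ u=\phi$ is an automorphism; the minimal one is unique up to isomorphism, and its domain is also called the minimal approximation. $\mathcal{P}^{<\infty}(A\text{-mod})$ is contravariantly finite in $A\text{-mod}$ if every $M\in A\text{-mod}$ has an approximation. Under the hypotheses of the claim, $\mathcal{P}^{<\infty}(\Lambda\text{-mod})$ is contravariantly finite in $\Lambda\text{-mod}$. $T\in A\text{-mod}$ is a tilting module if (1) $T\in\mathcal{P}^{<\infty}(A\text{-mod})$, (2) $\operatorname{Ext}^i_A(T,T)=0$ for $i\ge1$, (3) there is an exact sequence $0\to A\to T_0\to\cdots\to T_s\to0$ with all $T_j\in\operatorname{add}(T)$. It is strong if, in addition, $\operatorname{Ext}^i_A(M,T)=0$ for all $M\in\mathcal{P}^{<\infty}(A\text{-mod})$, $i\ge1$.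 A strong tilting module exists in $A\text{-mod}$ if and only if $\mathcal{P}^{<\infty}(A\text{-mod})$ is contravariantly finite, and the basic one is unique up to isomorphism. For a left $\Lambda$-module $M$, $\Delta(M)=\{x\in M:e\Lambda x=0\}$, the largest submodule annihilated by $e$. $\mathcal{T}$ is the class of left $\Lambda$-modules $X$ with $eX=0$, and $\mathcal{F}$ the class of those $F$ with $\Delta(F)=0$. The Giraud subcategory $\mathcal{G}$ is the full subcategory of the category of left $\Lambda$-modules consisting of the $F\in\mathcal{F}$ with $\operatorname{Ext}^1_\Lambda(X,F)=0$ for all $X\in\mathcal{T}$. *)

(* Defs.v *)
From HB Require Import structures.
From mathcomp Require Import all_boot all_order all_algebra.
From mathcomp Require Import boolp.

Set Implicit Arguments.
Unset Strict Implicit.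
Unset Printing Implicit Defensive.

Import GRing.Theory.
Local Open Scope ring_scope.
Local Open Scope quotient_scope.

(* Rings are [pzRingType]s, so the zero ring is allowed: the corner ring e R e
   vanishes for e = 0. Modules are left modules, [lmodType R]. *)

Section Submodules.
Variables (R : pzRingType) (M : lmodType R).
Implicit Types (N A B : submodClosed M).

Section OfProp.
Variables (P : M -> Prop) (P0 : P 0)
  (PD : forall a x y, P x -> P y -> P (a *: x + y)).

Definition smod_pred : {pred M} := fun x => `[< P x >].

Lemma smod_pred_closed : submod_closed smod_pred.
Proof.
split; first exact/asboolP.
by move=> a x y /asboolP Px /asboolP Py; apply/asboolP; apply: PD.
Qed.

Definition smod_of : submodClosed M :=
  HB.pack_for (submodClosed M) smod_pred
    (GRing.isSubmodClosed.Build R M smod_pred smod_pred_closed).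

Lemma smod_ofP x : reflect (P x) (x \in smod_of).
Proof. exact: asboolP. Qed.
End OfProp.

Lemma smod_lin N a x y : x \in N -> y \in N -> a *: x + y \in N.
Proof. by move=> Nx Ny; apply: rpredD => //; apply: rpredZ. Qed.

Definition smod_full : submodClosed M :=
  @smod_of (fun _ => True) I (fun _ _ _ _ _ => I).

Section Inf.
Variable C : submodClosed M -> Prop.
Let inC x := forall N, C N -> x \in N.
Lemma inC0 : inC 0. Proof. by move=> N _; apply: rpred0. Qed.
Lemma inCD a x y : inC x -> inC y -> inC (a *: x + y).
Proof. by move=> Cx Cy N CN; apply: smod_lin; [apply: Cx|apply: Cy]. Qed.

Definition smod_inf : submodClosed M := smod_of inC0 inCD.
End Inf.

Definition smod_mem N (x : M) : bool := x \in N.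

(* The submodule N as a module. *)
Definition sub_mod N : Type := {x : M | smod_mem N x}.

Lemma smod_mem_closed N : submod_closed (smod_mem N).
Proof. by split; [apply: rpred0|move=> a x y; apply: smod_lin]. Qed.

HB.instance Definition _ N :=
  GRing.isSubmodClosed.Build R M (smod_mem N) (smod_mem_closed N).
HB.instance Definition _ N := SubChoice.on (sub_mod N).
HB.instance Definition _ N :=
  [SubChoice_isSubLmodule of sub_mod N by <:].

End Submodules.

Section Restrict.
Variables (R : pzRingType) (M : lmodType R) (A B : submodClosed M).
Let inB (x : sub_mod A) := val x \in B.
Lemma inB0 : inB 0. Proof. by rewrite /inB raddf0 rpred0. Qed.
Lemma inBD a x y : inB x -> inB y -> inB (a *: x + y).
Proof. by rewrite /inB linearP; apply: smod_lin. Qed.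

(* The intersection of A and B, as a submodule of A. *)
Definition smod_restrict : submodClosed (sub_mod A) := smod_of inB0 inBD.
End Restrict.

Section QuotientModule.
Variables (R : pzRingType) (M : lmodType R) (N : submodClosed M).

Definition quot_pred : {pred M} := smod_mem N.
Lemma quot_pred_closed : zmod_closed quot_pred.
Proof.
split; first exact: rpred0.
by move=> x y Nx Ny; rewrite addrC -scaleN1r; apply: smod_lin.
Qed.
HB.instance Definition _ :=
  GRing.isZmodClosed.Build M quot_pred quot_pred_closed.

Definition quot_mod : Type := Quotient.quot quot_pred.
HB.instance Definition _ := GRing.Zmodule.on quot_mod.

Definition quot_pi (x : M) : quot_mod := \pi_(Quotient.quot quot_pred) x.
Definition quot_repr (u : quot_mod) : M := repr (u : Quotient.quot quot_pred).

Lemma quot_reprK : cancel quot_repr quot_pi.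
Proof. by move=> u; apply: reprK. Qed.

Lemma quot_piP (x y : M) : reflect (quot_pi x = quot_pi y) (x - y \in N).
Proof.
have -> : (x - y \in N) = (x - y \in quot_pred) by [].
by rewrite Quotient.idealrBE; apply: eqP.
Qed.

Lemma quot_piD : {morph quot_pi : x y / x + y}.
Proof. by move=> x y; apply: (raddfD (\pi_(Quotient.quot quot_pred))). Qed.

Definition quot_scale (a : R) (u : quot_mod) : quot_mod :=
  quot_pi (a *: quot_repr u).

Lemma quot_piZ a (x : M) : quot_pi (a *: x) = quot_scale a (quot_pi x).
Proof.
apply/quot_piP; rewrite -scalerBr; apply: rpredZ.
by apply/quot_piP; rewrite quot_reprK.
Qed.

Lemma quot_scaleA a b u : quot_scale a (quot_scale b u) = quot_scale (a * b) u.
Proof. by rewrite -[u]quot_reprK -!quot_piZ scalerA. Qed.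
Lemma quot_scale1 : left_id 1 quot_scale.
Proof. by move=> u; rewrite -[u]quot_reprK -quot_piZ scale1r. Qed.
Lemma quot_scaleDr : right_distributive quot_scale +%R.
Proof.
move=> a u v; rewrite -[u]quot_reprK -[v]quot_reprK -quot_piD -!quot_piZ.
by rewrite scalerDr quot_piD.
Qed.
Lemma quot_scaleDl u : {morph quot_scale^~ u : a b / a + b}.
Proof. by move=> a b; rewrite -[u]quot_reprK -!quot_piZ scalerDl quot_piD. Qed.

HB.instance Definition _ := GRing.Zmodule_isLmodule.Build R quot_mod
  quot_scaleA quot_scale1 quot_scaleDr quot_scaleDl.
HB.instance Definition _ := GRing.isZmodMorphism.Build M quot_mod quot_pi
  (raddfB (\pi_(Quotient.quot quot_pred))).
HB.instance Definition _ :=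
  GRing.isScalable.Build R M quot_mod *:%R quot_pi quot_piZ.
End QuotientModule.

Section DirectSum.
Variables (R : pzRingType) (I : finType) (A : I -> lmodType R).

Definition dsum : Type := {dffun forall i : I, A i}.
HB.instance Definition _ := Choice.on dsum.

Implicit Types f g : dsum.
Definition dsum_zero : dsum := [ffun i => 0 : A i].
Definition dsum_opp f : dsum := [ffun i => - f i].
Definition dsum_add f g : dsum := [ffun i => f i + g i].
Definition dsum_scale (a : R) f : dsum := [ffun i => a *: f i].

Lemma dsum_addA : associative dsum_add.
Proof. by move=> f g h; apply/ffunP => i; rewrite !ffunE addrA. Qed.
Lemma dsum_addC : commutative dsum_add.
Proof. by move=> f g; apply/ffunP => i; rewrite !ffunE addrC. Qed.
Lemma dsum_add0 : left_id dsum_zero dsum_add.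
Proof. by move=> f; apply/ffunP => i; rewrite !ffunE add0r. Qed.
Lemma dsum_addN : left_inverse dsum_zero dsum_opp dsum_add.
Proof. by move=> f; apply/ffunP => i; rewrite !ffunE addNr. Qed.
HB.instance Definition _ :=
  GRing.isZmodule.Build dsum dsum_addA dsum_addC dsum_add0 dsum_addN.

Lemma dsum_scaleA a b f : dsum_scale a (dsum_scale b f) = dsum_scale (a * b) f.
Proof. by apply/ffunP => i; rewrite !ffunE scalerA. Qed.
Lemma dsum_scale1 : left_id 1 dsum_scale.
Proof. by move=> f; apply/ffunP => i; rewrite !ffunE scale1r. Qed.
Lemma dsum_scaleDr : right_distributive dsum_scale +%R.
Proof. by move=> a f g; apply/ffunP => i; rewrite !ffunE scalerDr. Qed.
Lemma dsum_scaleDl f : {morph dsum_scale^~ f : a b / a + b}.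
Proof. by move=> a b; apply/ffunP => i; rewrite !ffunE scalerDl. Qed.
HB.instance Definition _ := GRing.Zmodule_isLmodule.Build R dsum
  dsum_scaleA dsum_scale1 dsum_scaleDr dsum_scaleDl.
End DirectSum.

Section Modules.
Variable R : pzRingType.
Implicit Types E M N P T X Y Z : lmodType R.

Definition mod_iso M N : Prop := exists f : {linear M -> N}, bijective f.

Definition zero_mod M : Prop := forall x : M, x = 0.

Definition fin_gen M : Prop :=
  exists s : seq M, forall x : M,
  exists c : nat -> R, x = \sum_(i < size s) c i *: s`_i.

Definition dsummand X M : Prop := exists Y, mod_iso M (X * Y)%type.

Definition add_class M X : Prop :=
  exists k : nat, dsummand X (dsum (fun _ : 'I_k => M)).

Definition indecomposable M : Prop :=
  ~ zero_mod M /\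
  forall X Y, mod_iso M (X * Y)%type -> zero_mod X \/ zero_mod Y.

Definition basic_mod M : Prop :=
  forall X, indecomposable X -> ~ dsummand (X * X)%type M.

Definition simple_mod M : Prop :=
  ~ zero_mod M /\
  forall N : submodClosed M,
    (forall x, x \in N -> x = 0) \/ (forall x, x \in N).

(* The socle is the sum of the simple submodules, that is, the least submodule
   that contains all of them. *)
Definition socle M : submodClosed M :=
  smod_inf (fun N : submodClosed M =>
    forall S : submodClosed M, simple_mod (sub_mod S) -> {subset S <= N}).

Definition projective_mod P : Prop :=
  forall X Y (g : {linear X -> Y}) (f : {linear P -> Y}),
    (forall y, exists x, g x = y) ->
  exists h : {linear P -> X}, forall z, g (h z) = f z.

Definition injective_mod E : Prop :=
  forall X Y (i : {linear X -> Y}) (f : {linear X -> E}),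
    injective i ->
  exists h : {linear Y -> E}, forall x, h (i x) = f x.

Definition injective_envelope M E (i : {linear M -> E}) : Prop :=
  [/\ injective i, injective_mod E &
    forall N : submodClosed E,
      (forall x : M, i x \in N -> i x = 0) -> forall y, y \in N -> y = 0].

Definition exact_at X Y Z (f : {linear X -> Y}) (g : {linear Y -> Z}) : Prop :=
  forall y, g y = 0 <-> exists x, f x = y.

(* ... -> P_2 -> P_1 -> P_0 -> M -> 0 *)
Record proj_resolution M := ProjResolution {
  pr_obj :> nat -> lmodType R;
  pr_diff : forall n, {linear pr_obj n.+1 -> pr_obj n};
  pr_aug : {linear pr_obj 0 -> M};
  pr_proj : forall n, projective_mod (pr_obj n);
  pr_surj : forall x, exists y, pr_aug y = x;
  pr_exact0 : exact_at (pr_diff 0) pr_aug;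
  pr_exactS : forall n, exact_at (pr_diff n.+1) (pr_diff n)
}.

(* 0 -> M -> C_0 -> C_1 -> C_2 -> ... *)
Record coresolution M := Coresolution {
  cr_obj :> nat -> lmodType R;
  cr_diff : forall n, {linear cr_obj n -> cr_obj n.+1};
  cr_coaug : {linear M -> cr_obj 0};
  cr_inj : injective cr_coaug;
  cr_exact0 : exact_at cr_coaug (cr_diff 0);
  cr_exactS : forall n, exact_at (cr_diff n) (cr_diff n.+1)
}.

Definition pdim_le (d : nat) M : Prop :=
  exists P : proj_resolution M, forall n, (d < n)%N -> zero_mod (P n).

Definition pdim_finite M : Prop := exists d, pdim_le d M.

(* Ext^n(M, N) is the n-th cohomology of Hom(P, N) for a projective resolution
   P of M; cocycle and coboundary describe kernel and image of its
   differentials. As this does not depend on P, Ext_zero quantifies over all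
   resolutions. *)
Definition cocycle M (P : proj_resolution M) N n (f : {linear P n -> N}) :
  Prop := forall x, f (pr_diff P n x) = 0.

Definition coboundary M (P : proj_resolution M) N n :
    {linear P n -> N} -> Prop :=
  match n with
  | 0 => fun f => forall x, f x = 0
  | n'.+1 => fun f =>
      exists g : {linear P n' -> N}, forall x, f x = g (pr_diff P n' x)
  end.

Definition Ext_zero n M N : Prop :=
  forall (P : proj_resolution M) (f : {linear P n -> N}),
    cocycle f -> coboundary f.

(* The class of finitely generated modules of finite projective dimension. *)
Definition Pfin M : Prop := fin_gen M /\ pdim_finite M.

Definition Pfin_approx X M (phi : {linear X -> M}) : Prop :=
  Pfin X /\
  forall Y (f : {linear Y -> M}), Pfin Y ->
  exists g : {linear Y -> X}, forall y, f y = phi (g y).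

Definition min_Pfin_approx X M (phi : {linear X -> M}) : Prop :=
  Pfin_approx phi /\
  forall u : {linear X -> X}, (forall x, phi (u x) = phi x) -> bijective u.

Definition Pfin_contravariantly_finite : Prop :=
  forall M, fin_gen M ->
  exists X (phi : {linear X -> M}), Pfin_approx phi.

Definition tilting T : Prop :=
  [/\ Pfin T,
      forall i, (1 <= i)%N -> Ext_zero i T T &
      exists (s : nat) (C : coresolution R^o),
        (forall j, (j <= s)%N -> add_class T (C j)) /\
        (forall j, (s < j)%N -> zero_mod (C j))].

Definition strong_tilting T : Prop :=
  tilting T /\
  forall M, Pfin M -> forall i, (1 <= i)%N -> Ext_zero i M T.

(* [T_] lists the indecomposable modules in add(M) without repetition, up to
   isomorphism. *)
Definition add_indec_reps M m (T_ : 'I_m -> lmodType R) : Prop :=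
  [/\ forall i, indecomposable (T_ i) /\ add_class M (T_ i),
      forall i j, mod_iso (T_ i) (T_ j) -> i = j &
      forall X, indecomposable X -> add_class M X ->
        exists i, mod_iso X (T_ i)].

End Modules.

Definition artinian_ring (R : pzRingType) : Prop :=
  forall I_ : nat -> submodClosed R^o,
    (forall n, {subset I_ n.+1 <= I_ n}) ->
  exists n, forall k, (n <= k)%N -> I_ k =i I_ n.

Definition artin_algebra (R : pzRingType) : Prop :=
  exists (k : comPzRingType) (h : {rmorphism k -> R}),
    [/\ artinian_ring k,
        forall c x, h c * x = x * h c &
        exists s : seq R, forall x,
        exists c : nat -> k, x = \sum_(i < size s) h (c i) * s`_i].

Definition maximal_left_ideal (R : pzRingType) (N : submodClosed R^o) : Prop :=
  ~ (forall x, x \in N) /\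
  forall N' : submodClosed R^o, {subset N <= N'} ->
    N' =i N \/ (forall x, x \in N').

Definition jacobson (R : pzRingType) : submodClosed R^o :=
  smod_inf (@maximal_left_ideal R).

Definition division_ring (D : nzRingType) : Prop :=
  forall x : D, x != 0 -> exists y, x * y = 1 /\ y * x = 1.

(* R / J(R) is isomorphic to a finite product of division rings: the maps f_ i
   are the components of a surjective ring morphism with kernel J(R). *)
Definition basic_ring (R : pzRingType) : Prop :=
  exists (n : nat) (D : 'I_n -> nzRingType) (f_ : forall i, {rmorphism R -> D i}),
    [/\ forall i, division_ring (D i),
        forall d : (forall i, D i), exists x, forall i, f_ i x = d i &
        forall x : R, x \in jacobson R <-> forall i, f_ i x = 0].

Definition idem (R : pzRingType) (e : R) : Prop := e * e = e.

Definition primitive_idem (R : pzRingType) (e : R) : Prop :=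
  [/\ idem e, e != 0 &
    forall f g : R, idem f -> idem g -> f * g = 0 -> g * f = 0 -> e = f + g ->
      f = 0 \/ g = 0].

Section LeftIdeals.
Variable R : pzRingType.

Section Mul.
Variables (I : submodClosed R^o) (f : R).
Let inIf (x : R^o) := exists2 a : R, a \in I & x = a * f.
Lemma inIf0 : inIf 0. Proof. by exists 0; [exact: (rpred0 I)|rewrite mul0r]. Qed.
Lemma inIfD a x y : inIf x -> inIf y -> inIf (a *: x + y).
Proof.
move=> [b Ib ->] [c Ic ->]; exists (a * b + c); first exact: (smod_lin a Ib Ic).
by rewrite mulrDl -mulrA.
Qed.

(* The left ideal I f. *)
Definition lideal_mul : submodClosed R^o := smod_of inIf0 inIfD.
End Mul.

(* R f *)
Definition lideal_gen (f : R) : submodClosed R^o := lideal_mul (smod_full _) f.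

(* R f / J f *)
Definition top_mod (f : R) : lmodType R :=
  quot_mod (smod_restrict (lideal_gen f) (lideal_mul (jacobson R) f)).
End LeftIdeals.

(* The corner ring e R e; as e is idempotent, its elements are the x with
   e x e = x. *)
Section Corner.
Variables (R : pzRingType) (e : R) (he : idem e).

Definition corner_pred (x : R) : bool := e * x * e == x.
Definition corner (_ : idem e) : Type := {x : R | corner_pred x}.
Local Notation eRe := (corner he).

Lemma corner_closed : zmod_closed corner_pred.
Proof.
split; first by rewrite /in_mem /= /corner_pred mulr0 mul0r.
move=> x y /eqP xe /eqP ye; apply/eqP.
by rewrite mulrBr mulrBl xe ye.
Qed.
HB.instance Definition _ :=
  GRing.isZmodClosed.Build R corner_pred corner_closed.
HB.instance Definition _ := SubChoice.on eRe.
HB.instance Definition _ := [SubChoice_isSubZmodule of eRe by <:].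

Lemma cornerl (x : eRe) : e * val x = val x.
Proof. by rewrite -(eqP (valP x)) !mulrA he. Qed.
Lemma cornerr (x : eRe) : val x * e = val x.
Proof. by rewrite -(eqP (valP x)) -!mulrA he. Qed.

Lemma corner_one_subproof : corner_pred e.
Proof. by rewrite /corner_pred !he. Qed.
Lemma corner_mul_subproof (x y : eRe) : corner_pred (val x * val y).
Proof. by rewrite /corner_pred mulrA cornerl -mulrA cornerr. Qed.

Definition corner_one : eRe := Sub e corner_one_subproof.
Definition corner_mul (x y : eRe) : eRe :=
  Sub (val x * val y) (corner_mul_subproof x y).

Lemma corner_mulA : associative corner_mul.
Proof. by move=> x y z; apply: val_inj; rewrite !SubK mulrA. Qed.
Lemma corner_mul1l : left_id corner_one corner_mul.
Proof. by move=> x; apply: val_inj; rewrite !SubK cornerl. Qed.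
Lemma corner_mul1r : right_id corner_one corner_mul.
Proof. by move=> x; apply: val_inj; rewrite !SubK cornerr. Qed.
Lemma corner_mulDl : left_distributive corner_mul +%R.
Proof.
by move=> x y z; apply: val_inj; exact: mulrDl.
Qed.
Lemma corner_mulDr : right_distributive corner_mul +%R.
Proof.
by move=> x y z; apply: val_inj; exact: mulrDr.
Qed.
HB.instance Definition _ := GRing.Zmodule_isPzRing.Build eRe
  corner_mulA corner_mul1l corner_mul1r corner_mulDl corner_mulDr.

(* The left e R e-module e M = {x in M | e x = x}. *)
Section CornerModule.
Variable M : lmodType R.

Definition corner_mod_pred (x : M) : bool := e *: x == x.
Definition corner_mod (_ : idem e) : Type := {x : M | corner_mod_pred x}.
Local Notation eM := (corner_mod he).

Lemma corner_mod_closed : zmod_closed corner_mod_pred.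
Proof.
split; first by rewrite /in_mem /= /corner_mod_pred scaler0.
by move=> x y /eqP xe /eqP ye; apply/eqP; rewrite scalerBr xe ye.
Qed.
HB.instance Definition _ :=
  GRing.isZmodClosed.Build M corner_mod_pred corner_mod_closed.
HB.instance Definition _ := SubChoice.on eM.
HB.instance Definition _ := [SubChoice_isSubZmodule of eM by <:].

Lemma corner_scale_subproof (a : eRe) (x : eM) :
  corner_mod_pred (val a *: val x).
Proof. by rewrite /corner_mod_pred scalerA cornerl. Qed.
Definition corner_scale (a : eRe) (x : eM) : eM :=
  Sub (val a *: val x) (corner_scale_subproof a x).

Lemma corner_scaleA a b x :
  corner_scale a (corner_scale b x) = corner_scale (a * b) x.
Proof. by apply: val_inj; rewrite !SubK scalerA. Qed.
Lemma corner_scale1 : left_id 1 corner_scale.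
Proof. by move=> x; apply: val_inj; rewrite !SubK (eqP (valP x)). Qed.
Lemma corner_scaleDr : right_distributive corner_scale +%R.
Proof.
by move=> a x y; apply: val_inj; exact: scalerDr.
Qed.
Lemma corner_scaleDl x : {morph corner_scale^~ x : a b / a + b}.
Proof.
by move=> a b; apply: val_inj; exact: scalerDl.
Qed.
HB.instance Definition _ := GRing.Zmodule_isLmodule.Build eRe eM
  corner_scaleA corner_scale1 corner_scaleDr corner_scaleDl.
End CornerModule.
End Corner.
Arguments corner_mod {R e} M _.

Section Giraud.
Variables (R : pzRingType) (e : R).

Section Delta.
Variable M : lmodType R.
Let inD (x : M) := forall a : R, (e * a) *: x = 0.
Lemma inD0 : inD 0. Proof. by move=> a; rewrite scaler0. Qed.
Lemma inDD a x y : inD x -> inD y -> inD (a *: x + y).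
Proof. by move=> Dx Dy b; rewrite scalerDr scalerA -mulrA Dx Dy addr0. Qed.

Definition Delta : submodClosed M := smod_of inD0 inDD.
End Delta.

Definition Delta_soc (M : lmodType R) : lmodType R :=
  sub_mod (Delta (sub_mod (socle M))).

Definition torsion (X : lmodType R) : Prop := forall x : X, e *: x = 0.

Definition torsion_free (F : lmodType R) : Prop :=
  forall x : F, x \in Delta F -> x = 0.

Definition giraud (F : lmodType R) : Prop :=
  torsion_free F /\ forall X, torsion X -> Ext_zero 1 X F.
End Giraud.

(* Main.v *)
(* Write ext-injective for an object X of Pfin with Ext^1(-, X) = 0 on Pfin. By
   minimality and Wakamatsu's lemma every A_i is ext-injective. For i <= m it is
   torsion-free, since torsion modules lie in Pfin and A_i -> E(S_i) is injective
   on Delta(A_i); for i > m, Delta(soc A_i) = S_i, so that just one indecomposable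
   summand S of A_i is not torsion-free. A torsion-free module in Pfin embeds in a
   power of A', hence the torsion-free ext-injectives form add(A'), and the
   indecomposable ext-injectives are those of add(A') together with the p modules
   S. Since Pfin has finite ext-injective coresolutions and finite projective
   resolutions, both the indecomposable ext-injectives and the n indecomposable
   projectives give a basis of the Grothendieck group of Pfin, so add(A') contains
   m indecomposables. As a coresolution of L in add(T) shows that the classes of
   add(T) generate this group as well, all ext-injectives lie in add(T), and T
   is T' x prod S by Krull-Remak-Schmidt.
   On the corner side, every f.g. e L e-module N of finite projective dimension
   is e X for a torsion-free X in Pfin, and maps e X -> e T' lift to maps X -> T'.
   This transports vanishing of Ext^1, the coresolutions by add(T') and the
   matrix units of End(e T'). *)
Require Import Defs.
From HB Require Import structures.
From mathcomp Require Import all_boot all_order all_algebra.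
From mathcomp Require Import boolp.
From mathcomp Require classical_sets.

Set Implicit Arguments.
Unset Strict Implicit.
Unset Printing Implicit Defensive.

Import GRing.Theory.
Local Open Scope ring_scope.

(** * Linear maps, retracts and direct sums *)

Section LinearMaps.
Variable R : pzRingType.
Implicit Types M N X Y Z : lmodType R.

(** The modules A_i with i <= m may decompose and share summands, so no T_i can be attached to a
    single index: the number m comes from counting alone. The Grothendieck group itself is never
    formed; its rational-valued functions, additive on short exact sequences of Pfin, take its
    place. A multiplicity function on a class of relative injectives or projectives extends to such
    a function by alternating sums, and two families of coordinate functions yield mutually inverse
    matrices. The alternating sums need uniform finiteness, which comes from T: if L has a
    coresolution of length s in add(T), then Ext^1(-, L) vanishes on s-th syzygies of Pfin, and s
    bounds all projective dimensions there. The definitions allow resolutions by projectives that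
    are not finitely generated, while the counting needs finitely generated syzygies. Hence
    projective dimension and Ext^1 are recast by single exact sequences, and Schanuel's lemma moves
    between the two kinds of syzygy. *)

Definition mkL X Y (f : X -> Y) (fP : linear f) : {linear X -> Y} :=
  HB.pack_for {linear X -> Y} f (GRing.isLinear.Build R X Y *:%R f fP).

(** Submodules are handled as [Prop]-valued predicates, so that kernels, images and sums are plain
    formulas; [smod_of_ex] yields a [submodClosed] where the definitions ask for one. *)
Definition sclosed X (P : X -> Prop) : Prop :=
  P 0 /\ forall a x y, P x -> P y -> P (a *: x + y).

Lemma sclosedD X (P : X -> Prop) x y : sclosed P -> P x -> P y -> P (x + y).
Proof. by move=> [_ H] Px Py; rewrite -[x]scale1r; apply: H. Qed.
Lemma sclosedZ X (P : X -> Prop) a x : sclosed P -> P x -> P (a *: x).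
Proof. by move=> [P0 H] Px; rewrite -[_ *: _]addr0; apply: H. Qed.
Lemma sclosedN X (P : X -> Prop) x : sclosed P -> P x -> P (- x).
Proof. by move=> cP Px; rewrite -scaleN1r; apply: sclosedZ. Qed.
Lemma sclosedB X (P : X -> Prop) x y : sclosed P -> P x -> P y -> P (x - y).
Proof. by move=> cP Px Py; apply: sclosedD => //; apply: sclosedN. Qed.
Lemma sclosed_sum X (P : X -> Prop) (I : Type) (r : seq I) (p : pred I) F :
  sclosed P -> (forall i, p i -> P (F i)) -> P (\sum_(i <- r | p i) F i).
Proof.
move=> cP PF; elim/big_ind: _ => //; first by case: cP.
by move=> x y; apply: sclosedD.
Qed.

Lemma sclosed_ker X Y (f : {linear X -> Y}) : sclosed (fun x => f x = 0).
Proof.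
by split=> [|a x y fx fy]; rewrite ?linear0 // linearP fx fy scaler0 addr0.
Qed.
Lemma sclosed_im X Y (f : {linear X -> Y}) : sclosed (fun y => exists x, f x = y).
Proof.
split=> [|a _ _ [x <-] [y <-]]; first by exists 0; rewrite linear0.
by exists (a *: x + y); rewrite linearP.
Qed.
Lemma sclosed_preim X Y (f : {linear X -> Y}) P :
  sclosed P -> sclosed (fun x => P (f x)).
Proof.
by move=> [P0 PD]; split=> [|a x y Px Py]; rewrite ?linear0 // linearP; apply: PD.
Qed.
Lemma sclosed_cyc X (x : X) : sclosed (fun y => exists a, y = a *: x).
Proof.
split=> [|a _ _ [b ->] [c ->]]; first by exists 0; rewrite scale0r.
by exists (a * b + c); rewrite scalerDl scalerA.
Qed.
Lemma sclosed_add X (P Q : X -> Prop) : sclosed P -> sclosed Q ->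
  sclosed (fun z => exists x y, [/\ P x, Q y & z = x + y]).
Proof.
move=> [P0 PD] [Q0 QD]; split=> [|a _ _ [x [y [Px Qy ->]]] [x' [y' [Px' Qy' ->]]]].
  by exists 0, 0; rewrite addr0.
exists (a *: x + x'), (a *: y + y'); split; [exact: PD|exact: QD|].
by rewrite scalerDr addrACA.
Qed.
Lemma sclosed_cap X (P Q : X -> Prop) : sclosed P -> sclosed Q ->
  sclosed (fun z => P z /\ Q z).
Proof.
move=> [P0 PD] [Q0 QD]; split=> // a x y [Px Qx] [Py Qy].
by split; [apply: PD|apply: QD].
Qed.
Lemma sclosed_zero X : sclosed (fun x : X => x = 0).
Proof. by split=> // a x y -> ->; rewrite scaler0 addr0. Qed.

(** Two values over [x] differ by a value over 0, so a linear relation need only be single-valued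
    there. Maps without a closed formula, such as liftings and factorizations, are obtained as such
    graphs. *)
Lemma rel_linear X Y (P : X -> Y -> Prop) :
  (forall x, exists y, P x y) -> (forall y, P 0 y -> y = 0) ->
  (forall a x y x' y', P x x' -> P y y' -> P (a *: x + y) (a *: x' + y')) ->
  exists g : {linear X -> Y}, forall x y, P x y <-> y = g x.
Proof.
move=> Pt P0 PD.
have Pu x y y' : P x y -> P x y' -> y = y'.
  move=> h h'; have := PD (-1) _ _ _ _ h' h.
  rewrite !scaleN1r addNr => /P0; rewrite addrC => /eqP.
  by rewrite subr_eq0 => /eqP.
pose f x := sval (cid (Pt x)).
have fP x : P x (f x) by rewrite /f; case: cid.
have fL : linear f by move=> a x y; apply: Pu (fP _) _; apply: PD.
exists (mkL fL) => x y; split=> [h|->]; [exact: Pu h (fP x)|exact: fP].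
Qed.

Lemma lin_lift X Y Z (i : {linear X -> Y}) (f : {linear Z -> Y}) :
  injective i -> (forall z, exists x, i x = f z) ->
  exists g : {linear Z -> X}, forall z, i (g z) = f z.
Proof.
move=> ii ex; have [|x|a x y x' y' h h'|g gP] := @rel_linear Z X (fun z x => i x = f z).
- exact: ex.
- by rewrite linear0 -(linear0 i) => /ii.
- by rewrite !linearP h h'.
by exists g => z; apply/gP.
Qed.

Lemma lin_fact X Y Z (q : {linear X -> Y}) (f : {linear X -> Z}) :
  (forall y, exists x, q x = y) -> (forall x, q x = 0 -> f x = 0) ->
  exists g : {linear Y -> Z}, forall x, g (q x) = f x.
Proof.
move=> sq kq.
have [y|z [x [qx <-]]|a x y x' y' [u [<- <-]] [v [<- <-]]|g gP] :=
  @rel_linear Y Z (fun y z => exists x, q x = y /\ f x = z).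
- by have [x <-] := sq y; exists (f x), x.
- exact: kq.
- by exists (a *: u + v); rewrite !linearP.
by exists g => x; apply/esym/gP; exists x.
Qed.

Lemma smod_of_ex X (P : X -> Prop) : sclosed P ->
  exists N : submodClosed X, forall x, x \in N <-> P x.
Proof.
move=> [P0 PD]; exists (smod_of P0 PD) => x.
by split=> [/smod_ofP|h]; last exact/smod_ofP.
Qed.

Lemma smod_sclosed X (N : submodClosed X) : sclosed (fun x => x \in N).
Proof. by split=> [|a x y]; [apply: rpred0|apply: smod_lin]. Qed.

Lemma sub_mod_inj X (N : submodClosed X) :
  injective (val : {linear sub_mod N -> X}).
Proof. exact: val_inj. Qed.

Lemma sub_mod_im X (N : submodClosed X) x :
  x \in N <-> exists k, (val : {linear sub_mod N -> X}) k = x.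
Proof.
split=> [Nx|[k <-]]; last exact: (valP k).
by exists (Sub x Nx : sub_mod N).
Qed.

Lemma sub_ex X (P : X -> Prop) : sclosed P ->
  exists (K : lmodType R) (i : {linear K -> X}),
    injective i /\ forall x, P x <-> exists k, i k = x.
Proof.
move=> /smod_of_ex[N NP]; exists (sub_mod N), (val : {linear sub_mod N -> X}).
by split=> [|x]; [exact: sub_mod_inj|rewrite -NP; exact: sub_mod_im].
Qed.

Lemma quot_pi0 X (N : submodClosed X) x : quot_pi N x = 0 <-> x \in N.
Proof.
rewrite -{2}[x]subr0; split=> [h|/quot_piP h].
  by apply/quot_piP; rewrite [quot_pi _ _]h [RHS]linear0.
by rewrite /= h linear0.
Qed.

Lemma quo_ex X (P : X -> Prop) : sclosed P ->
  exists (Q : lmodType R) (q : {linear X -> Q}),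
    (forall y, exists x, q x = y) /\ forall x, q x = 0 <-> P x.
Proof.
move=> /smod_of_ex[N NP]; exists (quot_mod N), (@quot_pi R X N).
split=> [y|x]; first by exists (quot_repr y); apply: quot_reprK.
by rewrite -NP; apply: quot_pi0.
Qed.

Definition surj X Y (f : X -> Y) := forall y, exists x, f x = y.

Lemma injP X Y (f : {linear X -> Y}) : (forall x, f x = 0 -> x = 0) -> injective f.
Proof.
by move=> k x y /eqP; rewrite -subr_eq0 -linearB => /eqP/k/eqP; rewrite subr_eq0 => /eqP.
Qed.

Lemma inj0 X Y (f : {linear X -> Y}) x : injective f -> f x = 0 -> x = 0.
Proof. by move=> fi; rewrite -(linear0 f) => /fi. Qed.

Lemma bij_inv X Y (f : {linear X -> Y}) : injective f -> surj f ->
  exists g : {linear Y -> X}, cancel f g /\ cancel g f.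
Proof.
move=> fi fs; have [y|g gP] := @lin_lift X Y Y f idfun fi; first exact: fs.
by exists g; split=> x; [apply: fi; rewrite gP|rewrite gP].
Qed.

Lemma bij_injsurj X Y (f : X -> Y) : bijective f -> injective f /\ surj f.
Proof. by move=> [g fg gf]; split=> [|y]; [exact: can_inj fg|exists (g y)]. Qed.

Lemma injsurj_bij X Y (f : {linear X -> Y}) : injective f -> surj f -> bijective f.
Proof. by move=> fi fs; have [g [fg gf]] := bij_inv fi fs; exists g. Qed.

Lemma mod_isoP X Y (f : {linear X -> Y}) : injective f -> surj f -> mod_iso X Y.
Proof. by move=> fi fs; exists f; apply: injsurj_bij. Qed.

Lemma isoE X Y : mod_iso X Y ->
  exists (f : {linear X -> Y}) (g : {linear Y -> X}), cancel f g /\ cancel g f.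
Proof.
by move=> [f /bij_injsurj[fi fs]]; exists f; apply: bij_inv.
Qed.

Lemma can_iso X Y (f : {linear X -> Y}) (g : {linear Y -> X}) :
  cancel f g -> cancel g f -> mod_iso X Y.
Proof. by move=> fg gf; exists f, g. Qed.

Lemma iso_refl X : mod_iso X X.
Proof. by exists idfun, idfun. Qed.
Lemma iso_sym X Y : mod_iso X Y -> mod_iso Y X.
Proof. by move=> /isoE[f [g [fg gf]]]; apply: can_iso gf fg. Qed.
Lemma iso_trans X Y Z : mod_iso X Y -> mod_iso Y Z -> mod_iso X Z.
Proof.
move=> /isoE[f [g [fg gf]]] /isoE[f' [g' [fg' gf']]].
by apply: (@can_iso _ _ (f' \o f) (g \o g')) => x /=; rewrite ?fg' ?fg ?gf ?gf'.
Qed.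
Lemma iso_zero X Y : mod_iso X Y -> zero_mod X -> zero_mod Y.
Proof. by move=> /isoE[f [g [fg gf]]] zX y; rewrite -[y]gf (zX (g y)) linear0. Qed.

Lemma zero_mod_ex : exists Z, zero_mod Z.
Proof.
have [K [i [ii iP]]] := sub_ex (sclosed_zero R^o).
by exists K => k; apply: (inj0 ii); apply/iP; exists k.
Qed.

Lemma zero_iso X Y : zero_mod X -> zero_mod Y -> mod_iso X Y.
Proof.
move=> zX zY; apply: (@can_iso _ _ \0 \0) => x /=; first by rewrite (zX x).
by rewrite (zY x).
Qed.

Lemma nonzero_ex X : ~ zero_mod X -> exists x : X, x <> 0.
Proof. by move=> h; apply: contra_notP h => h x; apply: contra_notP h => ?; exists x. Qed.

Lemma pair_ex X Y Z (f : {linear X -> Y}) (g : {linear X -> Z}) :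
  exists h : {linear X -> (Y * Z)%type}, forall x, h x = (f x, g x).
Proof.
have hL : linear (fun x => (f x, g x) : (Y * Z)%type).
  by move=> a x y; rewrite !linearP.
by exists (mkL hL).
Qed.

Lemma copair_ex X Y Z (f : {linear X -> Z}) (g : {linear Y -> Z}) :
  exists h : {linear (X * Y)%type -> Z}, forall x, h x = f x.1 + g x.2.
Proof. by exists ((f \o fst) \+ (g \o snd)). Qed.

Lemma inl_ex X Y : exists h : {linear X -> (X * Y)%type}, forall x, h x = (x, 0).
Proof. by have [h hE] := pair_ex (idfun : {linear X -> X}) (\0 : {linear X -> Y}); exists h. Qed.
Lemma inr_ex X Y : exists h : {linear Y -> (X * Y)%type}, forall x, h x = (0, x).
Proof. by have [h hE] := pair_ex (\0 : {linear Y -> X}) (idfun : {linear Y -> Y}); exists h. Qed.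

Definition retract X M : Prop :=
  exists (s : {linear X -> M}) (r : {linear M -> X}), cancel s r.

Lemma retract_refl X : retract X X.
Proof. by exists idfun, idfun. Qed.
Lemma retract_trans X Y Z : retract X Y -> retract Y Z -> retract X Z.
Proof.
move=> [s [r rs]] [s' [r' rs']]; exists (s' \o s), (r \o r') => x /=.
by rewrite rs' rs.
Qed.
Lemma iso_retract X Y : mod_iso X Y -> retract X Y.
Proof. by move=> /isoE[f [g [fg _]]]; exists f, g. Qed.
Lemma retract_fst X Y : retract X (X * Y)%type.
Proof. by have [h hE] := inl_ex X Y; exists h, fst => x; rewrite hE. Qed.
Lemma retract_snd X Y : retract Y (X * Y)%type.
Proof. by have [h hE] := inr_ex X Y; exists h, snd => x; rewrite hE. Qed.

Lemma split_iso X Y M (s : {linear X -> M}) (r : {linear M -> X})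
    (i : {linear Y -> M}) :
  cancel s r -> injective i -> (forall x, r x = 0 <-> exists k, i k = x) ->
  mod_iso M (X * Y)%type.
Proof.
move=> rs ii ik.
have [x|t tP] := @lin_lift Y M M i (idfun \- (s \o r)) ii.
  by apply/ik; rewrite /= linearB /= rs subrr.
have [h hE] := pair_ex r t; apply: (@mod_isoP _ _ h).
  by apply: injP => x; rewrite hE => -[rx tx]; have /= := tP x; rewrite tx linear0 rx linear0 subr0.
move=> [x y]; exists (s x + i y); rewrite hE linearD rs.
have riy : r (i y) = 0 by apply/ik; exists y.
rewrite riy addr0; congr (_, _); apply: ii; rewrite tP /=.
by rewrite linearD rs riy addr0 addrC addKr.
Qed.

Lemma retractP X M : retract X M <-> dsummand X M.
Proof.
split=> [[s [r rs]]|[Y iso]]; last first.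
  by apply: retract_trans (retract_fst X Y) (iso_retract (iso_sym iso)).
by have [K [i [ii iP]]] := sub_ex (sclosed_ker r); exists K; apply: split_iso rs ii iP.
Qed.

Lemma prod_iso X Y X' Y' : mod_iso X X' -> mod_iso Y Y' ->
  mod_iso (X * Y)%type (X' * Y')%type.
Proof.
move=> /isoE[f [g [fg gf]]] /isoE[f' [g' [fg' gf']]].
have [h hE] := pair_ex (f \o fst : {linear (X * Y)%type -> _}) (f' \o snd).
have [k kE] := pair_ex (g \o fst : {linear (X' * Y')%type -> _}) (g' \o snd).
by apply: (@can_iso _ _ h k) => -[x y]; rewrite hE kE /= ?fg ?fg' ?gf ?gf'.
Qed.
Lemma prod_isoC X Y : mod_iso (X * Y)%type (Y * X)%type.
Proof.
have [h hE] := pair_ex (snd : {linear (X * Y)%type -> _}) fst.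
have [k kE] := pair_ex (snd : {linear (Y * X)%type -> _}) fst.
by apply: (@can_iso _ _ h k) => -[x y]; rewrite hE kE.
Qed.
Lemma prod_isoA X Y Z : mod_iso (X * (Y * Z))%type (X * Y * Z)%type.
Proof.
have [h hE] := pair_ex (fst : {linear (X * (Y * Z))%type -> _}) (fst \o snd).
have [k kE] := pair_ex h (snd \o snd).
apply: (@mod_isoP _ _ k); last move=> [[x y] z].
  move=> [x [y z]] [x' [y' z']].
  by rewrite !kE !hE /= => -[-> -> ->].
by exists (x, (y, z)); rewrite kE hE.
Qed.
Lemma prod_iso0 X Y : zero_mod Y -> mod_iso (X * Y)%type X.
Proof.
move=> zY; apply: (@mod_isoP _ _ fst); last by move=> x; exists (x, 0).
by move=> [x y] [x' y'] /= ->; rewrite (zY y) (zY y').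
Qed.
Lemma prod_retract X Y X' Y' : retract X X' -> retract Y Y' ->
  retract (X * Y)%type (X' * Y')%type.
Proof.
move=> [s [r rs]] [s' [r' rs']].
have [h hE] := pair_ex (s \o fst : {linear (X * Y)%type -> _}) (s' \o snd).
have [k kE] := pair_ex (r \o fst : {linear (X' * Y')%type -> _}) (r' \o snd).
by exists h, k => -[x y]; rewrite hE kE /= rs rs'.
Qed.

Section Dsum.
Variables (I : finType) (A : I -> lmodType R).

Lemma dpr_ex i : exists p : {linear dsum A -> A i}, forall f, p f = (f : {dffun _}) i.
Proof.
have pL : linear (fun f : dsum A => (f : {dffun _}) i) by move=> a x y; rewrite !ffunE.
by exists (mkL pL).
Qed.
Definition dpr i : {linear dsum A -> A i} := sval (cid (dpr_ex i)).
Lemma dprE i f : dpr i f = (f : {dffun _}) i.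
Proof. by rewrite /dpr; case: cid. Qed.

Lemma dsum_eq (f g : dsum A) : (forall i, dpr i f = dpr i g) -> f = g.
Proof. by move=> h; apply/ffunP => i; have := h i; rewrite !dprE. Qed.

Lemma dtup_ex X (f : forall i, {linear X -> A i}) :
  exists h : {linear X -> dsum A}, forall x i, dpr i (h x) = f i x.
Proof.
pose h x : dsum A := [ffun i => f i x].
have hE x i : dpr i (h x) = f i x by rewrite dprE ffunE.
have hL : linear h by move=> a x y; apply: dsum_eq => i; rewrite linearP !hE linearP.
by exists (mkL hL).
Qed.

Lemma din_ex i : exists h : {linear A i -> dsum A},
  (forall x, dpr i (h x) = x) /\ (forall x j, j != i -> dpr j (h x) = 0).
Proof.
(* The identity at [j = i] has to be transported along the equality of indices. *)
pose f j : {linear A i -> A j} :=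
  match eqVneq j i with
  | EqNotNeq e => match esym e in _ = j return {linear A i -> A j} with erefl => idfun end
  | NeqNotEq _ => \0
  end.
have [h hE] := dtup_ex f; exists h; split=> [x|x j ji]; rewrite hE /f.
  by case: eqVneq => [e|/eqP//]; rewrite (Prop_irrelevance e erefl).
by case: eqVneq => // e; rewrite e eqxx in ji.
Qed.
Definition din i : {linear A i -> dsum A} := sval (cid (din_ex i)).
Lemma dinK i : cancel (din i) (dpr i).
Proof. by rewrite /din; case: cid => h []. Qed.
Lemma din0 i j x : j != i -> dpr j (din i x) = 0.
Proof. by rewrite /din; case: cid => h [? H] /=; apply: H. Qed.

Lemma dsumE (f : dsum A) : f = \sum_i din i (dpr i f).
Proof.
apply: dsum_eq => j; rewrite linear_sum (bigD1 j) //= dinK big1 ?addr0 // => i ij.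
by rewrite din0 // eq_sym.
Qed.

Lemma dcotup_ex X (f : forall i, {linear A i -> X}) :
  exists h : {linear dsum A -> X}, (forall x, h x = \sum_i f i (dpr i x)) /\
    forall i x, h (din i x) = f i x.
Proof.
pose h x : X := \sum_i f i (dpr i x).
have hL : linear h.
  move=> a x y; rewrite /h scaler_sumr -big_split /=; apply: eq_bigr => i _.
  by rewrite !linearP.
exists (mkL hL); split=> // i x; rewrite /= /h (bigD1 i) //= dinK big1 ?addr0 // => j ji.
by rewrite din0 // linear0.
Qed.
Lemma dsum_retract i : retract (A i) (dsum A).
Proof. by exists (din i), (dpr i); apply: dinK. Qed.
End Dsum.
Arguments dpr {I A} i.
Arguments din {I A} i.

Lemma dsum_recl k (A : 'I_k.+1 -> lmodType R) :
  mod_iso (dsum A) (A ord0 * dsum (fun i => A (lift ord0 i)))%type.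
Proof.
have [t tE] := dtup_ex (fun i => dpr (A:=A) (lift ord0 i)).
have [h hE] := pair_ex (dpr (A:=A) ord0) t.
apply: (@mod_isoP _ _ h); last move=> [x y].
  move=> x y; rewrite !hE => -[h0 ht]; apply: dsum_eq => i; case: (unliftP ord0 i) => [j|] -> //.
  by rewrite -!tE ht.
have [u [_ uE]] := dcotup_ex (fun i => din (A:=A) (lift ord0 i)).
exists (din ord0 x + u y); rewrite hE linearD dinK.
rewrite [y]dsumE !linear_sum /=.
under eq_bigr do rewrite uE.
rewrite big1 ?addr0; last by move=> i _; rewrite din0.
congr (_, _); apply: dsum_eq => i; rewrite tE linearD linear_sum /= din0 ?add0r //.
rewrite linear_sum; apply: eq_bigr => j _; case: (eqVneq i j) => [->|ij]; first by rewrite uE !dinK.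
by rewrite uE !din0 // (inj_eq lift_inj).
Qed.
Lemma dsum0_zero (A : 'I_0 -> lmodType R) : zero_mod (dsum A).
Proof. by move=> x; apply: dsum_eq => -[]. Qed.

Lemma retract_zero X M : retract X M -> zero_mod M -> zero_mod X.
Proof. by move=> [s [r rs]] zM x; rewrite -[x]rs (zM (s x)) linear0. Qed.

Lemma add_classP M X : add_class M X <->
  exists k, retract X (dsum (fun _ : 'I_k => M)).
Proof. by split=> -[k /retractP h]; exists k. Qed.
End LinearMaps.
Arguments dpr {R I A} i.
Arguments din {R I A} i.

(** * Short exact sequences, projective dimension *)

Section Extensions.
Variable R : pzRingType.
Implicit Types A B C F K L M N P Q W X Y Z : lmodType R.

Definition sesm X Y Z (i : {linear X -> Y}) (q : {linear Y -> Z}) : Prop :=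
  [/\ injective i, surj q & exact_at i q].

Lemma ses0 X Y Z (i : {linear X -> Y}) (q : {linear Y -> Z}) x :
  sesm i q -> q (i x) = 0.
Proof. by move=> [_ _ e]; apply/e; exists x. Qed.

Lemma ses_of_surj X Y (q : {linear X -> Y}) : surj q ->
  exists (K : lmodType R) (i : {linear K -> X}), sesm i q.
Proof. by move=> sq; have [K [i [ii iP]]] := sub_ex (sclosed_ker q); exists K, i; split. Qed.

Lemma ses_of_inj X Y (i : {linear X -> Y}) : injective i ->
  exists (Q : lmodType R) (q : {linear Y -> Q}), sesm i q.
Proof.
by move=> ii; have [Q [q [sq qP]]] := quo_ex (sclosed_im i); exists Q, q; split.
Qed.

Lemma ses_prod X Y (h : {linear X -> (X * Y)%type}) : (forall x, h x = (x, 0)) ->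
  sesm h (snd : {linear (X * Y)%type -> Y}).
Proof.
move=> hE; split; first by move=> x y; rewrite !hE => -[].
  by move=> y; exists (0, y).
move=> [x y] /=; split=> [->|[z]]; first by exists x.
by rewrite hE => -[].
Qed.

Lemma ses_split X Y Z (i : {linear X -> Y}) (q : {linear Y -> Z})
    (s : {linear Z -> Y}) : sesm i q -> cancel s q -> mod_iso Y (Z * X)%type.
Proof. by move=> [ii _ e] sK; apply: split_iso sK ii e. Qed.

Lemma ses_splitl X Y Z (i : {linear X -> Y}) (q : {linear Y -> Z})
    (r : {linear Y -> X}) : sesm i q -> cancel i r ->
  exists s : {linear Z -> Y}, cancel s q.
Proof.
move=> S rK; have [ii sq e] := S.
have [x|s sP] := @lin_fact _ _ _ _ q (idfun \- (i \o r)) sq.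
  by move=> /e[y <-] /=; rewrite rK subrr.
by exists s => z; have [x <-] := sq z; rewrite sP /= linearB /= (ses0 _ S) subr0.
Qed.

(** [W] is the fibre product of [X] and [Y] over [Z]. The last two clauses are its universal
    property on elements: existence and uniqueness of the point over a compatible pair. *)
Lemma pull_ses K Y Z X (i : {linear K -> Y}) (q : {linear Y -> Z})
    (f : {linear X -> Z}) : sesm i q ->
  exists (W : lmodType R) (a : {linear W -> X}) (b : {linear W -> Y})
      (j : {linear K -> W}),
    [/\ sesm j a, forall w, f (a w) = q (b w), forall k, b (j k) = i k,
        forall x y, f x = q y -> exists w, a w = x /\ b w = y &
        forall w, a w = 0 -> b w = 0 -> w = 0].
Proof.
move=> S; have [ii sq e] := S.
have [W [c [ci cP]]] :=
  sub_ex (sclosed_ker ((f \o fst) \- (q \o snd) : {linear (X * Y)%type -> Z})).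
have fq w : f (c w).1 = q (c w).2.
  by apply/eqP; rewrite -subr_eq0; apply/eqP/(cP (c w)); exists w.
have ex x y : f x = q y -> exists w, (c w).1 = x /\ (c w).2 = y.
  move=> h; have /cP[w cw] : ((f \o fst) \- (q \o snd)) (x, y) = 0 by rewrite /= h subrr.
  by exists w; rewrite cw.
have [h hE] := inr_ex X K.
have [r rE] := pair_ex (\0 : {linear K -> X}) i.
have [k|j jP] := @lin_lift _ _ _ _ c r ci.
  by apply/cP; rewrite rE /= linear0 sub0r (ses0 _ S) oppr0.
exists W, (fst \o c), (snd \o c), j; split=> //=.
- split=> [x y|x|w] /=.
  + by move=> xy; apply: ii; have := jP x; have := jP y; rewrite xy !rE => -> [].
  + by have [y qy] := sq (f x); have [w [? ?]] := ex x y (esym qy); exists w.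
  split=> [cw|[k <-]]; last by rewrite jP rE.
  have /e[k ik] : q (c w).2 = 0 by rewrite -fq cw linear0.
  exists k; apply: ci; rewrite jP rE /=; case: (c w) cw ik => ? ? /= -> -> //.
- by move=> k; rewrite jP rE.
- move=> w w1 w2; apply: (inj0 ci); case: (c w) w1 w2 => ? ? /= -> -> //.
Qed.

(* Ext^1(X, N) = 0, without reference to resolutions. *)
Definition ext1 X N : Prop :=
  forall Y Z (i : {linear Y -> Z}) (q : {linear Z -> X}), sesm i q ->
  forall f : {linear Y -> N}, exists g : {linear Z -> N}, forall y, g (i y) = f y.

(** Pushout: the quotient of [Z * N] by the pairs (i y, - f y) is an extension of [X] by [N]; a
    retraction of it, restricted to [Z], extends [f]. *)
Lemma split_ext1 X N :
  (forall Z (i : {linear N -> Z}) (q : {linear Z -> X}), sesm i q ->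
     exists r : {linear Z -> N}, cancel i r) ->
  ext1 X N.
Proof.
move=> H Y Z i q [ii sq e] f.
have [c cE] := pair_ex i (\0 \- f).
have [W [p [sp pP]]] := quo_ex (sclosed_im c).
have [h hE] := inl_ex Z N; have [h' h'E] := inr_ex Z N.
have [[z n] /pP[y cy]|t tE] := @lin_fact _ _ _ _ p (q \o fst) sp.
  by move: cy; rewrite cE => -[<- _] /=; apply/e; exists y.
have [|r rK] := H W (p \o h') t.
- split.
  + apply: injP => n /= /pP[y]; rewrite cE h'E /= => -[/(inj0 ii)-> <-].
    by rewrite linear0 subr0.
  + by move=> x; have [z <-] := sq x; exists (p (z, 0)); rewrite tE.
  move=> w; have [[z n] <-] := sp w; rewrite tE /=; split.
    move=> /e[y iy]; exists (n + f y); apply/eqP; rewrite eq_sym -subr_eq0 -linearB /=.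
    apply/eqP/pP; exists y; rewrite cE h'E /= iy sub0r; congr (_, _); first by rewrite /= subr0.
    by rewrite /= opprD addNKr.
  by move=> [n' /eqP]; rewrite eq_sym -subr_eq0 -linearB => /eqP/pP[y];
    rewrite cE h'E /= => -[iy _]; apply/e; exists y; rewrite iy subr0.
exists (r \o p \o h) => y /=; rewrite -[RHS]rK; congr (r _) => /=.
apply/eqP; rewrite -subr_eq0 -linearB; apply/eqP/pP; exists y.
by rewrite cE hE h'E /=; congr (_, _); rewrite /= ?subr0.
Qed.

Lemma ext1_split X N Z (i : {linear N -> Z}) (q : {linear Z -> X}) :
  ext1 X N -> sesm i q -> exists r : {linear Z -> N}, cancel i r.
Proof. by move=> E s; have [r rP] := E _ _ _ _ s idfun; exists r. Qed.

Lemma ext1_iso X N Z (i : {linear N -> Z}) (q : {linear Z -> X}) :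
  ext1 X N -> sesm i q -> mod_iso Z (X * N)%type.
Proof.
move=> E s; have [r rK] := ext1_split E s; have [t tK] := ses_splitl s rK.
exact: ses_split s tK.
Qed.

Lemma ext1_retractN X N N' : retract N' N -> ext1 X N -> ext1 X N'.
Proof.
move=> [s [r rs]] E Y Z i q S f; have [g gP] := E _ _ _ _ S (s \o f).
by exists (r \o g) => y; rewrite /= gP /= rs.
Qed.

(** Pull the extension of [X'] back along [r] to one of [X], extend [f] there, and restrict along
    the map [Z -> W] with components [s \o q] and the identity, which exists because [r] undoes
    [s]. *)
Lemma ext1_retractX X X' N : retract X' X -> ext1 X N -> ext1 X' N.
Proof.
move=> [s [r rs]] E Y Z i q S f.
have [W [a [b [j [S' fq bj ex ji]]]]] := pull_ses r S.
have [g gP] := E _ _ _ _ S' f.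
have [t tE] := pair_ex a b.
have ti : injective t by apply: injP => w; rewrite tE => -[]; apply: ji.
have [u uE] := pair_ex (s \o q) idfun.
have [z|c cP] := @lin_lift _ _ _ _ t u ti.
  by have [w [aw bw]] := ex (s (q z)) z (rs _); exists w; rewrite tE uE aw bw.
exists (g \o c) => y; rewrite /= -gP; congr (g _); apply: ti.
rewrite cP uE tE /= (ses0 _ S) linear0 bj; congr (_, _).
by rewrite (ses0 _ S').
Qed.

(** Extend in two stages: over the preimage [W] of [X'] in [Z], whose quotient by [Y] is [X'], and
    then from [W] to [Z], where the quotient is [X'']. *)
Lemma ext1_mid X' X X'' N (i : {linear X' -> X}) (q : {linear X -> X''}) :
  sesm i q -> ext1 X' N -> ext1 X'' N -> ext1 X N.
Proof.
move=> S E' E'' Y Z j p S' f.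
have [W [a [b [k [S'' fq bk ex ji]]]]] := pull_ses i S'.
have [g gP] := E' _ _ _ _ S'' f.
have [|h hP] := E'' _ _ b (q \o p) _ g.
- case: S S' S'' => ii sq e [ji' sp e'] [ki sa e3]; split.
  + apply: injP => w bw; apply: ji => //; apply: (inj0 ii); rewrite fq bw linear0 //.
  + by move=> x''; have [x <-] := sq x''; have [z <-] := sp x; exists z.
  move=> z /=; split=> [/e[x' ix']|[w <-]]; last by rewrite -fq; apply/e; exists (a w).
  by have [w [_ bw]] := ex _ _ ix'; exists w.
by exists h => y; rewrite -bk hP gP.
Qed.

Lemma proj_split P Z (q : {linear Z -> P}) : projective_mod P -> surj q ->
  exists s : {linear P -> Z}, cancel s q.
Proof. by move=> pP sq; have [s sP] := pP _ _ q idfun sq; exists s. Qed.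

Lemma ext1_proj P N : projective_mod P -> ext1 P N.
Proof.
move=> pP; apply: split_ext1 => Z i q S; have [ii sq e] := S.
have [s sK] := proj_split pP sq.
have [z|t tE] := @lin_lift _ _ _ _ i (idfun \- (s \o q)) ii.
  by apply/e; rewrite /= linearB /= sK subrr.
by exists t => n; apply: ii; rewrite tE /= (ses0 _ S) linear0 subr0.
Qed.

Lemma ext1_dsumN X (I : finType) (A : I -> lmodType R) :
  (forall i, ext1 X (A i)) -> ext1 X (dsum A).
Proof.
move=> E Y Z i q S f.
pose g j := sval (cid (E j _ _ _ _ S (dpr j \o f))).
have [h hE] := dtup_ex g; exists h => y; apply: dsum_eq => j.
by rewrite hE /g; case: cid.
Qed.

(** Lift [q] to [h : Q -> Z]; then [Z] is the sum of [h Q] and [i' Y], which overlap in the image of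
    [K]. An extension to [Q] of the map induced on [K] glues with [f]. *)
Lemma ext1_pres X N K Q (i : {linear K -> Q}) (q : {linear Q -> X}) :
  projective_mod Q -> sesm i q ->
  (forall f : {linear K -> N}, exists g : {linear Q -> N}, forall k, g (i k) = f k) ->
  ext1 X N.
Proof.
move=> pQ S H Y Z i' q' S' f; have [ii sq e] := S; have [ii' sq' e'] := S'.
have [h hP] := pQ _ _ q' q sq'.
have [x|k kP] := @lin_lift _ _ _ _ i' (h \o i) ii'.
  by apply/e'; rewrite /= hP (ses0 _ S).
have [g gP] := H (f \o k).
have [z|n [p [y [zE ->]]]|a x y x' y' [p [u [-> ->]]] [p' [u' [-> ->]]]|t tP] :=
  @rel_linear _ Z N (fun z n => exists p y, z = h p + i' y /\ n = g p + f y).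
- have [p qp] := sq (q' z).
  have /e'[y yE] : q' (z - h p) = 0 by rewrite linearB hP qp subrr.
  by exists (g p + f y), p, y; rewrite yE addrC subrK.
- have /e[x xp] : q p = 0.
    have : q' (h p + i' y) = 0 by rewrite -zE linear0.
    by rewrite linearD hP (ses0 _ S') addr0.
  have yE : y = - k x.
    apply: ii'; rewrite linearN kP /= xp; apply/eqP; rewrite -addr_eq0 addrC.
    by rewrite -zE.
  by rewrite yE -xp gP /= linearN addrN.
- exists (a *: p + p'), (a *: u + u'); rewrite !linearP scalerDr scalerDr.
  by split; rewrite addrACA.
exists t => y; apply/esym/tP; exists 0, y.
by rewrite !linear0 !add0r.
Qed.

Lemma lift_ext1 K M A M'' (i : {linear M -> A}) (q : {linear A -> M''})
    (f : {linear K -> M''}) : sesm i q -> ext1 K M ->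
  exists g : {linear K -> A}, forall k, q (g k) = f k.
Proof.
move=> S E; have [W [a [b [j [S' fq bj ex ji]]]]] := pull_ses f S.
have [r rK] := ext1_split E S'; have [s sK] := ses_splitl S' rK.
by exists (b \o s) => k /=; rewrite -fq sK.
Qed.

(** Exactness of Ext^1(X, A) -> Ext^1(X, M'') -> Ext^2(X, M), where Ext^2(X, M) is Ext^1(K, M) for
    the syzygy [K]. *)
Lemma ext1_shiftN K F X M A M'' (j : {linear K -> F}) (p : {linear F -> X})
    (i : {linear M -> A}) (q : {linear A -> M''}) :
  projective_mod F -> sesm j p -> sesm i q ->
  ext1 K M -> ext1 X A -> ext1 X M''.
Proof.
move=> pF S S' EK EX; apply: (ext1_pres pF S) => f.
have [g gP] := lift_ext1 f S' EK; have [h hP] := EX _ _ _ _ S g.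
by exists (q \o h) => k; rewrite /= hP gP.
Qed.

(** Exactness of Ext^1(X, Z'') -> Ext^2(X, Z) -> Ext^2(X, C), with Ext^2(X, -) written as Ext^1(K,
    -). *)
Lemma ext1_shiftX K F X Z C Z'' (j : {linear K -> F}) (p : {linear F -> X})
    (i : {linear Z -> C}) (q : {linear C -> Z''}) :
  projective_mod F -> sesm j p -> sesm i q ->
  ext1 X Z'' -> ext1 K C -> ext1 K Z.
Proof.
move=> pF S S' EX EK Y W j' p' S3 f.
have [ii sq e] := S'; have [_ sp' e'] := S3.
have [g gP] := EK _ _ _ _ S3 (i \o f).
have [w|g1 g1P] := @lin_fact _ _ _ _ p' (q \o g) sp'.
  by move=> /e'[y <-]; rewrite /= gP /= (ses0 _ S').
have [h hP] := EX _ _ _ _ S g1.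
have [h' h'P] := pF _ _ q h sq.
have [w|t tP] := @lin_lift _ _ _ _ i (g \- (h' \o j \o p')) ii.
  by apply/e; rewrite /= linearB /= h'P hP g1P /= subrr.
by exists t => y; apply: ii; rewrite tP /= gP (ses0 _ S3) (linear0 j) (linear0 h') subr0.
Qed.

Lemma proj_retract P Q : retract P Q -> projective_mod Q -> projective_mod P.
Proof.
move=> [s [r rs]] pQ X Y g f sg; have [h hP] := pQ _ _ g (f \o r) sg.
by exists (h \o s) => z; rewrite /= hP /= rs.
Qed.

Lemma proj_dsum (I : finType) (A : I -> lmodType R) :
  (forall i, projective_mod (A i)) -> projective_mod (dsum A).
Proof.
move=> pA X Y g f sg.
pose h i := sval (cid (pA i _ _ g (f \o din i) sg)).
have hP i x : g (h i x) = f (din i x) by rewrite /h; case: cid.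
have [t [tE tP]] := dcotup_ex h; exists t => z; rewrite tE {2}[z]dsumE !linear_sum.
by apply: eq_bigr => i _; rewrite hP.
Qed.

Lemma proj_prod P Q : projective_mod P -> projective_mod Q ->
  projective_mod (P * Q)%type.
Proof.
move=> pP pQ X Y g f sg.
have [a aE] := inl_ex P Q; have [b bE] := inr_ex P Q.
have [h hP] := pP _ _ g (f \o a) sg; have [k kP] := pQ _ _ g (f \o b) sg.
have [t tE] := copair_ex h k; exists t => -[x y]; rewrite tE linearD hP kP /= -linearD.
by rewrite aE bE; congr (f (_, _)); rewrite /= ?addr0 ?add0r.
Qed.

Lemma proj_zero P : zero_mod P -> projective_mod P.
Proof.
move=> zP X Y g f sg; exists \0 => z /=.
by rewrite (zP z) !linear0.
Qed.

Lemma cyc_ex X (x : X) : exists h : {linear R^o -> X}, forall a : R, h a = a *: x.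
Proof.
have hL : linear (fun a : R^o => (a : R) *: x) by move=> a b c; rewrite scalerDl scalerA.
by exists (mkL hL).
Qed.

Lemma proj_reg : projective_mod R^o.
Proof.
move=> X Y g f sg; have [x gx] := sg (f 1).
have [h hE] := cyc_ex x; exists h => a; rewrite hE linearZ gx -linearZ /=.
by congr (f _); apply: mulr1.
Qed.

(** Projective dimension at most [n], one syzygy at a time and with arbitrary projectives. That the
    choice of presentation does not matter is [pd_syz]; [pdim_le_pd] and [pd_pdim_le] relate it to
    [pdim_le]. *)
Fixpoint pd n M : Prop :=
  match n with
  | 0 => projective_mod M
  | n'.+1 => exists (K P : lmodType R) (i : {linear K -> P}) (q : {linear P -> M}),
      [/\ projective_mod P, sesm i q & pd n' K]
  end.

Lemma iso_ses X Y Z Z' (i : {linear X -> Y}) (q : {linear Y -> Z})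
   (f : {linear Z -> Z'}) (g : {linear Z' -> Z}) : cancel f g -> cancel g f ->
   sesm i q -> sesm i (f \o q).
Proof.
move=> fg gf [ii sq e]; split=> // [z|y] /=.
  by have [y qy] := sq (g z); exists y; rewrite qy gf.
by rewrite -e; split=> [h|->]; [rewrite -[q y]fg h linear0|rewrite linear0].
Qed.

Lemma pd_iso n M N : mod_iso M N -> pd n M -> pd n N.
Proof.
move=> iso; case: n => [|n]; first exact/proj_retract/iso_retract/iso_sym.
have [f [g [fg gf]]] := isoE iso; move=> [K [P [i [q [pP S pK]]]]].
exists K, P, i, (f \o q); split=> //; exact: (iso_ses fg gf).
Qed.

(** The fibre product of [P] and [P'] over [M] is an extension of [P'] by [K] and of [P] by [K'],
    and both split. *)
Lemma schanuel M K P K' P' (i : {linear K -> P}) (q : {linear P -> M})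
    (i' : {linear K' -> P'}) (q' : {linear P' -> M}) :
  projective_mod P -> projective_mod P' -> sesm i q -> sesm i' q' ->
  mod_iso (P' * K)%type (P * K')%type.
Proof.
move=> pP pP' S S'.
have [W [a [b [j [Sa fq bj ex ji]]]]] := pull_ses q' S.
have [ii sq e] := S; have [ii' sq' e'] := S'.
have [t tE] := pair_ex a b.
have ti : injective t by apply: injP => w; rewrite tE => -[]; apply: ji.
have [u uE] := pair_ex i' (\0 : {linear K' -> P}).
have [x|c cP] := @lin_lift _ _ _ _ t u ti.
  have [|w [aw bw]] := ex (i' x) 0; first by rewrite (ses0 _ S') linear0.
  by exists w; rewrite tE uE aw bw.
have Sb : sesm c b.
  split.
  - by apply: injP => x cx; apply: (inj0 ii'); have := cP x; rewrite cx linear0 uE => -[].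
  - move=> y; have [x qx] := sq' (q y).
    by have [w [_ bw]] := ex _ _ qx; exists w.
  move=> w; split=> [bw|[x <-]]; last by have := cP x; rewrite tE uE => -[].
  have /e'[x ix] : q' (a w) = 0 by rewrite fq bw linear0.
  by exists x; apply: ti; rewrite cP tE uE bw ix.
have [sa saK] : exists s : {linear P' -> W}, cancel s a by apply: proj_split => //; case: Sa.
have [sb sbK] : exists s : {linear P -> W}, cancel s b by apply: proj_split => //; case: Sb.
exact: iso_trans (iso_sym (ses_split Sa saK)) (ses_split Sb sbK).
Qed.

(** Let [F] cover [P * K] with kernel [L]. The kernel [W] of [F -> P] is a summand of [F], hence
    projective, and covers [K] with the same kernel [L]. *)
Lemma pd_summand n K P : projective_mod P -> pd n (P * K)%type -> pd n K.
Proof.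
move=> pP; case: n => [|n]; first exact: proj_retract (retract_snd P K).
move=> [L [F [i [q [pF S pL]]]]]; have [ii sq e] := S.
have [W [j [ji jP]]] := sub_ex (sclosed_ker (fst \o q)).
have [s sK] : exists s : {linear P -> F}, cancel s (fst \o q).
  by apply: proj_split => // p; have [f qf] := sq (p, 0); exists f; rewrite /= qf.
have [k|c cP] := @lin_lift _ _ _ _ j i ji; first by apply/jP; rewrite /= (ses0 _ S).
exists L, W, c, (snd \o q \o j); split=> //.
  have Sj : sesm j (fst \o q) by split; [exact: ji|move=> p; exists (s p); exact: sK|exact: jP].
  apply: proj_retract pF; apply: retract_trans (retract_snd P W) _.
  exact: iso_retract (iso_sym (ses_split Sj sK)).
split=> [|k|w].
- by apply: injP => l cl; apply: (inj0 ii); rewrite -cP cl linear0.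
- have [f qf] := sq (0, k); have /jP[w jw] : (fst \o q) f = 0 by rewrite /= qf.
  by exists w; rewrite /= jw qf.
rewrite /=; have q1 : (q (j w)).1 = 0 by apply/(jP (j w)); exists w.
split=> [q2|[l <-]]; last by rewrite cP (ses0 _ S).
have /e[l il] : q (j w) = 0 by case: (q (j w)) q1 q2 => ? ? /= -> ->.
by exists l; apply: ji; rewrite cP.
Qed.

Lemma pd_addP n K P : projective_mod P -> pd n K -> pd n (P * K)%type.
Proof.
move=> pP; case: n => [|n]; first exact: proj_prod.
move=> [L [F [i [q [pF S pL]]]]]; have [ii sq e] := S.
have [c cE] := pair_ex (\0 : {linear L -> P}) i.
have [d dE] := pair_ex (fst : {linear (P * F)%type -> P}) (q \o snd).
exists L, (P * F)%type, c, d; split=> //; first exact: proj_prod.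
split=> [|[p k]|[p f]].
- by apply: injP => l; rewrite cE => -[] /(inj0 ii).
- by have [f qf] := sq k; exists (p, f); rewrite dE /= qf.
rewrite dE /=; split=> [[-> /e[l <-]]|[l]]; first by exists l; rewrite cE.
by rewrite cE => -[<- <-]; rewrite (ses0 _ S).
Qed.

Lemma pd_syz n M K P (i : {linear K -> P}) (q : {linear P -> M}) :
  pd n.+1 M -> projective_mod P -> sesm i q -> pd n K.
Proof.
move=> [L [F [j [p [pF S pL]]]]] pP S'.
apply: (pd_summand pF); apply: pd_iso (iso_sym (schanuel pP pF S' S)) _.
exact: pd_addP.
Qed.

Lemma pd_mono n M : pd n M -> pd n.+1 M.
Proof.
elim: n M => [|n IH] M; last first.
  by move=> [K [P [i [q [pP S pK]]]]]; exists K, P, i, q; split=> //; apply: IH.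
move=> pM; have [Z zZ] := zero_mod_ex R.
exists Z, M, \0, idfun; split=> //; last exact: proj_zero.
split=> [x y _|x|x] /=; first by rewrite (zZ x) (zZ y).
  by exists x.
by split=> [->|[]//]; exists 0.
Qed.

Lemma pd_le n m M : (n <= m)%N -> pd n M -> pd m M.
Proof. by move=> nm h; rewrite -(subnK nm); elim: (m - n)%N => // k; apply: pd_mono. Qed.

Lemma horseshoe A B C K P L Q (i : {linear A -> B}) (p : {linear B -> C})
    (k : {linear K -> P}) (u : {linear P -> A})
    (l : {linear L -> Q}) (v : {linear Q -> C}) :
  projective_mod Q -> sesm i p -> sesm k u -> sesm l v ->
  exists (W : lmodType R) (w : {linear W -> (P * Q)%type})
      (t : {linear (P * Q)%type -> B}) (a : {linear K -> W}) (b : {linear W -> L}),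
    sesm w t /\ sesm a b.
Proof.
move=> pQ S Sk Sl; have [ii sp e] := S; have [ki su ek] := Sk; have [li sv el] := Sl.
have [t tP] := pQ _ _ p v sp.
have [h hE] := copair_ex (i \o u) t.
have sh : surj h.
  move=> y; have [z vz] := sv (p y).
  have /e[x ix] : p (y - t z) = 0 by rewrite linearB tP vz subrr.
  by have [x' ux] := su x; exists (x', z); rewrite hE /= ux ix subrK.
have [W [w Sw]] := ses_of_surj sh; have [wi _ ew] := Sw.
have hw z : h (w z) = 0 by apply/ew; exists z.
have vw z : v (w z).2 = 0.
  by rewrite -tP -(linear0 p) -(hw z) hE linearD /= (ses0 _ S) add0r.
have [z|b bP] := @lin_lift _ _ _ _ l (snd \o w) li; first by apply/el; apply: vw.
have [c cE] := pair_ex k (\0 : {linear K -> Q}).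
have [x|a aP] := @lin_lift _ _ _ _ w c wi.
  by apply/ew; rewrite hE cE /= (ses0 _ Sk) !linear0 addr0.
exists W, w, h, a, b; split=> //; split=> [|y|z].
- by apply: injP => x ax; apply: (inj0 ki); have := aP x; rewrite ax linear0 cE => -[].
- have /e[x ix] : p (t (l y)) = 0 by rewrite tP (ses0 _ Sl).
  have [x' ux] := su x.
  have /ew[z wz] : h (- x', l y) = 0 by rewrite hE /= linearN linearN ux ix addNr.
  by exists z; apply: li; rewrite bP /= wz.
split=> [bz|[x <-]]; last by apply: li; rewrite bP /= aP cE linear0.
have w2 : (w z).2 = 0 by have /= := bP z; rewrite bz linear0.
have /ek[x kx] : u (w z).1 = 0.
  by apply: (inj0 ii); have := hw z; rewrite hE w2 /= (linear0 t) addr0.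
by exists x; apply: wi; rewrite aP cE kx; case: (w z) w2 => ? ? /= ->.
Qed.

Lemma pd_ext n A B C (i : {linear A -> B}) (p : {linear B -> C}) :
  sesm i p -> pd n A -> pd n C -> pd n B.
Proof.
elim: n A B C i p => [|n IH] A B C i p S.
  move=> pA pC; have [s sK] : exists s : {linear C -> B}, cancel s p.
    by apply: proj_split => //; case: S.
  apply: proj_retract (iso_retract (ses_split S sK)) _; exact: proj_prod.
move=> [K [P [k [u [pP Sk pK]]]]] [L [Q [l [v [pQ Sl pL]]]]].
have [W [w [t [a [b [Sw Sa]]]]]] := horseshoe pQ S Sk Sl.
exists W, (P * Q)%type, w, t; split=> //; [exact: proj_prod|exact: IH Sa _ _].
Qed.

(** The kernel [L] of [P -> C] is the preimage of [A] in [P]: a syzygy of [C] is an extension of [A]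
    by a syzygy of [B]. *)
Lemma ses_rotate A B C K P (i : {linear A -> B}) (p : {linear B -> C})
    (k : {linear K -> P}) (u : {linear P -> B}) :
  sesm i p -> sesm k u ->
  exists (L : lmodType R) (l : {linear L -> P}) (a : {linear K -> L})
    (b : {linear L -> A}), sesm l (p \o u) /\ sesm a b.
Proof.
move=> S Sk; have [ii sp e] := S; have [ki su ek] := Sk.
have spu : surj (p \o u).
  by move=> z; have [y <-] := sp z; have [x <-] := su y; exists x.
have [L [l Sl]] := ses_of_surj spu; have [li _ el] := Sl.
have [x|b bP] := @lin_lift _ _ _ _ i (u \o l) ii.
  by apply/e; apply/el; exists x.
have [x|a aP] := @lin_lift _ _ _ _ l k li.
  by apply/el; rewrite /= (ses0 _ Sk) linear0.
exists L, l, a, b; split=> //; split=> [|y|x].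
- by apply: injP => x ax; apply: (inj0 ki); rewrite -aP ax linear0.
- have [x ux] := su (i y); have /el[z lz] : (p \o u) x = 0 by rewrite /= ux (ses0 _ S).
  by exists z; apply: ii; rewrite bP /= lz.
split=> [bx|[y <-]]; last by apply: ii; rewrite bP /= aP (ses0 _ Sk) linear0.
have /ek[y ky] : u (l x) = 0 by have /= := bP x; rewrite bx linear0.
by exists y; apply: li; rewrite aP.
Qed.

Lemma pd_quot n A B C (i : {linear A -> B}) (p : {linear B -> C}) :
  sesm i p -> pd n A -> pd n.+1 B -> pd n.+1 C.
Proof.
move=> S pA [K [P [k [u [pP Sk pK]]]]].
have [L [l [a [b [Sl Sa]]]]] := ses_rotate S Sk.
by exists L, P, l, (p \o u); split=> //; apply: pd_ext Sa pK pA.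
Qed.

(** The fibre product of [B] and [P] over [C] is an extension of [B] by [K], and also of [P] by [A],
    where it splits; so [A] has a projective complement in it. The two calls of [pull_ses] build it
    twice, whence the isomorphism at the end. *)
Lemma pd_sub n A B C (i : {linear A -> B}) (p : {linear B -> C}) :
  sesm i p -> pd n B -> pd n.+1 C -> pd n A.
Proof.
move=> S pB [K [P [k [u [pP Sk pK]]]]].
have [W [a [b [j [Sa fq bj ex ji]]]]] := pull_ses p Sk.
have [W' [a' [b' [j' [Sa' fq' bj' ex' ji']]]]] := pull_ses u S.
have [s sK] : exists s : {linear P -> W'}, cancel s a'.
  by apply: proj_split => //; case: Sa'.
apply: (pd_summand pP); apply: pd_iso (ses_split Sa' sK) _.
have pW : pd n W := pd_ext Sa pK pB.
apply: pd_iso pW.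
have [w|w'|c x y x' y'|f fP] := @rel_linear _ W W' (fun w w' => a w = b' w' /\ b w = a' w').
- by have [w' [? ?]] := ex' (b w) (a w) (esym (fq w)); exists w'.
- by rewrite !linear0 => -[h h']; apply: ji'.
- by move=> [h1 h2] [h3 h4]; rewrite !linearP h1 h2 h3 h4.
apply: (@mod_isoP _ _ _ f) => [|w'].
  apply: injP => w fw; have [] : a w = b' (f w) /\ b w = a' (f w) by apply/fP.
  by rewrite fw !linear0; apply: ji.
have [w [? ?]] := ex (b' w') (a' w') (esym (fq' w')).
by exists w; apply/esym/fP.
Qed.

(** A cover [P] of [X * Y] covers each factor. After doubling it, the product [K1 * K2] of the two
    kernels is a syzygy of [X * Y] itself, so the induction applies. *)
Lemma pd_prod n X Y : pd n (X * Y)%type -> pd n X.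
Proof.
elim: n X Y => [|n IH] X Y; first exact/proj_retract/retract_fst.
move=> pXY; have [K [P [i [q [pP S pK]]]]] := pXY; have [_ sq _] := S.
have s1 : surj (fst \o q) by move=> x; have [p qp] := sq (x, 0); exists p; rewrite /= qp.
have s2 : surj (snd \o q) by move=> x; have [p qp] := sq (0, x); exists p; rewrite /= qp.
have [K1 [k1 S1]] := ses_of_surj s1; have [K2 [k2 S2]] := ses_of_surj s2.
exists K1, P, k1, (fst \o q); split=> //; apply: (IH _ K2).
have [k kE] := pair_ex (k1 \o fst : {linear (K1 * K2)%type -> _}) (k2 \o snd).
have [u uE] := pair_ex (fst \o q \o fst : {linear (P * P)%type -> _}) (snd \o q \o snd).
apply: (pd_syz pXY) (proj_prod pP pP) (_ : sesm k u).
have [i1 _ e1] := S1; have [i2 _ e2] := S2; split=> [|[x y]|[p p']].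
- by apply: injP => -[x y]; rewrite kE /= => -[/(inj0 i1)-> /(inj0 i2)->].
- have [p px] := s1 x; have [p' py] := s2 y.
  by exists (p, p'); rewrite uE /=; congr (_, _).
rewrite uE; split=> [[/e1[x <-] /e2[y <-]]|[[x y]]]; first by exists (x, y); rewrite kE.
by rewrite kE => -[<- <-] /=; congr (_, _); [apply: (ses0 x S1)|apply: (ses0 y S2)].
Qed.

Lemma pd_retract n X Y : retract X Y -> pd n Y -> pd n X.
Proof. by move=> /retractP[Z iso] /(pd_iso iso); apply: pd_prod. Qed.

Definition pdf M : Prop := exists n, pd n M.

Lemma pdf_quot A B C (i : {linear A -> B}) (p : {linear B -> C}) :
  sesm i p -> pdf A -> pdf B -> pdf C.
Proof.
move=> S [n pA] [m pB]; exists (maxn n m).+1; apply: pd_quot S _ _.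
  by apply: pd_le pA; rewrite leq_maxl.
by apply: pd_le pB; rewrite leqW ?leq_maxr.
Qed.
Lemma pdf_sub A B C (i : {linear A -> B}) (p : {linear B -> C}) :
  sesm i p -> pdf B -> pdf C -> pdf A.
Proof.
move=> S [n pA] [m pB]; exists (maxn n m); apply: pd_sub S _ _.
  by apply: pd_le pA; rewrite leq_maxl.
by apply: pd_le pB; rewrite leqW ?leq_maxr.
Qed.
Lemma pdf_ext A B C (i : {linear A -> B}) (p : {linear B -> C}) :
  sesm i p -> pdf A -> pdf C -> pdf B.
Proof.
move=> S [n pA] [m pB]; exists (maxn n m); apply: pd_ext S _ _.
  by apply: pd_le pA; rewrite leq_maxl.
by apply: pd_le pB; rewrite ?leq_maxr.
Qed.
Lemma pdf_retract X Y : retract X Y -> pdf Y -> pdf X.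
Proof. by move=> r [n p]; exists n; apply: pd_retract r p. Qed.
Lemma pdf_proj P : projective_mod P -> pdf P.
Proof. by exists 0. Qed.
End Extensions.

(** * Resolutions and Ext *)

Section FinGen.
Variable R : pzRingType.
Implicit Types A B C F K L M N P Q W X Y Z : lmodType R.

Lemma fgP M : fin_gen M <->
  exists s : seq M, forall P : M -> Prop, sclosed P ->
    (forall x, x \in s -> P x) -> forall y, P y.
Proof.
split=> [[s sP]|[s sP]]; exists s.
  move=> P cP Ps y; have [c ->] := sP y; apply: sclosed_sum => // i _.
  by apply: sclosedZ => //; apply/Ps/mem_nth.
apply: sP => [|x xs].
  split; first by exists (fun=> 0); rewrite big1 // => i _; rewrite scale0r.
  move=> a _ _ [c ->] [d ->]; exists (fun i => a * c i + d i).
  rewrite scaler_sumr -big_split; apply: eq_bigr => i _.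
  by rewrite scalerDl scalerA.
have xi : (index x s < size s)%N by rewrite index_mem.
exists (fun i => if i == index x s then 1 else 0); rewrite (bigD1 (Ordinal xi)) //=.
rewrite eqxx scale1r nth_index // big1 ?addr0 // => i.
by rewrite -val_eqE /= => /negPf->; rewrite scale0r.
Qed.

Lemma fg_cover M : fin_gen M ->
  exists k (q : {linear dsum (fun _ : 'I_k => R^o) -> M}), surj q.
Proof.
move=> [s sP]; pose f (i : 'I_(size s)) := sval (cid (cyc_ex s`_i)).
have fE i (a : R) : f i a = a *: s`_i by rewrite /f; case: cid.
have [q [qE qP]] := dcotup_ex f; exists (size s), q => x; have [c ->] := sP x.
have [t tE] := dtup_ex (fun i : 'I_(size s) => sval (cid (cyc_ex (X := R^o) (c i)))).
exists (t 1); rewrite qE; apply: eq_bigr => i _; rewrite tE; case: cid => h /= ->.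
by rewrite fE; congr (_ *: _); apply: mul1r.
Qed.

Lemma fg_surj X Y (q : {linear X -> Y}) : surj q -> fin_gen X -> fin_gen Y.
Proof.
move=> sq /fgP[s sP]; apply/fgP; exists (map q s) => P cP Ps y.
have [x <-] := sq y; apply: (sP _ (sclosed_preim q cP)) => z zs.
by apply: Ps; apply: map_f.
Qed.

Lemma fg_retract X Y : retract X Y -> fin_gen Y -> fin_gen X.
Proof. by move=> [s [r rs]]; apply: (@fg_surj _ _ r) => x; exists (s x). Qed.

Lemma fg_iso X Y : mod_iso X Y -> fin_gen X -> fin_gen Y.
Proof. by move=> /iso_sym/iso_retract; apply: fg_retract. Qed.

Lemma fg_ext A B C (i : {linear A -> B}) (p : {linear B -> C}) :
  sesm i p -> fin_gen A -> fin_gen C -> fin_gen B.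
Proof.
move=> [ii sp e] /fgP[s sP] /fgP[t tP].
pose u c := sval (cid (sp c)); have uE c : p (u c) = c by rewrite /u; case: cid.
apply/fgP; exists (map i s ++ map u t) => P cP PS.
have Pi x : P (i x).
  apply: (sP _ (sclosed_preim i cP)) => z zs; apply: PS.
  by rewrite mem_cat map_f.
have PK y : p y = 0 -> P y by move=> /e[x <-].
suff H c : exists y, P y /\ p y = c.
  move=> y; have [z [Pz pz]] := H (p y).
  rewrite -[y](subrK z); apply: sclosedD => //; apply: PK.
  by rewrite linearB pz subrr.
apply: (tP (fun c => exists y, P y /\ p y = c)) => [|z zt].
  split; first by exists 0; rewrite linear0; case: cP.
  move=> a _ _ [y [Py <-]] [z [Pz <-]]; exists (a *: y + z); rewrite linearP.
  by split=> //; case: cP => _; apply.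
by exists (u z); split=> //; apply: PS; rewrite mem_cat map_f ?orbT.
Qed.

Lemma fg_prod X Y : fin_gen X -> fin_gen Y -> fin_gen (X * Y)%type.
Proof. by have [h hE] := inl_ex X Y; apply: fg_ext (ses_prod hE). Qed.

Lemma fg_zero Z : zero_mod Z -> fin_gen Z.
Proof. by move=> zZ; exists [::] => x; exists (fun=> 0); rewrite big_ord0 (zZ x). Qed.

Lemma dsum_ind (C : lmodType R -> Prop) :
  (forall Z, zero_mod Z -> C Z) ->
  (forall X Y, C X -> C Y -> C (X * Y)%type) ->
  (forall X Y, mod_iso X Y -> C X -> C Y) ->
  forall k (A : 'I_k -> lmodType R), (forall i, C (A i)) -> C (dsum A).
Proof.
move=> C0 CX Ci; elim=> [|k IH] A CA; first by apply: C0; apply: dsum0_zero.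
apply: Ci (iso_sym (dsum_recl A)) _; apply: CX => //; apply: IH => i; exact: CA.
Qed.

Lemma fg_dsum k (A : 'I_k -> lmodType R) : (forall i, fin_gen (A i)) -> fin_gen (dsum A).
Proof. by apply: dsum_ind; [exact: fg_zero|exact: fg_prod|exact: fg_iso]. Qed.

Lemma fg_reg : fin_gen R^o.
Proof.
apply/fgP; exists [:: (1 : R)] => P cP P1 y.
have -> : y = (y : R) *: (1 : R^o) by rewrite /GRing.scale /= mulr1.
by apply: sclosedZ => //; apply: P1; rewrite mem_head.
Qed.

Lemma fg_free k : fin_gen (dsum (fun _ : 'I_k => R^o)).
Proof. by apply: fg_dsum => i; apply: fg_reg. Qed.
Lemma proj_free k : projective_mod (dsum (fun _ : 'I_k => R^o)).
Proof. by apply: proj_dsum => i; apply: proj_reg. Qed.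

(** Trades the arbitrary projective cover hidden in [pd] for a free one of finite rank. *)
Lemma fg_syz n M : fin_gen M -> pd n.+1 M ->
  exists (K F : lmodType R) (i : {linear K -> F}) (q : {linear F -> M}),
    [/\ sesm i q, projective_mod F, fin_gen F & pd n K].
Proof.
move=> /fg_cover[k [q sq]] p; have [K [i S]] := ses_of_surj sq.
exists K, (dsum (fun _ : 'I_k => R^o)), i, q; split=> //.
- exact: proj_free.
- exact: fg_free.
- exact: pd_syz p (@proj_free k) S.
Qed.

Section ShiftResolution.
Variables (X : lmodType R) (P : proj_resolution X) (K : lmodType R).
Variables (i : {linear K -> P 0%N}) (S : sesm i (pr_aug P)).
Variables (d : {linear P 1%N -> K}) (dP : forall x, i (d x) = pr_diff P 0 x).

Lemma shift_surj x : exists y, d y = x.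
Proof.
have [ii _ e] := S; have /pr_exact0[y yE] : pr_aug P (i x) = 0 by apply: ses0 S.
by exists y; apply: ii; rewrite dP.
Qed.
Lemma shift_exact0 : exact_at (pr_diff P 1) d.
Proof.
move=> y; rewrite -(@pr_exactS _ _ P 0 y) -dP; split=> [->|]; first exact: linear0.
by case: S => ii _ _ /(inj0 ii).
Qed.
Definition shift_res : proj_resolution K :=
  @ProjResolution R K (fun n => P n.+1) (fun n => pr_diff P n.+1) d
    (fun n => @pr_proj _ _ P n.+1) shift_surj shift_exact0 (fun n => @pr_exactS _ _ P n.+1).
End ShiftResolution.

Lemma res_ses X (P : proj_resolution X) :
  exists (K : lmodType R) (i : {linear K -> P 0%N}) (d : {linear P 1%N -> K}),
    sesm i (pr_aug P) /\ forall x, i (d x) = pr_diff P 0 x.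
Proof.
have [K [i S]] := ses_of_surj (@pr_surj _ _ P); have [ii _ e] := S.
have [x|d dP] := @lin_lift _ _ _ _ i (pr_diff P 0) ii; last by exists K, i, d.
by apply/e/(@pr_exact0 _ _ P); exists x.
Qed.

Lemma pdim_le_pd n M : pdim_le n M -> pd n M.
Proof.
elim: n M => [|n IH] M [P zP].
  apply: proj_retract (@pr_proj _ _ P 0); apply: iso_retract; apply: iso_sym.
  apply: (@mod_isoP _ _ _ (pr_aug P)); last exact: pr_surj.
  by apply: injP => x /(@pr_exact0 _ _ P)[y <-]; rewrite (zP 1%N isT y) linear0.
have [K [i [d [S dP]]]] := res_ses P.
exists K, (P 0%N), i, (pr_aug P); split=> //; first exact: pr_proj.
by apply: IH; exists (shift_res S dP) => k nk; apply: zP.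
Qed.

Section SpliceResolution.
Variables (X F K : lmodType R) (i : {linear K -> F}) (q : {linear F -> X}).
Variables (pF : projective_mod F) (S : sesm i q) (P : proj_resolution K).
Let obj n : lmodType R := match n with 0 => F | n'.+1 => P n' end.
Let diff n : {linear obj n.+1 -> obj n} :=
  match n return {linear obj n.+1 -> obj n} with
  | 0 => i \o pr_aug P | n'.+1 => pr_diff P n' end.
Lemma splice_proj n : projective_mod (obj n).
Proof. by case: n => //= n; apply: pr_proj. Qed.
Lemma splice_exact0 : exact_at (diff 0) q.
Proof.
have [ii sq e] := S => y; rewrite e /=; split=> [[k <-]|[x <-]]; last by exists (pr_aug P x).
by have [x <-] := @pr_surj _ _ P k; exists x.
Qed.
Lemma splice_exactS n : exact_at (diff n.+1) (diff n).
Proof.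
case: n => [|n] y; last exact: pr_exactS.
rewrite -(@pr_exact0 _ _ P y) /=; split=> [|->]; last exact: linear0.
by case: S => ii _ _ /(inj0 ii).
Qed.
Definition splice_res : proj_resolution X :=
  @ProjResolution R X obj diff q splice_proj (let: And3 _ sq _ := S in sq)
    splice_exact0 splice_exactS.
End SpliceResolution.

Lemma zero_res Z : zero_mod Z -> exists P : proj_resolution Z, forall n, zero_mod (P n).
Proof.
move=> zZ; have e (y : Z) : (\0 : {linear Z -> Z}) y = 0 <-> exists x, (\0 : {linear Z -> Z}) x = y.
  by split=> // _; exists 0; rewrite /= (zZ y).
have s (x : Z) : exists y, (\0 : {linear Z -> Z}) y = x by exists 0; rewrite (zZ x).
by exists (@ProjResolution R Z (fun=> Z) (fun=> \0) \0 (fun=> proj_zero zZ) s e (fun=> e)).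
Qed.

Lemma pd_pdim_le n M : pd n M -> pdim_le n M.
Proof.
elim: n M => [|n IH] M; last first.
  move=> [K [F [i [q [pF S /IH[P zP]]]]]].
  by exists (splice_res pF S P) => -[|k] //; rewrite ltnS; apply: zP.
move=> pM; have [Z zZ] := zero_mod_ex R; have [P zP] := zero_res zZ.
have S : sesm (\0 : {linear Z -> M}) idfun.
  split=> [x y _|x|x] /=; first by rewrite (zZ x) (zZ y).
    by exists x.
  by split=> [->|[]//]; exists 0.
by exists (splice_res pM S P) => -[|k] // _ /=; apply: zP.
Qed.

(** A coresolution cut into short exact sequences. Index [n] means terms 0 to [n], the last cosyzygy
    lying in [C], as in the convention [j <= s] of [tilting]. *)
Fixpoint cores (C : lmodType R -> Prop) n M : Prop :=
  match n with
  | 0 => C M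
  | n'.+1 => exists (A M' : lmodType R) (i : {linear M -> A}) (q : {linear A -> M'}),
      [/\ C A, sesm i q & cores C n' M']
  end.

Section ShiftCoresolution.
Variables (X : lmodType R) (C : coresolution X) (Q : lmodType R).
Variables (q : {linear C 0%N -> Q}) (S : sesm (cr_coaug C) q).
Variables (d : {linear Q -> C 1%N}) (dP : forall x, d (q x) = cr_diff C 0 x).

Lemma shift_inj : injective d.
Proof.
apply: injP => y; have [_ sq _] := S; have [x <-] := sq y.
by rewrite dP => /(@cr_exact0 _ _ C)[z <-]; apply: ses0 S.
Qed.
Lemma shift_coexact0 : exact_at d (cr_diff C 1).
Proof.
move=> y; rewrite (@cr_exactS _ _ C 0 y); split=> [[x <-]|[x <-]].
  by exists (q x).
by have [_ sq _] := S; have [z <-] := sq x; exists z; rewrite dP.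
Qed.
Definition shift_cores : coresolution Q :=
  @Coresolution R Q (fun n => C n.+1) (fun n => cr_diff C n.+1) d
    shift_inj shift_coexact0 (fun n => @cr_exactS _ _ C n.+1).
End ShiftCoresolution.

Lemma coresolution_cores (T : lmodType R -> Prop) n M (C : coresolution M) :
  (forall X Y, mod_iso X Y -> T X -> T Y) ->
  (forall j, (j <= n)%N -> T (C j)) -> (forall j, (n < j)%N -> zero_mod (C j)) ->
  cores T n M.
Proof.
move=> Ti; elim: n M C => [|n IH] M C TC zC.
  apply: Ti (TC 0%N isT); apply: iso_sym; apply: (@mod_isoP _ _ _ (cr_coaug C)).
    exact: cr_inj.
  by move=> y; apply/(@cr_exact0 _ _ C); apply: zC.
have [Q [q S]] := ses_of_inj (@cr_inj _ _ C); have [_ sq e] := S.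
have [x /e[y <-]|d dP] := @lin_fact _ _ _ _ q (cr_diff C 0) sq.
  by apply/(@cr_exact0 _ _ C); exists y.
exists (C 0%N), Q, (cr_coaug C), q; split=> //; first exact: TC.
by apply: (IH _ (shift_cores S dP)) => j jn; [apply: TC|apply: zC].
Qed.

Section SpliceCoresolution.
Variables (X A Q : lmodType R) (i : {linear X -> A}) (q : {linear A -> Q}).
Variables (S : sesm i q) (C : coresolution Q).
Let obj n : lmodType R := match n with 0 => A | n'.+1 => C n' end.
Let diff n : {linear obj n -> obj n.+1} :=
  match n return {linear obj n -> obj n.+1} with
  | 0 => cr_coaug C \o q | n'.+1 => cr_diff C n' end.
Lemma splice_coexact0 : exact_at i (diff 0).
Proof.
have [ii sq e] := S => y; rewrite -e /=; split=> [|->]; last exact: linear0.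
exact: (inj0 (@cr_inj _ _ C)).
Qed.
Lemma splice_coexactS n : exact_at (diff n) (diff n.+1).
Proof.
case: n => [|n] y; last exact: (@cr_exactS _ _ C n y).
rewrite [_ = 0](@cr_exact0 _ _ C y) /=; split=> [[x <-]|[x <-]]; last by exists (q x).
by have [_ sq _] := S; have [z <-] := sq x; exists z.
Qed.
Definition splice_cores : coresolution X :=
  @Coresolution R X obj diff i (let: And3 ii _ _ := S in ii)
    splice_coexact0 splice_coexactS.
End SpliceCoresolution.

Lemma zero_cores Z : zero_mod Z -> exists C : coresolution Z, forall n, zero_mod (C n).
Proof.
move=> zZ; have e (y : Z) : (\0 : {linear Z -> Z}) y = 0 <-> exists x, (\0 : {linear Z -> Z}) x = y.
  by split=> // _; exists 0; rewrite /= (zZ y).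
have s : injective (\0 : {linear Z -> Z}) by move=> x y _; rewrite (zZ x) (zZ y).
by exists (@Coresolution R Z (fun=> Z) (fun=> \0) \0 s e (fun=> e)).
Qed.

Lemma cores_coresolution (T : lmodType R -> Prop) n M : cores T n M ->
  exists C : coresolution M,
  (forall j, (j <= n)%N -> T (C j)) /\ (forall j, (n < j)%N -> zero_mod (C j)).
Proof.
elim: n M => [|n IH] M.
  move=> TM; have [Z zZ] := zero_mod_ex R; have [C zC] := zero_cores zZ.
  have S : sesm idfun (\0 : {linear M -> Z}).
    split=> [x y //|x|x] /=; first by exists 0; rewrite (zZ x).
    by split=> // _; exists x.
  by exists (splice_cores S C); split=> -[|j] // _; apply: zC.
move=> [A [M' [i [q [TA S /IH[C [TC zC]]]]]]].
by exists (splice_cores S C); split=> -[|j] //; [apply: TC|apply: zC].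
Qed.

(** [Ext_zero] quantifies over all resolutions and yields information only once one is at hand;
    finite projective dimension supplies it. *)
Lemma Ext_zero_ext1 X N : pdim_finite X -> Ext_zero 1 X N -> ext1 X N.
Proof.
move=> [d [P _]] E; have [K [i [p [S pP]]]] := res_ses P.
have [ii sq e] := S.
apply: (ext1_pres (@pr_proj _ _ P 0) S) => f.
have [x|g gP] := E P (f \o p).
  by rewrite /= (_ : p _ = 0) ?linear0 //; apply: (inj0 ii); rewrite pP; apply/(@pr_exactS _ _ P 0); exists x.
exists g => k; have /(@pr_exact0 _ _ P)[y yE] := ses0 k S.
by rewrite -yE -gP /=; congr (f _); apply: ii; rewrite pP.
Qed.

Lemma ext1_Ext_zero1 X N : ext1 X N -> Ext_zero 1 X N.
Proof.
move=> E P f fP; have [K [i [p [S pP]]]] := res_ses P.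
have [|g gP] := @lin_fact _ _ _ _ p f (shift_surj S pP).
  move=> x px; have /(@pr_exactS _ _ P 0)[y <-] : pr_diff P 0 x = 0 by rewrite -pP px linear0.
  exact: fP.
by have [h hP] := E _ _ _ _ S g; exists h => x; rewrite -pP hP gP.
Qed.

(** Dimension shift inside a class stable under syzygies. Stability is asked for arbitrary
    projective [F], because the resolutions in [Ext_zero] are arbitrary. *)
Lemma ext1_Ext_zero (C : lmodType R -> Prop) N :
  (forall X, C X -> ext1 X N) ->
  (forall X K F (i : {linear K -> F}) (q : {linear F -> X}),
    C X -> projective_mod F -> sesm i q -> C K) ->
  forall n X, C X -> Ext_zero n.+1 X N.
Proof.
move=> CE CS; elim=> [|n IH] X CX; first exact/ext1_Ext_zero1/CE.
move=> P f fP; have [K [i [p [S pP]]]] := res_ses P.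
have CK := CS _ _ _ _ _ CX (@pr_proj _ _ P 0) S.
exact: (IH K CK (shift_res S pP) f fP).
Qed.

Definition pfin M := fin_gen M /\ pdf M.

Lemma PfinP M : Pfin M <-> pfin M.
Proof.
split=> -[fM [n h]]; split=> //; exists n; first exact: pdim_le_pd.
exact: pd_pdim_le.
Qed.

Definition noeth : Prop := forall M N (i : {linear N -> M}),
  injective i -> fin_gen M -> fin_gen N.

Lemma pfin_iso X Y : mod_iso X Y -> pfin X -> pfin Y.
Proof.
move=> iso [fX pX]; split; first exact: fg_iso iso fX.
by apply: pdf_retract pX; apply/iso_retract/iso_sym.
Qed.
Lemma pfin_retract X Y : retract X Y -> pfin Y -> pfin X.
Proof. by move=> r [fY pY]; split; [apply: fg_retract r fY|apply: pdf_retract r pY]. Qed.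
Lemma pfin_quot A B C (i : {linear A -> B}) (p : {linear B -> C}) :
  sesm i p -> pfin A -> pfin B -> pfin C.
Proof.
move=> S [fA pA] [fB pB]; split; last exact: pdf_quot S pA pB.
by case: S => _ sp _; apply: fg_surj sp fB.
Qed.
Lemma pfin_ext A B C (i : {linear A -> B}) (p : {linear B -> C}) :
  sesm i p -> pfin A -> pfin C -> pfin B.
Proof.
by move=> S [fA pA] [fC pC]; split; [exact: fg_ext S fA fC|exact: pdf_ext S pA pC].
Qed.
Lemma pfin_sub A B C (i : {linear A -> B}) (p : {linear B -> C}) :
  noeth -> sesm i p -> pfin B -> pfin C -> pfin A.
Proof.
move=> nR S [fB pB] [fC pC]; split; last exact: pdf_sub S pB pC.
by case: S => ii _ _; apply: nR ii fB.
Qed.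
Lemma pfin_zero Z : zero_mod Z -> pfin Z.
Proof. by move=> zZ; split; [exact: fg_zero|exact/pdf_proj/proj_zero]. Qed.
Lemma pfin_prod X Y : pfin X -> pfin Y -> pfin (X * Y)%type.
Proof. by have [h hE] := inl_ex X Y; apply: pfin_ext (ses_prod hE). Qed.
Lemma pfin_dsum k (A : 'I_k -> lmodType R) : (forall i, pfin (A i)) -> pfin (dsum A).
Proof. by apply: dsum_ind; [exact: pfin_zero|exact: pfin_prod|exact: pfin_iso]. Qed.
Lemma pfin_proj P : fin_gen P -> projective_mod P -> pfin P.
Proof. by move=> fP /pdf_proj. Qed.

Lemma pfin_syz X : noeth -> pfin X ->
  exists (K F : lmodType R) (i : {linear K -> F}) (q : {linear F -> X}),
    [/\ sesm i q, projective_mod F, fin_gen F & pfin K].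
Proof.
move=> nR [fX [n p]]; have [K [F [i [q [S pF fF pK]]]]] := fg_syz fX (pd_mono p).
exists K, F, i, q; split=> //; split; last by exists n.
by case: S => ii _ _; apply: nR ii fF.
Qed.

(* Syzygies in an arbitrary projective resolution agree with finitely generated
   ones only up to projective summands. *)
Definition stably_pfin X : Prop := exists (X0 Q Q' : lmodType R),
  [/\ pfin X0, projective_mod Q, projective_mod Q' & mod_iso (X * Q)%type (X0 * Q')%type].

(** Adding [Q] and [Q'] to the two covers makes them cover the same module without changing the
    kernels [K] and [K0], which Schanuel's lemma then compares. *)
Lemma stably_pfin_syz X K F (i : {linear K -> F}) (q : {linear F -> X}) :
  noeth -> stably_pfin X -> projective_mod F -> sesm i q -> stably_pfin K.
Proof.
move=> nR [X0 [Q [Q' [pX0 pQ pQ' iso]]]] pF S.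
have [K0 [F0 [i0 [q0 [S0 pF0 fF0 pK0]]]]] := pfin_syz nR pX0.
have [f [g [fg gf]]] := isoE iso.
have add (U V W Q1 : lmodType R) (j : {linear U -> V}) (p : {linear V -> W}) : sesm j p ->
    exists (j' : {linear U -> (V * Q1)%type}) (p' : {linear (V * Q1)%type -> (W * Q1)%type}),
    sesm j' p'.
  move=> Sj; have [ji sp e] := Sj.
  have [j' j'E] := pair_ex j (\0 : {linear U -> Q1}).
  have [p' p'E] := pair_ex (p \o fst : {linear (V * Q1)%type -> _}) snd.
  exists j', p'; split=> [|[w x]|[v x]].
  - by apply: injP => u; rewrite j'E => -[/(inj0 ji)].
  - by have [v <-] := sp w; exists (v, x); rewrite p'E.
  rewrite p'E /=; split=> [[/e[u <-] ->]|[u]]; first by exists u; rewrite j'E.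
  by rewrite j'E => -[<- <-]; rewrite (ses0 _ Sj).
have [i1 [q1 S1]] := add _ _ _ Q _ _ S; have [i2 [q2 S2]] := add _ _ _ Q' _ _ S0.
have S3 := iso_ses fg gf S1.
have pa := proj_prod pF pQ; have pb := proj_prod pF0 pQ'.
exists K0, (F0 * Q')%type, (F * Q)%type; split=> //.
apply: iso_trans (prod_isoC _ _) _; apply: iso_trans (schanuel pa pb S3 S2) _.
exact: prod_isoC.
Qed.

Lemma pfin_Ext_zero X N : noeth -> (forall Y, pfin Y -> ext1 Y N) -> pfin X ->
  forall i, (1 <= i)%N -> Ext_zero i X N.
Proof.
move=> nR E pX [|n] // _; apply: (@ext1_Ext_zero stably_pfin) => [Y|Y K F i q CY pF S|].
- move=> [Y0 [Q [Q' [pY pQ pQ' iso]]]]; apply: ext1_retractX (retract_fst Y Q) _.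
  apply: ext1_retractX (iso_retract iso) _; have [h hE] := inl_ex Y0 Q'.
  exact: ext1_mid (ses_prod hE) (E _ pY) (ext1_proj pQ').
- exact: stably_pfin_syz nR CY pF S.
have [Z zZ] := zero_mod_ex R; exists X, Z, Z.
by split=> //; [exact: proj_zero|exact: proj_zero|exact: iso_refl].
Qed.

(* By dimension shifting, Ext^1(X, N_d) = Ext^(d+1)(X, N) = 0 for the d-th
   cosyzygy N_d of N, so N_d is a summand of the next term. *)
Lemma cores_ex (C B : lmodType R -> Prop) d : noeth ->
  (forall X, pfin X -> pd d X) ->
  (forall X Y, retract X Y -> C Y -> C X) ->
  (forall N, B N -> pfin N) ->
  (forall N, B N -> exists (I N' : lmodType R) (i : {linear N -> I}) (q : {linear I -> N'}),
     [/\ sesm i q, C I, B N' & forall X, pfin X -> ext1 X I]) ->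
  forall N, B N -> cores C d N.
Proof.
move=> nR bd Cr BP H.
pose ei k N := forall X, pfin X -> pd k X -> ext1 X N.
have step k N (I N' : lmodType R) (i : {linear N -> I}) (q : {linear I -> N'}) :
    sesm i q -> (forall X, pfin X -> ext1 X I) -> ei k N -> ei k.+1 N'.
  move=> S EI eN X [fX pX] /(fg_syz fX)[K [F [j [p [Sj pF fF pK]]]]].
  have pfK : pfin K by split; [case: Sj => ji _ _; apply: nR ji fF|exists k].
  by apply: (ext1_shiftN pF Sj S (eN K pfK pK)); apply: EI.
suff G j k N : (j + k = d)%N -> B N -> ei k N -> cores C j N.
  move=> N pN; apply: (G d 0%N) => //; first exact: addn0.
  by move=> X _ pX; apply: ext1_proj.
elim: j k N => [|j IH] k N jk pN eN; have [I [N' [i [q [S CI pN' EI]]]]] := H N pN.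
  have pk : pd k N' by rewrite -[k]add0n jk; apply: bd (BP _ pN').
  by have [r rK] := ext1_split (eN N' (BP _ pN') pk) S; apply: Cr CI; exists i, r.
exists I, N', i, q; split=> //; apply: (IH k.+1) => //; first by rewrite addnS.
exact: step S EI eN.
Qed.

Lemma proj_fg_retract P : projective_mod P -> fin_gen P ->
  exists k, retract P (dsum (fun _ : 'I_k => R^o)).
Proof.
move=> pP /fg_cover[k [q sq]]; exists k.
by have [s sK] := proj_split pP sq; exists s, q.
Qed.

Fixpoint syzn n X : Prop :=
  match n with
  | 0 => pfin X
  | n'.+1 => exists (X1 F : lmodType R) (i : {linear X -> F}) (q : {linear F -> X1}),
      [/\ sesm i q, projective_mod F, fin_gen F & syzn n' X1]
  end.

Lemma syzn_pfin n X : noeth -> syzn n X -> pfin X.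
Proof.
move=> nR; elim: n X => // n IH X [X1 [F [i [q [S pF fF /IH pX1]]]]].
by apply: pfin_sub nR S (pfin_proj fF pF) pX1.
Qed.

Lemma syznW n X : noeth -> syzn n.+1 X -> syzn n X.
Proof.
move=> nR; elim: n X => [|n IH] X; first exact: syzn_pfin.
by move=> [X1 [F [i [q [S pF fF sX1]]]]]; exists X1, F, i, q; split=> //; apply: IH.
Qed.

(** Ext^1 of an [n]-th syzygy is Ext^(n+1) of the original module, and a coresolution of length [n]
    with Ext-acyclic terms kills it. *)
Lemma syzn_ext1 (C : lmodType R -> Prop) n Z X : noeth ->
  (forall A, C A -> forall X, pfin X -> ext1 X A) ->
  cores C n Z -> syzn n X -> ext1 X Z.
Proof.
move=> nR E; elim: n Z X => [|n IH] Z X; first by move=> /E; apply.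
move=> [A [Z' [i [q [CA S cZ']]]]] sX.
have pX := syzn_pfin nR sX; move: sX => [X1 [F [j [p [Sj pF fF sX1]]]]].
exact: ext1_shiftX pF Sj S (IH _ _ cZ' sX1) (E _ CA _ pX).
Qed.

(* If Ext(-, R) vanishes on high syzygies, then a nonprojective high syzygy would
   have a nonsplit last step in its finite projective resolution. *)
Lemma pd_bound (C : lmodType R -> Prop) d : noeth ->
  (forall A, C A -> forall X, pfin X -> ext1 X A) ->
  cores C d R^o -> forall X, pfin X -> pd d X.
Proof.
move=> nR E cR; have G t K : syzn d K -> pd t K -> projective_mod K.
  elim: t K => // t IH K sK pK; have pfK := syzn_pfin nR sK.
  have [L [F [i [q [S pF fF pL]]]]] := fg_syz (proj1 pfK) pK.
  have sL : syzn d L by apply: syznW => //; exists K, F, i, q.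
  have [k rL] := proj_fg_retract (IH _ sL pL) (proj1 (syzn_pfin nR sL)).
  have EKL : ext1 K L.
    by apply: ext1_retractN rL _; apply: ext1_dsumN => _; apply: syzn_ext1 nR E cR sK.
  have [r rK] := ext1_split EKL S; have [s sqK] := ses_splitl S rK.
  by apply: proj_retract pF; exists s, q.
suff H n j X : (n + j = d)%N -> syzn j X -> pd n X.
  by move=> X pX; apply: (H d 0%N) => //; rewrite addn0.
elim: n j X => [|n IH] j X.
  rewrite add0n => -> sX; have [_ [t p]] := syzn_pfin nR sX; exact: G p.
move=> jd sX; have [fX [t p]] := syzn_pfin nR sX.
have [K [F [i [q [S pF fF _]]]]] := fg_syz fX (pd_mono p).
exists K, F, i, q; split=> //; apply: (IH j.+1); first by rewrite addnS.
by exists X, F, i, q.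
Qed.
End FinGen.

(** * Finite length and Krull-Remak-Schmidt *)

Section FiniteLength.
Variable R : pzRingType.
Implicit Types A B C F K L M N P Q W X Y Z : lmodType R.

(* M has length at most n. *)
Fixpoint flen n M : Prop :=
  match n with
  | 0 => zero_mod M
  | n'.+1 => forall Q (q : {linear M -> Q}), surj q ->
      (exists x, x <> 0 /\ q x = 0) -> flen n' Q
  end.

Definition fl M := exists n, flen n M.

Lemma flen_surj n X Y (q : {linear X -> Y}) : surj q -> flen n X -> flen n Y.
Proof.
case: n => [|n] sq fX /=.
  by move=> y; have [x <-] := sq y; rewrite (fX x) linear0.
move=> Q p sp [y [y0 py]]; have [x qx] := sq y.
apply: (fX _ (p \o q)) => [z|].
  by have [y' <-] := sp z; have [x' <-] := sq y'; exists x'.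
by exists x; split=> [x0|] /=; [apply: y0; rewrite -qx x0 linear0|rewrite qx].
Qed.

Lemma flen_iso n X Y : mod_iso X Y -> flen n X -> flen n Y.
Proof. by move=> [f /bij_injsurj[_ sf]]; apply: flen_surj sf. Qed.
Lemma flenS n M : flen n M -> flen n.+1 M.
Proof. by move=> fM Q q sq _; apply: flen_surj sq fM. Qed.
Lemma flen_le m n M : (m <= n)%N -> flen m M -> flen n M.
Proof. by move=> mn fM; rewrite -(subnK mn); elim: (n - m)%N => // k; apply: flenS. Qed.

Lemma im_fact X Y (f : {linear X -> Y}) :
  exists (I : lmodType R) (u : {linear X -> I}) (v : {linear I -> Y}),
    [/\ surj u, injective v & forall x, v (u x) = f x].
Proof.
have [I [v [vi vP]]] := sub_ex (sclosed_im f).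
have [x|u uP] := @lin_lift _ _ _ _ v f vi; first by apply/vP; exists x.
exists I, u, v; split=> // y; have /vP[x fx] : exists k, v k = v y by exists y.
by exists x; apply: vi; rewrite uP.
Qed.

(** Pushout of [M] and [Q] over [N], realized as [M] modulo the image of the kernel of [q]. *)
Lemma push_quot N M Q (i : {linear N -> M}) (q : {linear N -> Q}) :
  injective i -> surj q ->
  exists (M' : lmodType R) (p : {linear M -> M'}) (j : {linear Q -> M'}),
    [/\ surj p, injective j, forall x, p (i x) = j (q x) &
      forall m, p m = 0 <-> exists k, i k = m /\ q k = 0].
Proof.
move=> ii sq.
have [|M' [p [sp pP]]] := @quo_ex _ M (fun m => exists k, i k = m /\ q k = 0).
  split=> [|a _ _ [k [<- qk]] [l [<- ql]]]; first by exists 0; rewrite !linear0.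
  by exists (a *: k + l); rewrite !linearP qk ql scaler0 addr0.
have [x qx|j jP] := @lin_fact _ _ _ _ q (p \o i) sq; first by apply/pP; exists x.
exists M', p, j; split=> //.
apply: injP => y; have [x <-] := sq y; rewrite jP => /pP[k [/ii-> ->]] //.
Qed.

Lemma flen_inj n N M (i : {linear N -> M}) : injective i -> flen n M -> flen n N.
Proof.
elim: n N M i => [|n IH] N M i ii fM /=.
  by move=> x; apply: (inj0 ii); rewrite (fM (i x)).
move=> Q q sq [x [x0 qx]]; have [M' [p [j [sp ji pi pP]]]] := push_quot ii sq.
apply: (IH _ _ j ji); apply: fM sp _; exists (i x).
by split=> [/(inj0 ii)|] //; apply/pP; exists x.
Qed.

(** A quotient of [N] embeds in the pushout quotient of [M], again properly; at length one a nonzero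
    [N] would already fill [M]. *)
Lemma flen_proper n N M (i : {linear N -> M}) :
  injective i -> ~ surj i -> flen n.+1 M -> flen n N.
Proof.
elim: n N M i => [|n IH] N M i ii ni fM.
  move=> x; apply: contrapT => x0; apply: ni => y.
  have [Q [q [_ sq e]]] := ses_of_inj ii.
  by apply/e; apply: (fM Q q sq); exists (i x); split=> [/(inj0 ii)//|]; apply/e; exists x.
move=> Q q sq [x [x0 qx]]; have [M' [p [j [sp ji pi pP]]]] := push_quot ii sq.
apply: (IH _ _ j ji); last first.
  by apply: fM sp _; exists (i x); split=> [/(inj0 ii)|] //; apply/pP; exists x.
move=> sj; apply: ni => m; have [y jy] := sj (p m); have [z qz] := sq y.
have /pP[k [ik _]] : p (m - i z) = 0 by rewrite linearB pi qz jy subrr.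
by exists (k + z); rewrite linearD ik subrK.
Qed.

(** A nonzero element of the kernel of [q] either lies in [A], and then the image of [A] gets
    shorter, or is nonzero in [C], and then the quotient of [C] does. *)
Lemma flen_ext a b A B C (i : {linear A -> B}) (p : {linear B -> C}) :
  sesm i p -> flen a A -> flen b C -> flen (a + b) B.
Proof.
move: {2}(a + b)%N (erefl (a + b)%N) => n; elim: n a b A B C i p => [|n IH] a b A B C i p nE S.
  move: nE => /eqP; rewrite addn_eq0 => /andP[/eqP-> /eqP->] zA zC x.
  have [_ _ e] := S; have /e[y <-] := zC (p x); by rewrite (zA y) linear0.
move=> fA fC; rewrite nE => Q q sq [x [x0 qx]]; have [ii sp e] := S.
have [A' [u [v [su vi vu]]]] := im_fact (q \o i).
have [C' [w Sv]] := ses_of_inj vi; have [_ sw ew] := Sv.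
have [|t tP] := @lin_fact _ _ _ _ p (w \o q) sp.
  by move=> y /e[z <-] /=; apply/ew; exists (u z); rewrite vu.
have st : surj t.
  by move=> c; have [y <-] := sw c; have [z <-] := sq y; exists (p z); rewrite tP.
case: (pselect (p x = 0)) => [/e[z iz]|px].
  have z0 : z <> 0 by move=> z0; apply: x0; rewrite -iz z0 linear0.
  case: a fA nE => [/(_ z)//|a] fA; rewrite addSn => -[nE]; rewrite -nE.
  apply: IH nE Sv _ (flen_surj st fC); apply: fA su _; exists z; split=> //.
  by apply: (inj0 vi); rewrite vu /= iz.
case: b fC nE => [/(_ (p x))//|b] fC; rewrite addnS => -[nE]; rewrite -nE.
apply: IH nE Sv (flen_surj su fA) _; apply: fC st _; exists (p x); split=> //.
by rewrite tP /= qx linear0.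
Qed.

Lemma fl_ext A B C (i : {linear A -> B}) (p : {linear B -> C}) :
  sesm i p -> fl A -> fl C -> fl B.
Proof. by move=> S [a fA] [c fC]; exists (a + c)%N; apply: flen_ext S fA fC. Qed.
Lemma fl_inj N M (i : {linear N -> M}) : injective i -> fl M -> fl N.
Proof. by move=> ii [n fM]; exists n; apply: flen_inj ii fM. Qed.
Lemma fl_surj N M (i : {linear N -> M}) : surj i -> fl N -> fl M.
Proof. by move=> ii [n fM]; exists n; apply: flen_surj ii fM. Qed.
Lemma fl_retract N M : retract N M -> fl M -> fl N.
Proof. by move=> [s [r rs]]; apply: (@fl_inj _ _ s); apply: can_inj rs. Qed.
Lemma fl_iso N M : mod_iso N M -> fl N -> fl M.
Proof. by move=> /iso_sym/iso_retract; apply: fl_retract. Qed.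
Lemma fl_zero Z : zero_mod Z -> fl Z.
Proof. by exists 0. Qed.
Lemma fl_prod X Y : fl X -> fl Y -> fl (X * Y)%type.
Proof. by have [h hE] := inl_ex X Y; apply: fl_ext (ses_prod hE). Qed.
Lemma fl_dsum k (A : 'I_k -> lmodType R) : (forall i, fl (A i)) -> fl (dsum A).
Proof. by apply: dsum_ind; [exact: fl_zero|exact: fl_prod|exact: fl_iso]. Qed.

Lemma simpleP M : simple_mod M <-> ~ zero_mod M /\
  forall P : M -> Prop, sclosed P -> (forall x, P x -> x = 0) \/ (forall x, P x).
Proof.
split=> -[nz H]; split=> //.
  move=> P /smod_of_ex[N NP]; case: (H N) => h; [left|right] => x; last exact/NP.
  by move=> /NP; apply: h.
by move=> N; have [h|h] := H _ (smod_sclosed N); [left|right].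
Qed.

Lemma simple_iso M N : mod_iso M N -> simple_mod M -> simple_mod N.
Proof.
move=> iso /simpleP[nz H]; have [f [g [fg gf]]] := isoE iso; apply/simpleP; split.
  by move=> zN; apply: nz; apply: iso_zero (iso_sym iso) zN.
move=> P cP; have [h|h] := H _ (sclosed_preim f cP); [left|right] => x.
  by move=> Px; rewrite -[x]gf (h (g x)) ?linear0 ?gf.
by rewrite -[x]gf.
Qed.

Lemma simple_fl M : simple_mod M -> fl M.
Proof.
move=> /simpleP[_ H]; exists 1%N => Q q sq [x [x0 qx]] y.
have [h|h] := H _ (sclosed_ker q); first by have := h _ qx.
by have [z <-] := sq y; apply: h.
Qed.

Lemma simple_sub M : fl M -> ~ zero_mod M ->
  exists (S : lmodType R) (i : {linear S -> M}), injective i /\ simple_mod S.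
Proof.
move=> [n fM]; elim: n M fM => [|n IH] M fM nz; first by [].
have [sM|] := pselect (simple_mod M); first by exists M, idfun; split.
move=> nsM; have [P [cP [x [Px x0]] [y Py]]] : exists P : M -> Prop,
    [/\ sclosed P, exists x, P x /\ x <> 0 & exists y, ~ P y].
  apply: contra_notP nsM => H; apply/simpleP; split=> // P cP.
  have [|h] := pselect (forall x, P x -> x = 0); first by left.
  right=> y; apply: contrapT => Py; apply: H; exists P; split=> //; last by exists y.
  apply: contra_notP h => h x Px; apply: contrapT => x0; apply: h; by exists x.
have [N [i [ii iP]]] := sub_ex cP.
have [||S [j [ji sS]]] := IH N.
- by apply: flen_proper ii _ fM => si; apply: Py; apply/iP; apply: si.
- by have /iP[k ik] := Px => zN; apply: x0; rewrite -ik (zN k) linear0.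
by exists S, (i \o j); split=> //; apply: inj_comp.
Qed.

Lemma indec_iso X Y : mod_iso X Y -> indecomposable X -> indecomposable Y.
Proof.
move=> iso [nz H]; split=> [zY|U V iso']; last exact: H (iso_trans iso iso').
by apply: nz; apply: iso_zero (iso_sym iso) zY.
Qed.

Lemma flen_summand n M X Y : mod_iso M (X * Y)%type -> ~ zero_mod Y ->
  flen n.+1 M -> flen n X.
Proof.
move=> iso /nonzero_ex[y y0] fM.
have fXY := flen_iso iso fM; apply: (fXY _ fst) => [x|]; first by exists (x, 0).
by exists (0, y); split=> // -[].
Qed.

Lemma indec_ex M : fl M -> ~ zero_mod M -> 
  exists X Y : lmodType R, mod_iso M (X * Y)%type /\ indecomposable X.
Proof.
move=> [n fM]; elim: n M fM => [|n IH] M fM nz //.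
have [iM|] := pselect (indecomposable M).
  have [Z zZ] := zero_mod_ex R; exists M, Z; split=> //.
  exact: iso_sym (prod_iso0 M zZ).
move=> niM; have [X [Y [iso nX nY]]] : exists X Y : lmodType R,
    [/\ mod_iso M (X * Y)%type, ~ zero_mod X & ~ zero_mod Y].
  apply: contra_notP niM => H; split=> // X Y iso.
  by apply: contrapT => /not_orP[nX nY]; apply: H; exists X, Y.
have [X1 [X2 [iso' iX1]]] := IH X (flen_summand iso nY fM) nX.
exists X1, (X2 * Y)%type; split=> //; apply: iso_trans iso _.
by apply: iso_trans (prod_iso iso' (iso_refl Y)) _; apply/iso_sym/prod_isoA.
Qed.

Lemma indec_split M (P Q : M -> Prop) : indecomposable M -> sclosed P -> sclosed Q ->
  (forall x, P x -> Q x -> x = 0) -> (forall x, exists y z, [/\ P y, Q z & x = y + z]) ->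
  (forall x, P x -> x = 0) \/ (forall x, P x).
Proof.
move=> [_ iM] cP cQ PQ ex; have [K [i [ii iP]]] := sub_ex cP.
have [L [j [ji jP]]] := sub_ex cQ; have [h hE] := copair_ex i j.
have [|zK|zL] := iM K L.
- apply: iso_sym; apply: (@mod_isoP _ _ _ h) => [|x].
    apply: injP => -[k l]; rewrite hE /= => /eqP; rewrite addr_eq0 => /eqP kl.
    have ik0 : i k = 0.
      apply: PQ; first by apply/iP; exists k.
      by rewrite kl; apply: sclosedN => //; apply/jP; exists l.
    move/eqP: kl; rewrite ik0 eq_sym oppr_eq0 => /eqP/(inj0 ji)->.
    by rewrite (inj0 ii ik0).
  by have [y [z [/iP[k <-] /jP[l <-] ->]]] := ex x; exists (k, l); rewrite hE.
- by left=> x /iP[k <-]; rewrite (zK k) linear0.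
right=> x; have [y [z [Py /jP[l <-] ->]]] := ex x.
by rewrite (zL l) linear0 addr0.
Qed.

Lemma fl_inj_surj M (u : {linear M -> M}) : fl M -> injective u -> surj u.
Proof.
move=> [n fM] ui; elim: n fM => [|n IH] fM; first by move=> y; exists 0; rewrite (fM y) linear0.
by apply: contrapT => ns; apply: (ns); apply: IH; apply: flen_proper ui ns fM.
Qed.

Lemma fl_surj_inj M (u : {linear M -> M}) : fl M -> surj u -> injective u.
Proof.
move=> [n fM] us; elim: n fM => [|n IH] fM; first by move=> x y; rewrite (fM x) (fM y).
apply: contrapT => ni; apply: (ni); apply: IH; apply: fM us _.
apply: contra_notP ni => h; apply: injP => x ux; apply: contrapT => x0.
by apply: h; exists x.
Qed.

Lemma linear_iter M (u : {linear M -> M}) k : 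
  exists v : {linear M -> M}, forall x, v x = iter k u x.
Proof.
elim: k => [|k [v vE]]; first by exists idfun.
by exists (u \o v) => x; rewrite /= vE.
Qed.

(** Fitting's lemma. [Y] is the stable image of the powers of [u], found by replacing [M] with the
    image of [u] until [u] is onto; the last clause says that [Y] and the elements killed by powers
    of [u] span [M]. *)
Lemma fitting M (u : {linear M -> M}) : fl M -> exists Y : M -> Prop,
  [/\ sclosed Y, forall y, Y y -> Y (u y),
    forall y, Y y -> exists y', Y y' /\ u y' = y, forall y, Y y -> u y = 0 -> y = 0 &
    forall x, exists y k, Y y /\ iter k u (x - y) = 0].
Proof.
move=> [n fM]; elim: n M u fM => [|n IH] M u fM.
  exists (fun x => x = 0); split=> //.
  - by move=> y _; exists 0; rewrite (fM y) linear0.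
  - by move=> x; exists 0, 0%N; rewrite /= (fM (x - 0)).
have [us|ns] := pselect (surj u).
  have ui : injective u by apply: fl_surj_inj us; exists n.+1.
  exists (fun=> True); split=> //.
  - by move=> y _; have [x] := us y; exists x.
  - by move=> y _; apply: inj0.
  - by move=> x; exists x, 0%N; rewrite /= subrr.
have [N [v [i [sv ii iv]]]] := im_fact u.
have fN : flen n N.
  apply: flen_proper ii _ fM => si; apply: ns => y.
  by have [z <-] := si y; have [x <-] := sv z; exists x.
pose u' : {linear N -> N} := v \o i.
have iu' z : i (u' z) = u (i z) by rewrite /u' /= iv.
have [Y [cY uY sY kY exY]] := IH N u' fN.
exists (fun x => exists2 y, Y y & i y = x); split.
- split=> [|a _ _ [y Yy <-] [z Yz <-]].
    by exists 0; [case: cY|rewrite linear0].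
  by exists (a *: y + z); [case: cY => _; apply|rewrite linearP].
- by move=> _ [y Yy <-]; exists (u' y); [exact: uY|rewrite iu'].
- move=> _ [y Yy <-]; have [z [Yz uz]] := sY _ Yy.
  by exists (i z); split; [exists z|rewrite -iu' uz].
- by move=> _ [y Yy <-]; rewrite -iu' => /(inj0 ii)/(kY _ Yy)->; rewrite linear0.
move=> x; have [y [k [Yy ky]]] := exY (v x); have [z [Yz uz]] := sY _ Yy.
exists (i z), k.+1; split; first by exists z.
rewrite iterSr linearB -iu' uz -iv -linearB.
by have -> w : iter k u (i w) = i (iter k u' w) by [elim: k {ky} => //= k ->; rewrite iu']; rewrite ky linear0.
Qed.

(** By Fitting, either [u] is bijective or every element is killed by a power of [u]. In the second
    case [u] has no nonzero fixed point, so [v = 1 - u] is injective, hence bijective by finite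
    length. *)
Lemma local_end M (u v : {linear M -> M}) : fl M -> indecomposable M ->
  (forall x, u x + v x = x) -> bijective u \/ bijective v.
Proof.
move=> fM iM uv; have [Y [cY uY sY kY exY]] := fitting u fM.
pose X x := exists k, iter k u x = 0.
have iterD k l x : iter k u x = 0 -> iter (l + k) u x = 0.
  by move=> h; rewrite iterD h; elim: l => //= l ->; rewrite linear0.
have cX : sclosed X.
  split=> [|a x y [k kx] [l ly]]; first by exists 0%N.
  exists (l + k)%N; have [w wE] := linear_iter u (l + k).
  by rewrite -wE linearP !wE iterD // addnC iterD // scaler0 addr0.
have XY x : Y x -> X x -> x = 0.
  move=> Yx [k]; elim: k x Yx => // k IH x Yx; rewrite iterSr => /IH h.
  by apply: kY => //; apply: h; apply: uY.
have [|Y0|Y1] := indec_split iM cY cX XY.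
- move=> x; have [y [k [Yy ky]]] := exY x; exists y, (x - y); split=> //; first by exists k.
  by rewrite addrC subrK.
- right; have vi : injective v.
    apply: injP => x vx; have ux : u x = x by rewrite -{2}[x]uv vx addr0.
    have [y [k [/Y0-> ]]] := exY x; rewrite subr0.
    by have -> : iter k u x = x by elim: k => //= k ->.
  exact: injsurj_bij vi (fl_inj_surj fM vi).
left; apply: injsurj_bij => [|y]; first by apply: injP => x; apply: kY; apply: Y1.
by have [x [_ ux]] := sY y (Y1 y); exists x.
Qed.

Lemma local_add M (u v w : {linear M -> M}) : fl M -> indecomposable M ->
  (forall x, u x + v x = w x) -> bijective w -> bijective u \/ bijective v.
Proof.
move=> fM iM uv /bij_injsurj[wi ws]; have [w' [ww' w'w]] := bij_inv wi ws.
have B (f : {linear M -> M}) : bijective (w' \o f) -> bijective f.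
  move=> [g h1 h2]; exists (g \o w') => x /=; first exact: h1.
  by have := h2 (w' x); rewrite /= => /(can_inj w'w).
have [x|/B|/B] := @local_end _ (w' \o u) (w' \o v) fM iM; [|by left|by right].
by rewrite /= -linearD uv ww'.
Qed.

Lemma local_sum M (I : Type) (r : seq I) (f : I -> {linear M -> M}) (w : {linear M -> M}) :
  fl M -> indecomposable M -> (forall x, w x = \sum_(i <- r) f i x) ->
  bijective w -> exists i, bijective (f i).
Proof.
move=> fM iM; elim: r w => [|a r IH] w wE bw.
  case: iM => nz _; case: nz => x; have [wi _] := bij_injsurj bw.
  by apply: (inj0 wi); rewrite wE big_nil.
have [x||] := @local_add _ (f a) (w \- f a) w fM iM _ bw.
- by rewrite /= addrC subrK.
- by exists a.
by apply: IH => x; rewrite /= wE big_cons addrC addrA addNr add0r.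
Qed.

Lemma retract_bij X M (s : {linear X -> M}) (r : {linear M -> X}) :
  bijective (r \o s) -> retract X M.
Proof.
move=> b; have [i' s'] := @bij_injsurj _ _ _ (r \o s) b.
by have [g [gK _]] := bij_inv i' s'; exists s, (g \o r).
Qed.

(** The identity of [X] is the sum of its passages through the [A i]; since the endomorphism ring is
    local, one of them is invertible. *)
Lemma krs_prime X (I : finType) (A : I -> lmodType R) : fl X -> indecomposable X ->
  retract X (dsum A) -> exists i, retract X (A i).
Proof.
move=> fX iX [s [r rs]].
have [x||i bi] := @local_sum X I (index_enum I) (fun i => r \o din i \o dpr i \o s) idfun fX iX.
- by rewrite /= -{1}[x]rs {1}[s x]dsumE linear_sum.
- by exists idfun.
by exists i; apply: (@retract_bij _ _ (dpr i \o s) (r \o din i)).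
Qed.

Lemma krs_prime2 X Y Z : fl X -> indecomposable X ->
  retract X (Y * Z)%type -> retract X Y \/ retract X Z.
Proof.
move=> fX iX [s [r rs]]; have [a aE] := inl_ex Y Z; have [b bE] := inr_ex Y Z.
have [x|h|h] := @local_end X (r \o a \o fst \o s) (r \o b \o snd \o s) fX iX.
- rewrite /= -linearD aE bE -[RHS]rs; congr (r _).
  by case: (s x) => y z; congr (_, _); rewrite /= ?addr0 ?add0r.
- by left; apply: (@retract_bij _ _ (fst \o s) (r \o a)).
- by right; apply: (@retract_bij _ _ (snd \o s) (r \o b)).
Qed.

Lemma retract_indec X Y : ~ zero_mod X -> indecomposable Y -> retract X Y -> mod_iso X Y.
Proof.
move=> nX [_ iY] /retractP[Z iso]; have [zX|zZ] := iY _ _ iso; first by case: nX.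
by apply: iso_sym; apply: iso_trans iso (prod_iso0 X zZ).
Qed.

(** Gaussian elimination: when the entry [X -> X] of [f] is invertible, its Schur complement
    [h : M -> N] is bijective. *)
Lemma cancel_aux X M N (f : {linear (X * M)%type -> (X * N)%type}) :
  injective f -> surj f -> bijective (fun x => (f (x, 0)).1) -> mod_iso M N.
Proof.
move=> fi fs; have [i iE] := inl_ex X M; have [j jE] := inr_ex X M.
move=> b; have {b} b : bijective (fst \o f \o i) by apply: (eq_bij b) => x; rewrite /= iE.
have [ai as_] := bij_injsurj b; have [a [aK Ka]] := bij_inv ai as_.
pose h : {linear M -> N} := snd \o f \o (j \- (i \o a \o fst \o f \o j)).
have h1 m : (f (j m - i (a (f (j m)).1))).1 = 0.
  by rewrite linearB /=; have /= -> := Ka (f (j m)).1; rewrite subrr.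
apply: (@mod_isoP _ _ _ h) => [|n].
  apply: injP => m hm; have /(inj0 fi) : f (j m - i (a (f (j m)).1)) = 0.
    by move: (h1 m) hm; rewrite /h /=; case: (f _) => ? ? /= -> ->.
  by rewrite iE jE => -[_]; rewrite /= subr0.
have [[x m] fxm] := fs (0, n); exists m.
have xm : (x, m) = i x + j m by rewrite iE jE; congr (_, _); rewrite /= ?addr0 ?add0r.
have e1 : (f (i x)).1 = - (f (j m)).1.
  by apply/eqP; rewrite -addr_eq0; apply/eqP; have := congr1 fst fxm; rewrite xm linearD.
have xE : i x = - i (a (f (j m)).1).
  by rewrite -linearN /= -linearN /= -e1; have /= -> := aK x.
by rewrite /h /= -xE addrC -xm fxm.
Qed.

(** By [cancel_aux] an isomorphism with invertible entry [X -> X] suffices. The [X]-entry of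
    [g \o f] writes the identity as the sum of a map factoring through [a] and of [b]. If [b] is the
    invertible one, then so is [a + b] or [- a]. *)
Lemma krs_cancel X M N : fl X -> indecomposable X ->
  mod_iso (X * M)%type (X * N)%type -> mod_iso M N.
Proof.
move=> fX iX iso; have [f [g [fg gf]]] := isoE iso.
have [i iE] := inl_ex X M; have [i' i'E] := inl_ex X N; have [j' j'E] := inr_ex X N.
pose a : {linear X -> X} := fst \o f \o i.
pose b : {linear X -> X} := fst \o g \o j' \o snd \o f \o i.
have fin_ : bijective a -> mod_iso M N.
  move=> ba; apply: (cancel_aux (can_inj fg)) => [y|]; first by exists (g y).
  by apply: (eq_bij ba) => x; rewrite /a /= iE.
have [x|h|bb] := @local_end X (fst \o g \o i' \o a) b fX iX.
- rewrite /b /a /= -[_ + _]/((g (i' (f (i x)).1) + g (j' (f (i x)).2)).1) -linearD.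
  have -> : i' (f (i x)).1 + j' (f (i x)).2 = f (i x).
    by rewrite i'E j'E; case: (f _) => ? ?; congr (_, _); rewrite /= ?addr0 ?add0r.
  by rewrite fg iE.
- apply: fin_; have ai : injective a.
    have [hi _] := bij_injsurj h; move=> x y xy; apply: hi.
    exact: (congr1 (fun z => (g (i' z)).1) xy).
  exact: injsurj_bij ai (fl_inj_surj fX ai).
have [x|bs|ba] := @local_add X (a \+ b) (\0 \- a) b fX iX _ bb.
- by rewrite /= sub0r addrC addKr.
(* A shear of the target, adding the entry [N -> X] of [g] to the first component, turns the entry
   [a] of [f] into [a + b]. *)
- have [t tE] := pair_ex (fst \+ (fst \o g \o j' \o snd) : {linear (X * N)%type -> X}) snd.
  apply: (@cancel_aux X M N (t \o f)) => [|[x n]|].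
  + apply: inj_comp (can_inj fg) => -[x n] [x' n']; rewrite !tE /= => -[+ nn'].
    by rewrite nn' => /addIr->.
  + by exists (g (x - (g (j' n)).1, n)); rewrite /= gf tE /= subrK.
  by apply: (eq_bij bs) => x; rewrite /= tE /a /b /= iE.
apply: fin_; have [ni ns] := bij_injsurj ba.
have ai : injective a by move=> x y xy; apply: ni; exact: (congr1 (fun z => 0 - z) xy).
exact: injsurj_bij ai (fl_inj_surj fX ai).
Qed.

Lemma krs_closure (C : lmodType R -> Prop) M : 
  (forall Z, zero_mod Z -> C Z) -> (forall X Y, C X -> C Y -> C (X * Y)%type) ->
  (forall X Y, mod_iso X Y -> C X -> C Y) ->
  fl M -> (forall X, indecomposable X -> retract X M -> C X) -> C M.
Proof.
move=> C0 CX Ci [n fM]; elim: n M fM => [|n IH] M fM H; first exact: C0.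
have [zM|nz] := pselect (zero_mod M); first exact: C0.
have [|X [Y [iso iX]]] := indec_ex _ nz; first by exists n.+1.
apply: Ci (iso_sym iso) _; apply: CX.
  by apply: H => //; apply/retractP; exists Y.
have r : retract Y M := retract_trans (retract_snd X Y) (iso_retract (iso_sym iso)).
apply: IH => [|Z iZ rZ]; last by apply: H => //; apply: retract_trans rZ r.
by case: iX => nX _; apply: flen_summand nX fM; apply: iso_trans iso (prod_isoC X Y).
Qed.

(** Split off one summand; by the prime property the others, not being isomorphic to it, are
    summands of the complement. *)
Lemma distinct_retract k (X : 'I_k -> lmodType R) M :
  (forall i, fl (X i) /\ indecomposable (X i)) ->
  (forall i j, mod_iso (X i) (X j) -> i = j) ->
  (forall i, retract (X i) M) -> retract (dsum X) M.
Proof.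
elim: k X M => [|k IH] X M iX dX rX.
  exists \0, \0 => x; rewrite /= (@dsum0_zero _ X x) //.
have /retractP[M' iso] := rX ord0.
apply: retract_trans (iso_retract (dsum_recl X)) _.
apply: retract_trans _ (iso_retract (iso_sym iso)).
apply: prod_retract (retract_refl _) _; apply: IH => [i|i j /dX/lift_inj//|i] //.
have [fi ii] := iX (lift ord0 i).
have [/retract_indec h|//] := krs_prime2 fi ii (retract_trans (rX (lift ord0 i)) (iso_retract iso)).
by have /dX/eqP := h (proj1 ii) (proj2 (iX ord0)); rewrite eq_sym (negPf (neq_lift _ _)).
Qed.

Lemma indec_reps M : fl M -> exists k (X : 'I_k -> lmodType R),
  [/\ forall i, indecomposable (X i) /\ retract (X i) M,
    forall i j, mod_iso (X i) (X j) -> i = j &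
    forall Y, indecomposable Y -> fl Y -> retract Y M -> exists i, mod_iso Y (X i)].
Proof.
move=> [n fM]; elim: n M fM => [|n IH] M fM.
  by exists 0%N, (fun=> M); split=> [[]//|[]//|Y [nz _] _ /retract_zero/(_ fM)].
have [zM|nz] := pselect (zero_mod M).
  by apply: IH; apply: flen_le (leq0n n) _.
have [|X [Y [iso iX]]] := indec_ex _ nz; first by exists n.+1.
have rX : retract X M by apply/retractP; exists Y.
have rY : retract Y M := retract_trans (retract_snd X Y) (iso_retract (iso_sym iso)).
have flX : fl X by apply: fl_retract rX _; exists n.+1.
have [|k [Z [iZ dZ exZ]]] := IH Y.
  by case: iX => nX _; apply: flen_summand nX fM; apply: iso_trans iso (prod_isoC X Y).
have iZM i : indecomposable (Z i) /\ retract (Z i) M.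
  by have [? h] := iZ i; split=> //; apply: retract_trans h rY.
have exM W : indecomposable W -> fl W -> retract W M -> mod_iso W X \/ exists i, mod_iso W (Z i).
  move=> iW fW rW; have [r|r] := krs_prime2 fW iW (retract_trans rW (iso_retract iso)).
    by left; apply: retract_indec => //; case: iW.
  by right; apply: exZ.
have [[i Xi]|nX] := pselect (exists i, mod_iso X (Z i)).
  exists k, Z; split=> // W iW fW rW; have [WX|//] := exM W iW fW rW.
  by exists i; apply: iso_trans WX Xi.
exists k.+1, (fun i => if unlift ord0 i is Some j then Z j else X); split.
- by move=> i; case: unliftP => [j|] _.
- move=> i j; case: unliftP => [i'|] ->; case: unliftP => [j'|] -> //.
  + by move=> /dZ->.
  + by move=> /iso_sym h; case: nX; exists i'.
  + by move=> h; case: nX; exists j'.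
move=> W iW fW rW; have [WX|[i Wi]] := exM W iW fW rW.
  by exists ord0; rewrite unlift_none.
by exists (lift ord0 i); rewrite liftK.
Qed.

(* X has multiplicity a in M. *)
Fixpoint mult X a M : Prop :=
  match a with
  | 0 => ~ retract X M
  | a'.+1 => exists M' : lmodType R, mod_iso M (X * M')%type /\ mult X a' M'
  end.

Lemma mult_iso X a M N : mod_iso M N -> mult X a M -> mult X a N.
Proof.
move=> iso; case: a => [|a] /=.
  by move=> h rN; apply: h; apply: retract_trans rN (iso_retract (iso_sym iso)).
by move=> [M' [iso' h]]; exists M'; split=> //; apply: iso_trans (iso_sym iso) iso'.
Qed.

Lemma mult_uniq X a b M : fl X -> indecomposable X -> mult X a M -> mult X b M -> a = b.
Proof.
move=> fX iX; elim: a b M => [|a IH] [|b] M //=.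
- by move=> h [M' [iso _]]; case: h; apply/retractP; exists M'.
- by move=> [M' [iso _]] []; apply/retractP; exists M'.
move=> [M' [iso h]] [M'' [iso' h']]; congr _.+1; apply: IH h _.
apply: mult_iso h'; apply: (krs_cancel fX iX).
exact: iso_trans (iso_sym iso') iso.
Qed.

Lemma mult_prod X a b M N : fl X -> indecomposable X ->
  mult X a M -> mult X b N -> mult X (a + b) (M * N)%type.
Proof.
move=> fX iX; elim: a M => [|a IH] M /=; last first.
  move=> [M' [iso h]] h'; exists (M' * N)%type; split; last exact: IH.
  by apply: iso_trans (prod_iso iso (iso_refl N)) _; apply/iso_sym/prod_isoA.
elim: b N => [|b IHb] N /=; first by move=> hM hN /(krs_prime2 fX iX)[].
move=> hM [N' [iso h]]; exists (M * N')%type; split; last exact: IHb.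
apply: iso_trans (prod_iso (iso_refl M) iso) _.
apply: iso_trans (prod_isoA _ _ _) _.
apply: iso_trans (prod_iso (prod_isoC _ _) (iso_refl N')) _.
by apply/iso_sym/prod_isoA.
Qed.

Lemma mult_ex X M : fl M -> ~ zero_mod X -> exists a, mult X a M.
Proof.
move=> [n fM] nX; elim: n M fM => [|n IH] M fM.
  by exists 0%N => r; apply: nX; apply: retract_zero r fM.
have [/retractP[M' iso]|] := pselect (retract X M); last by exists 0%N.
have [|a h] := IH M'; last by exists a.+1, M'.
by apply: flen_summand nX fM; apply: iso_trans iso (prod_isoC _ _).
Qed.
End FiniteLength.

(** * Artinian rings *)

Section DescendingChains.
Variables (k : comPzRingType) (L : pzRingType) (h : {rmorphism k -> L}).
Hypothesis k_artin : artinian_ring k.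

Fixpoint kspan (s : seq L) (x : L) : Prop :=
  match s with
  | [::] => x = 0
  | a :: s' => exists c y, kspan s' y /\ x = h c * a + y
  end.

Lemma kspan_sum (s : seq L) (c : nat -> k) :
  kspan s (\sum_(i < size s) h (c i) * s`_i).
Proof.
elim: s c => [|a s IH] c /=; first by rewrite big_ord0.
rewrite big_ord_recl /=; exists (c 0%N), (\sum_(i < size s) h (c i.+1) * s`_i).
by split=> //; apply: IH (fun i => c i.+1).
Qed.

Lemma kspanP s c x y : kspan s x -> kspan s y -> kspan s (h c * x + y).
Proof.
elim: s x y => [|a s IH] x y /=; first by move=> -> ->; rewrite mulr0 addr0.
move=> [d [x' [sx ->]]] [d' [y' [sy ->]]]; exists (c * d + d'), (h c * x' + y').
split; first exact: IH.
by rewrite mulrDr rmorphD rmorphM /= mulrDl mulrA addrACA.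
Qed.

(** Induction on the generators: a chain in the span of [a :: s] is governed by its ideals of
    coefficients at [a], which stabilize in [k], and by its traces on the span of [s]. *)
Lemma kspan_dcc (s : seq L) (V : nat -> L -> Prop) :
  (forall n, V n 0) -> (forall n c x y, V n x -> V n y -> V n (h c * x + y)) ->
  (forall n x, V n.+1 x -> V n x) ->
  exists n, forall m x, (n <= m)%N -> kspan s x -> V n x -> V m x.
Proof.
move=> V0 VD Vd; have Vle n m x : (n <= m)%N -> V m x -> V n x.
  by move=> nm; rewrite -(subnK nm); elim: (m - n)%N => // d IH /Vd.
have VN n x : V n x -> V n (- x).
  by move=> Vx; have := VD n (-1) x 0 Vx (V0 n); rewrite rmorphN1 mulN1r addr0.
have VA n x y : V n x -> V n y -> V n (x + y).
  by move=> Vx Vy; have := VD n 1 x y Vx Vy; rewrite rmorph1 mul1r.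
elim: s => [|a s [n1 IH]] /=; first by exists 0%N => m x _ -> _.
pose K n (c : k^o) := exists w, kspan s w /\ V n (h c * a + w).
have s0 : kspan s 0 by elim: (s) => //= b s' h0; exists 0, 0; rewrite rmorph0 mul0r add0r.
have cK n : sclosed (K n).
  split=> [|c x y [w [sw Vw]] [w' [sw' Vw']]].
    by exists 0; rewrite rmorph0 mul0r addr0.
  exists (h c * w + w'); split; first exact: kspanP.
  have -> : h (c *: x + y) * a + (h c * w + w') = h c * (h x * a + w) + (h y * a + w').
    by rewrite rmorphD rmorphM mulrDl mulrDr -mulrA addrACA.
  exact: VD.
pose I_ n := sval (cid (smod_of_ex (cK n))).
have I_P n x : x \in I_ n <-> K n x by rewrite /I_; case: cid.
have [n x /I_P[w [sw Vw]]|n2 H] := k_artin (I_ := I_).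
  by apply/I_P; exists w; split=> //; apply: Vd.
exists (maxn n1 n2) => m x; rewrite geq_max => /andP[m1 m2] [c [w [sw ->]]] Vx.
have /I_P : c \in I_ n2.
  by apply/I_P; exists w; split=> //; apply: Vle Vx; apply: leq_maxr.
move=> /I_P; rewrite -(H m m2) => /I_P[w' [sw' Vw']].
have -> : h c * a + w = (w - w') + (h c * a + w') by rewrite addrCA subrK.
apply: (VA _ _ _ _ Vw'); apply: IH => //.
  by rewrite addrC; have := kspanP (-1) sw' sw; rewrite rmorphN1 mulN1r.
have -> : w - w' = (h c * a + w) + - (h c * a + w') by rewrite opprD addrACA subrr add0r.
apply: VA; first by apply: Vle Vx; apply: leq_maxl.
by apply: VN; apply: Vle Vw'.
Qed.
End DescendingChains.

Definition dcc (L : pzRingType) := forall C : (L^o -> Prop) -> Prop,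
  (exists P, sclosed P /\ C P) -> exists P, [/\ sclosed P, C P &
    forall Q, sclosed Q -> C Q -> (forall x, Q x -> P x) -> forall x, P x -> Q x].

(** Left ideals are [k]-submodules through [h], so their descending chains stop; choice turns a
    failure of the minimum condition into a strictly descending chain. *)
Lemma artin_dcc (L : pzRingType) : artin_algebra L -> dcc L.
Proof.
move=> [k [h [kA hC [s sP]]]] C [P0 CP0]; apply: contrapT => nmin.
pose T := {P : L^o -> Prop | sclosed P /\ C P}.
have step (P : T) : exists Q : T, (forall x, sval Q x -> sval P x) /\
    exists x, sval P x /\ ~ sval Q x.
  apply: contrapT => H; apply: nmin; case: P H => P [cP CP] H; exists P; split=> // Q cQ CQ QP.
  apply: contrapT => /existsNP[x /not_implyP[Px Qx]].
  by apply: H; exists (exist _ Q (conj cQ CQ)); split=> //; exists x.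
pose nx P := sval (cid (step P)).
have nxP P : (forall x, sval (nx P) x -> sval P x) /\
    exists x, sval P x /\ ~ sval (nx P) x by rewrite /nx; case: cid.
pose V n := sval (iter n nx (exist _ P0 CP0)).
have cV n : sclosed (V n) by rewrite /V; case: (iter _ _ _) => P [].
have [n|n c x y Vx Vy|n x|n H] := @kspan_dcc k L h kA s V.
- by case: (cV n).
- by have [_ H] := cV n; exact: (H (h c) x y Vx Vy).
- by have [H _] := nxP (iter n nx (exist _ P0 CP0)); apply: H.
have [_ [x [Vx nVx]]] := nxP (iter n nx (exist _ P0 CP0)).
apply: nVx; apply: (H n.+1) => //; have [c ->] := sP x; exact: kspan_sum.
Qed.

Section Zorn.
Import classical_sets.
Variables (R : pzRingType) (M : lmodType R).

Lemma zorn_sub (P : M -> Prop) (x : M) : sclosed P -> ~ P x ->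
  exists Q : M -> Prop, [/\ sclosed Q, forall y, P y -> Q y, ~ Q x &
    forall Q' : M -> Prop, sclosed Q' -> (forall y, Q y -> Q' y) -> ~ Q' x ->
      forall y, Q' y -> Q y].
Proof.
move=> cP Px.
(* Closure is asked of the union with [P] and not of the set itself, because the chains include the
   empty one, whose union is the empty set. *)
pose good (A : set M) := sclosed (fun y => A y \/ P y) /\ ~ A x.
have [F Fg Ft|A [[cA Ax] Amax]] := @Zorn_bigcup M good.
  split; last by move=> [A FA] Ax; case: (Fg A FA).
  split=> [|a u v]; first by right; case: cP.
  move=> [[A FA Au]|Pu] [[B FB Bv]|Pv].
  - have [AB|BA] := Ft A B FA FB.
      have [[_ H] _] := Fg B FB.
      by have [h|h] := H a u v (or_introl (AB _ Au)) (or_introl Bv); [left; exists B|right].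
    have [[_ H] _] := Fg A FA.
    by have [h|h] := H a u v (or_introl Au) (or_introl (BA _ Bv)); [left; exists A|right].
  - have [[_ H] _] := Fg A FA.
    by have [h|h] := H a u v (or_introl Au) (or_intror Pv); [left; exists A|right].
  - have [[_ H] _] := Fg B FB.
    by have [h|h] := H a u v (or_intror Pu) (or_introl Bv); [left; exists B|right].
  - by right; case: cP => _; apply.
exists (fun y => A y \/ P y); split=> //; first by right.
  by move=> [].
move=> Q' cQ' AQ' Q'x y Q'y; apply: contrapT => nAy.
apply: (Amax Q'); last first.
  split=> //; split=> [|a u v]; first by right; case: cP.
  have e z : Q' z \/ P z -> Q' z by move=> [//|Pz]; apply: AQ'; right.
  by move=> /e h1 /e h2; left; case: cQ' => _; apply.
split=> [z Az|/(_ y Q'y) Ay]; first by apply: AQ'; left.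
by apply: nAy; left.
Qed.
End Zorn.

Section FlReg.
Variable R : pzRingType.
Hypothesis flR : fl R^o.

Lemma fg_fl (M : lmodType R) : fin_gen M -> fl M.
Proof. by move=> /fg_cover[k [q sq]]; apply: fl_surj sq _; apply: fl_dsum. Qed.

Lemma fl_fg (M : lmodType R) : fl M -> fin_gen M.
Proof.
move=> [n fM]; elim: n M fM => [|n IH] M fM; first exact: fg_zero.
have [|/nonzero_ex[x x0]] := pselect (zero_mod M); first exact: fg_zero.
have [c cE] := cyc_ex x; have [I [u [v [su vi vu]]]] := im_fact c.
have [Q [q S]] := ses_of_inj vi; have [_ sq e] := S.
apply: fg_ext S (fg_surj su (@fg_reg R)) _; apply: IH; apply: fM sq _.
by exists x; split=> //; apply/e; exists (u 1); rewrite vu cE scale1r.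
Qed.

Lemma fl_noeth : noeth R.
Proof. by move=> M N i ii /fg_fl fM; apply: fl_fg; apply: fl_inj ii fM. Qed.
End FlReg.

Lemma smod_infP (R : pzRingType) (M : lmodType R) (C : submodClosed M -> Prop) x :
  x \in smod_inf C <-> forall N, C N -> x \in N.
Proof.
by split=> [/(smod_ofP (@inC0 _ _ C) (@inCD _ _ C))|H];
  last exact/(smod_ofP (@inC0 _ _ C) (@inCD _ _ C)).
Qed.

(** * The radical of a basic artinian ring *)

Section Basic.
Variables (L : pzRingType) (n : nat) (D : 'I_n -> nzRingType).
Variable f_ : forall i, {rmorphism L -> D i}.
Hypothesis D_div : forall i, division_ring (D i).
Hypothesis f_surj : forall d : (forall i, D i), exists x, forall i, f_ i x = d i.
Hypothesis f_ker : forall x : L, x \in jacobson L <-> forall i, f_ i x = 0.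
Implicit Types M N S X : lmodType L.

Definition J (x : L) := forall i, f_ i x = 0.

Lemma JD x y : J x -> J y -> J (x + y).
Proof. by move=> Jx Jy i; rewrite rmorphD Jx Jy addr0. Qed.
Lemma JMl a x : J x -> J (a * x).
Proof. by move=> Jx i; rewrite rmorphM /= Jx mulr0. Qed.
Lemma JMr a x : J x -> J (x * a).
Proof. by move=> Jx i; rewrite rmorphM /= Jx mul0r. Qed.
Lemma sclosed_J : sclosed (J : L^o -> Prop).
Proof.
split=> [i|a x y Jx Jy]; first exact: rmorph0.
by apply: (@JD (a * x) y) => //; apply: JMl.
Qed.

Definition maxl (Q : L^o -> Prop) := [/\ sclosed Q, ~ Q 1 &
  forall Q' : L^o -> Prop, sclosed Q' -> (forall y, Q y -> Q' y) -> ~ Q' 1 ->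
      forall y, Q' y -> Q y].

Lemma J_maxl Q a : maxl Q -> J a -> Q a.
Proof.
move=> [cQ Q1 Qm] /f_ker/smod_infP Ja; have [N NP] := smod_of_ex cQ.
apply/NP; apply: Ja; split=> [|N' NN'].
  by move=> h; apply: Q1; apply/NP.
have [N'1|N'1] := pselect ((1 : L^o) \in N').
  right=> x; have -> : x = (x : L) *: (1 : L^o) by rewrite /GRing.scale /= mulr1.
  exact: rpredZ.
left=> x; apply/idP/idP; last exact: NN'.
move=> N'x; apply/NP; apply: (Qm _ (smod_sclosed N')) => // y /NP; exact: NN'.
Qed.

(** Otherwise some maximal left ideal contains [1 - a], and also [a], as it contains the radical. *)
Lemma J_qreg a : J a -> exists v, v * (1 - a) = 1.
Proof.
move=> Ja; apply: contrapT => H.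
have c1 := sclosed_cyc ((1 - a) : L^o).
have [|Q [cQ PQ Q1 Qm]] := @zorn_sub _ L^o _ 1 c1.
  by move=> [v vE]; apply: H; exists v; apply: esym.
apply: (Q1); rewrite -[1](subrK a).
apply: (sclosedD cQ); first by apply: PQ; exists 1; rewrite scale1r.
exact: (@J_maxl Q a (And3 cQ Q1 Qm) Ja).
Qed.

Lemma J_nak M (x : M) a : J a -> x = a *: x -> x = 0.
Proof.
move=> /J_qreg[v vE] xE; rewrite -[x]scale1r -vE -scalerA scalerBl scale1r.
by rewrite -xE subrr scaler0.
Qed.

(** The annihilator of a nonzero [x] is a maximal left ideal. *)
Lemma J_simple S a (x : S) : simple_mod S -> J a -> a *: x = 0.
Proof.
move=> /simpleP[_ sS] Ja; have [->|x0] := pselect (x = 0); first exact: scaler0.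
have [c cE] := cyc_ex x.
rewrite -cE; apply: (@J_maxl (fun b => c b = 0) a _ Ja); split.
- exact: sclosed_ker.
- by rewrite cE scale1r.
move=> Q cQ kQ Q1 b Qb; rewrite cE; apply: contrapT => bx0.
have [h|h] := sS _ (sclosed_cyc ((b : L) *: x)); first by apply: bx0; apply: h; exists 1; rewrite scale1r.
have [d xE] := h x; apply: (Q1); rewrite -[1](subrK (d * (b : L))).
apply: (sclosedD cQ); last exact: (sclosedZ d cQ Qb).
by apply: kQ; rewrite cE scalerBl scale1r -scalerA -xE subrr.
Qed.

(* The submodule J N. *)
Definition jm M (N : M -> Prop) (y : M) : Prop :=
  forall Q : M -> Prop, sclosed Q -> (forall a x, J a -> N x -> Q (a *: x)) -> Q y.

Lemma jm_closed M (N : M -> Prop) : sclosed (jm N).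
Proof.
split=> [Q [] //|a x y Nx Ny Q cQ H].
by have [_ QD] := cQ; apply: QD; [apply: Nx|apply: Ny].
Qed.
Lemma jm_mul M (N : M -> Prop) a x : J a -> N x -> jm N (a *: x).
Proof. by move=> Ja Nx Q cQ; apply. Qed.
Lemma jm_mono M (N N' : M -> Prop) : (forall x, N x -> N' x) -> forall x, jm N x -> jm N' x.
Proof. by move=> h x Nx; apply: Nx (jm_closed N') _ => a y Ja /h; apply: jm_mul. Qed.
Lemma jm_sub M (N : M -> Prop) : sclosed N -> forall x, jm N x -> N x.
Proof. by move=> cN x; apply=> // a y _; apply: sclosedZ. Qed.
Lemma iter_jm_mono M (N N' : M -> Prop) k : (forall x, N x -> N' x) ->
  forall x, iter k (@jm M) N x -> iter k (@jm M) N' x.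
Proof. by move=> h; elim: k => //= k; apply: jm_mono. Qed.

Section Artinian.
Hypothesis L_dcc : dcc L.
Let all1 (x : L^o) := True.
Let Jp k : L^o -> Prop := iter k (@jm L^o) all1.

Lemma Jp_closed k : sclosed (Jp k).
Proof. by case: k => [|k] //=; apply: jm_closed. Qed.
Lemma JpW k x : Jp k.+1 x -> Jp k x.
Proof. by move=> h; apply: jm_sub h; apply: Jp_closed. Qed.

(** Let I = J^k be the smallest power, so J I = I. If I is nonzero, take N minimal with I N nonzero
    and [x] in N with I x nonzero. Either I (I x) is nonzero, and then N = I x gives [x = b x] with
    [b] in J, against Nakayama; or I^2 x = 0, which is absurd since I = J^k I = I^2. *)
Lemma J_nilp : exists k, forall x, Jp k x -> x = 0.
Proof.
have [I0 [cI0 [k kE] Imin]] := L_dcc (C := fun P => exists k, P = Jp k) (ex_intro _ _ (conj (Jp_closed 0) (ex_intro _ 0%N erefl))).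
rewrite {}kE {I0} in cI0 Imin *; set I := Jp k in cI0 Imin *.
have IW : forall x, I x -> jm I x :=
  Imin (jm I) (jm_closed I) (ex_intro _ k.+1 erefl) (@JpW k).
have Ij l x : I x -> iter l (@jm L^o) I x.
  by elim: l x => //= l IH x /IW; apply: jm_mono.
have IJ x : I x -> J x by move=> /IW; apply; [exact: sclosed_J|move=> a y Ja _; apply: (JMr y Ja)].
exists k => i0 Ii0; apply: contrapT => i0n.
have [|N [cN [x [a [Nx Ia ax]]] Nmin]] := L_dcc (C := fun W : L^o -> Prop => exists x a : L, [/\ W x, I a & a * x <> 0]).
  by exists all1; split=> //; exists 1, i0; rewrite mulr1.
have cI1 : sclosed (fun y : L^o => exists2 b, I b & y = (b * x : L)).
  split=> [|c y z [b Ib ->] [d Id ->]]; first by exists 0; rewrite ?mul0r //; case: cI0.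
  exists (c *: b + d); first by case: cI0 => _; apply.
  by rewrite [RHS]mulrDl; congr (_ + _); apply: mulrA.
have [||x1 Ix1 xE] := Nmin _ cI1 _ _ x Nx; last 2 first.
- by move=> y [b _ ->]; apply: (sclosedZ b cN Nx).
- by apply: ax; rewrite (@J_nak L^o x x1) ?mulr0 //; apply: IJ.
apply: contrapT => H.
have bcx b c : I b -> I c -> b * (c * x) = 0.
  move=> Ib Ic; apply: contrapT => h; apply: H; exists (c * x), b; split=> //.
  by exists c.
(* [G l] is the left ideal J^l I, spanned by products; for [l = k] it is I^2. *)
pose G l (y : L^o) := forall Q : L^o -> Prop, sclosed Q ->
  (forall b c, iter l (@jm L^o) all1 b -> I c -> Q (b * c : L)) -> Q y.
have cG l : sclosed (G l).
  split=> [Q [] //|b y z Gy Gz Q cQ HQ].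
  by have [_ QD] := cQ; apply: QD; [apply: Gy|apply: Gz].
have IG l y : iter l (@jm L^o) I y -> G l y.
  elim: l y => [|l IH] y /=.
    by move=> Iy Q cQ HQ; rewrite -[y]mul1r; apply: HQ.
  apply; first exact: cG.
  move=> b z Jb /IH; suff cS : sclosed (fun z : L^o => forall b : L, J b -> G l.+1 (b * z : L)).
    move=> h; apply: (h _ cS _ b Jb) => c d Ic Id b' Jb' Q cQ HQ.
    by rewrite mulrA; apply: HQ => //; apply: jm_mul.
  split=> [c Jc|c u v Hu Hv d Jd]; first by rewrite mulr0; case: (cG l.+1).
  rewrite mulrDr mulrA; apply: (sclosedD (cG l.+1)); last exact: Hv.
  by apply: Hu; apply: JMr.
apply: ax; apply: (IG k a (Ij _ _ Ia) (fun y : L^o => (y * x : L) = 0)).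
  by split=> [|c u v ux vx]; [rewrite mul0r|rewrite mulrDl -mulrA ux mulr0 vx add0r].
by move=> b c Ib Ic; rewrite -mulrA bcx.
Qed.

Lemma unit_coset k : exists u, f_ k u = 1 /\ forall l, l != k -> f_ l u = 0.
Proof.
have [u uE] := f_surj (fun l => if l == k then 1 else 0).
by exists u; split=> [|l /negPf lk]; rewrite uE ?eqxx ?lk.
Qed.

Lemma f_surj1 k (d : D k) : exists b, f_ k b = d.
Proof. by have [b bE] := f_surj (dfwith (fun l => 0) d); exists b; rewrite bE dfwith_in. Qed.

(* Hopkins-Levitzki: in a minimal submodule N of infinite length, a submodule Q
   containing J N and maximal without some x outside J N has simple colength. *)
Lemma fl_reg : fl L^o.
Proof.
pose C (P : L^o -> Prop) := exists (K : lmodType L) (i : {linear K -> L^o}),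
  [/\ injective i, forall x, P x <-> exists k, i k = x & ~ fl K].
apply: contrapT => nfl.
have [|N [cN [K [i [ii iN nK]]] Nmin]] := L_dcc (C := C).
  by exists all1; split=> //; exists L^o, idfun; split=> // x; split=> // _; exists x.
have flP P : sclosed P -> ~ C P -> exists (K' : lmodType L) (i' : {linear K' -> L^o}),
   [/\ injective i', forall x, P x <-> exists k, i' k = x & fl K'].
  move=> cP nC; have [K' [i' [i'i i'P]]] := sub_ex cP; exists K', i'; split=> //.
  by apply: contrapT => h; apply: nC; exists K', i'.
(* If J N = N, then N lies in all powers of J and vanishes, although its length is infinite. *)
have [x [Nx jx]] : exists x, N x /\ ~ jm N x.
  apply: contra_notP nK => H; apply: fl_zero => z; apply: (inj0 ii).
  have NJ y : N y -> jm N y by move=> Ny; apply: contrapT => h; apply: H; exists y.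
  have [k kz] := J_nilp; apply: kz; apply: (@iter_jm_mono _ N) => //.
  have : N (i z) by apply/iN; exists z.
  by elim: k (i z) => //= k IH y /NJ; apply: jm_mono.
have [Q [cQ jQ Qx Qm]] := zorn_sub (jm_closed N) jx.
have cQN := sclosed_cap cQ cN.
have [|K' [i' [i'i i'P flK']]] := flP _ cQN.
  by move=> CQN; apply: Qx; have [] := Nmin _ cQN CQN (fun y h => proj2 h) x Nx.
have Qx_or y : N y -> ~ Q y -> exists q a, Q q /\ x = q + a *: y.
  move=> Ny Qy; apply: contrapT => H; apply: Qy.
  have c1 := sclosed_add cQ (sclosed_cyc y).
  apply: (Qm _ c1) => [z Qz||].
  - by exists z, 0; split; [|exists 0; rewrite scale0r|rewrite addr0].
  - by move=> [q [_ [Qq [a ->] xE]]]; apply: H; exists q, a.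
  by exists 0, y; split; [case: cQ|exists 1; rewrite scale1r|rewrite add0r].
have gen y : N y -> exists q a, Q q /\ y = q + a *: x.
  move=> Ny; pose u k := sval (cid (unit_coset k)).
  have uk k : f_ k (u k) = 1 by rewrite /u; case: cid => ? [].
  have ul k l : l != k -> f_ l (u k) = 0 by rewrite /u; case: cid => ? [? H]; apply: H.
  pose S z := exists q a, Q q /\ z = q + a *: x.
  have cS : sclosed S.
    split=> [|a z1 z2 [q1 [a1 [Q1 ->]]] [q2 [a2 [Q2 ->]]]].
      by exists 0, 0; split; [case: cQ|rewrite scale0r addr0].
    exists (a *: q1 + q2), (a * a1 + a2); split; first by case: cQ => _; apply.
    by rewrite scalerDr scalerDl scalerA addrACA.
  have QS z : Q z -> S z by exists z, 0; rewrite scale0r addr0.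
  rewrite -[y]scale1r -[1](subrK (\sum_k u k)) scalerDl; apply: (sclosedD cS).
    apply: (QS _ (jQ _ (jm_mul _ Ny))) => l; rewrite rmorphB rmorph1 rmorph_sum (bigD1 l) //= uk.
    by rewrite big1 ?addr0 ?subrr // => k kl; rewrite ul // eq_sym.
  rewrite scaler_suml; apply: (sclosed_sum _ cS) => k _.
  have [Qu|nQ] := pselect (Q (u k *: y)); first exact: QS.
  have [q [a [Qq xE]]] := Qx_or _ (sclosedZ (u k) cN Ny) nQ.
  have [fa|fa] := eqVneq (f_ k a) 0.
    case: Qx; rewrite xE; apply: (sclosedD cQ) => //; apply: jQ; rewrite scalerA.
    apply: (jm_mul _ Ny) => l; rewrite rmorphM /=; have [->|lk] := eqVneq l k.
      by rewrite fa mul0r.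
    by rewrite ul // mulr0.
  (* [b] inverts [a] in the component [D k] and [u k] vanishes in the others, so [u k - b * a * u k]
     lies in J. *)
  have [d [_ da]] := D_div fa; have [b bE] := f_surj1 d.
  exists ((u k - b * a * u k) *: y - b *: q), b; split.
    apply: (sclosedB cQ); last exact: sclosedZ.
    apply: (jQ _ (jm_mul _ Ny)) => l; rewrite rmorphB !rmorphM /=.
    have [->|lk] := eqVneq l k; first by rewrite bE da uk mul1r subrr.
    by rewrite ul // mulr0 subrr.
  by rewrite {1}xE scalerBl scalerDr -!scalerA addrA !subrK.
have kx : exists kx, i kx = x by apply/iN.
have {kx} [kx kxE] := kx.
have [z|j jP] := @lin_lift _ _ _ _ i i' ii.
  by apply/iN; have [] : Q (i' z) /\ N (i' z) by apply/i'P; exists z.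
have ji : injective j by apply: injP => z jz; apply: (inj0 i'i); rewrite -jP jz linear0.
have [W [q S]] := ses_of_inj ji; have [_ sq e] := S.
have qQ y : q y = 0 <-> Q (i y).
  rewrite e; split=> [[z <-]|Qy].
    by rewrite jP; have [] : Q (i' z) /\ N (i' z) by apply/i'P; exists z.
  have /i'P[z zE] : Q (i y) /\ N (i y) by split=> //; apply/iN; exists y.
  by exists z; apply: ii; rewrite jP.
have sW : simple_mod W.
  apply/simpleP; split=> [zW|P cP]; first by apply: Qx; rewrite -kxE; apply/qQ; rewrite (zW (q kx)).
  have [|nP] := pselect (forall y, P y -> y = 0); [by left|right=> w].
  have [y [Py y0]] : exists y, P (q y) /\ q y <> 0.
    apply: contra_notP nP => H y Py; apply: contrapT => y0; apply: H.
    by have [y' yE] := sq y; exists y'; rewrite yE.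
  have [q0 [a [Qq xE]]] : exists q0 a, Q q0 /\ x = q0 + a *: i y.
    by apply: Qx_or => [|/qQ//]; apply/iN; exists y.
  have qx : q kx = a *: q y.
    apply/eqP; rewrite -subr_eq0 -linearZ -linearB; apply/eqP/qQ.
    by rewrite linearB linearZ kxE xE addrK.
  have [z <-] := sq w; have [q1 [b [Qq1 zE]]] : exists q1 b, Q q1 /\ i z = q1 + b *: x.
    by apply: gen; apply/iN; exists z.
  have -> : q z = b *: q kx.
    apply/eqP; rewrite -subr_eq0 -linearZ -linearB; apply/eqP/qQ.
    by rewrite linearB linearZ kxE zE addrK.
  by rewrite qx; do 2 apply: (sclosedZ _ cP).
by apply: nK; apply: fl_ext S flK' (simple_fl sW).
Qed.
End Artinian.
End Basic.

Lemma lideal_mulP (L : pzRingType) (I : submodClosed L^o) (f x : L) :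
  (x : L^o) \in lideal_mul I f <-> exists2 a : L, a \in I & x = a * f.
Proof. by split=> [/(smod_ofP (inIf0 I f) (@inIfD _ I f))|H]; last exact/(smod_ofP (inIf0 I f) (@inIfD _ I f)). Qed.

Lemma smod_restrictP (R : pzRingType) (M : lmodType R) (A B : submodClosed M)
  (x : sub_mod A) : x \in smod_restrict A B <-> val x \in B.
Proof. by split=> [/(smod_ofP (inB0 A B) (@inBD _ _ A B))|H]; last exact/(smod_ofP (inB0 A B) (@inBD _ _ A B)). Qed.

(** * Idempotents, indecomposable projectives and simple modules *)

Section CyclicProjectives.
Variables (L : pzRingType) (f : L) (ff : idem f).
Let P : lmodType L := sub_mod (lideal_gen f).

Lemma lideal_genP (x : L^o) : x \in lideal_gen f <-> exists a : L, x = a * f.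
Proof.
split=> [/smod_ofP[a _ ->]|[a ->]]; first by exists a.
by apply/smod_ofP; exists a => //; apply/asboolP.
Qed.

Lemma pe_ex : exists pe : {linear L^o -> sub_mod (lideal_gen f)},
  surj pe /\ forall a : L, val (pe a) = a * f.
Proof.
have hL : linear (fun a : L^o => (a : L) * f : L^o).
  by move=> a x y; rewrite mulrDl; congr (_ + _); apply/esym/mulrA.
have [a|g gP] := @lin_lift _ _ _ _ (val : {linear P -> L^o}) (mkL hL) (@sub_mod_inj _ _ _).
  by apply/sub_mod_im/lideal_genP; exists a.
exists g; split=> [y|a]; last exact: gP.
have /lideal_genP[a aE] := valP y; exists a; apply: (@sub_mod_inj _ _ _).
by rewrite gP /= -aE.
Qed.
Definition pe : {linear L^o -> sub_mod (lideal_gen f)} := sval (cid pe_ex).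
Lemma pe_surj : surj pe. Proof. by rewrite /pe; case: cid => ? []. Qed.
Lemma val_pe (a : L) : val (pe a) = a * f.
Proof. by rewrite /pe; case: cid => ? []. Qed.

Lemma pe0 (a : L) : pe a = 0 <-> a * f = 0.
Proof.
rewrite -val_pe; split=> [->|h]; first exact: (linear0 (val : {linear P -> L^o})).
by apply: (inj0 (@sub_mod_inj _ _ _)); rewrite /= h.
Qed.

Lemma val_lideal (x : P) : val x * f = val x.
Proof. by have [a <-] := pe_surj x; rewrite val_pe -mulrA ff. Qed.
Lemma pe_val (x : P) : pe (val x) = x.
Proof. by apply: val_inj; rewrite val_pe val_lideal. Qed.

Lemma peE (a : L) : pe a = a *: pe 1.
Proof. by rewrite -linearZ; congr (pe _); apply/esym/mulr1. Qed.
Lemma pe_idem : f *: pe 1 = pe 1.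
Proof. by rewrite -peE; apply: val_inj; rewrite !val_pe ff mul1r. Qed.

Lemma lideal_retract : retract P L^o.
Proof. by exists (val : {linear P -> L^o}), pe => x; apply: pe_val. Qed.
Lemma lideal_proj : projective_mod P.
Proof. exact: proj_retract lideal_retract (@proj_reg L). Qed.
Lemma lideal_fg : fin_gen P.
Proof. exact: fg_surj pe_surj (@fg_reg L). Qed.

Lemma lideal_univ (M : lmodType L) (x : M) : f *: x = x ->
  exists h : {linear P -> M}, forall a : L, h (pe a) = a *: x.
Proof.
move=> fx; have [c cE] := cyc_ex x.
have [a|h hP] := @lin_fact _ _ _ _ pe c pe_surj.
  by move=> /pe0 af; rewrite cE -fx scalerA af scale0r.
by exists h => a; rewrite hP cE.
Qed.

(** Endomorphisms of L f are right multiplications by elements of f L f, so the two projections of a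
    decomposition correspond to orthogonal idempotents with sum [f]. *)
Lemma lideal_indec : primitive_idem f -> indecomposable (sub_mod (lideal_gen f)).
Proof.
move=> [_ /eqP f0 prim]; split=> [z|X Y iso].
  by apply: f0; rewrite -[f]mul1r; apply/pe0; apply: z.
have [g [h [gh hg]]] := isoE iso.
have [i iE] := inl_ex X Y; have [j jE] := inr_ex X Y.
pose p : {linear P -> P} := h \o i \o fst \o g.
pose q : {linear P -> P} := h \o j \o snd \o g.
have pq x : p x + q x = x.
  rewrite /p /q /= -linearD iE jE -[RHS]gh; congr (h _).
  by case: (g x) => u v; congr (_, _); rewrite /= ?addr0 ?add0r.
have i1 x : (i x).1 = x by rewrite iE.
have i2 x : (i x).2 = 0 by rewrite iE.
have j1 x : (j x).1 = 0 by rewrite jE.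
have j2 x : (j x).2 = x by rewrite jE.
have pp x : p (p x) = p x by rewrite /p /= hg i1.
have qp x : q (p x) = 0 by rewrite /p /q /= hg i2 (linear0 j) (linear0 h).
have pp' x : p (q x) = 0 by rewrite /p /q /= hg j1 (linear0 i) (linear0 h).
have qq x : q (q x) = q x by rewrite /q /= hg j2.
have vE (u : {linear P -> P}) x : val (u x) = val x * val (u (pe 1)).
  by rewrite -{1}[x]pe_val peE linearZ.
have E (u v : {linear P -> P}) : val (u (pe 1)) * val (v (pe 1)) = val (v (u (pe 1))).
  by rewrite [in RHS]vE.
have v0 : val (0 : P) = 0 := linear0 (val : {linear P -> L^o}).
have h0 (u : {linear P -> P}) : val (u (pe 1)) = 0 -> forall x, u x = 0.
  by move=> u0 x; apply: val_inj; rewrite vE u0 mulr0 v0.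
have [|||||/h0 p0|/h0 q0] := prim (val (p (pe 1))) (val (q (pe 1))).
- by rewrite /idem E pp.
- by rewrite /idem E qq.
- by rewrite E qp v0.
- by rewrite E pp' v0.
- have := pq (pe 1); move=> /(congr1 val); rewrite val_pe mul1r => /esym fE.
  exact: etrans fE (linearD (val : {linear P -> L^o}) _ _).
- left=> x; have := p0 (h (i x)); rewrite /p /= hg i1.
  by move=> /(inj0 (can_inj hg)); rewrite iE => -[].
- right=> x; have := q0 (h (j x)); rewrite /q /= hg j2.
  by move=> /(inj0 (can_inj hg)); rewrite jE => -[].
Qed.
End CyclicProjectives.
Arguments pe {L} f.
Arguments pe_surj {L} f.

(** * Tops, simple modules and projectives of a basic ring *)

Section Basic.
Variables (L : pzRingType) (n : nat) (D : 'I_n -> nzRingType).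
Variable f_ : forall i, {rmorphism L -> D i}.
Hypothesis D_div : forall i, division_ring (D i).
Hypothesis f_surj : forall d : (forall i, D i), exists x, forall i, f_ i x = d i.
Hypothesis f_ker : forall x : L, x \in jacobson L <-> forall i, f_ i x = 0.
Hypothesis flL : fl L^o.
Implicit Types M N S X : lmodType L.
Local Notation J := (J f_).

Section Top.
Variables (f : L) (ff : idem f).

Lemma top_ex : exists tm : {linear L^o -> top_mod f},
  surj tm /\ forall a : L, tm a = 0 <-> J (a * f).
Proof.
pose N := smod_restrict (lideal_gen f) (lideal_mul (jacobson L) f).
exists (@quot_pi _ _ N \o pe f); split=> [y|a].
  by have [a aE] := pe_surj f (quot_repr y); exists a; rewrite /= aE; apply: quot_reprK.
rewrite /= quot_pi0 smod_restrictP lideal_mulP val_pe.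
split=> [[b /f_ker Jb ->]|Ja]; first exact: JMr.
by exists (a * f); [exact/f_ker|rewrite -mulrA ff].
Qed.
(** Sends [a] to the class of [a * f], so that [tm 1] generates the top. *)
Definition tm : {linear L^o -> top_mod f} := sval (cid top_ex).
Lemma tm_surj : surj tm. Proof. by rewrite /tm; case: cid => ? []. Qed.
Lemma tm0 (a : L) : tm a = 0 <-> J (a * f).
Proof. by rewrite /tm; case: cid => ? []. Qed.
Lemma tmE (a : L) : tm a = a *: tm 1.
Proof. by rewrite -linearZ; congr (tm _); apply/esym/mulr1. Qed.

Lemma top_J a (x : top_mod f) : J a -> a *: x = 0.
Proof.
move=> Ja; have [b <-] := tm_surj x; rewrite -linearZ; apply/(tm0 (a * b)).
by do 2 apply: JMr.
Qed.

Lemma top_fg : fin_gen (top_mod f).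
Proof. exact: fg_surj tm_surj (@fg_reg L). Qed.

Lemma top_univ M (x : M) : f *: x = x -> (forall a, J a -> a *: x = 0) ->
  exists h : {linear top_mod f -> M}, forall a : L, h (tm a) = a *: x.
Proof.
move=> fx Jx; have [c cE] := cyc_ex x.
have [a|h hP] := @lin_fact _ _ _ _ tm c tm_surj.
  by move=> /tm0/Jx; rewrite cE -scalerA fx.
by exists h => a; rewrite hP cE.
Qed.
End Top.

Lemma div_idem i (d : D i) : d * d = d -> d = 0 \/ d = 1.
Proof.
have [->|d0] := eqVneq d 0; [by left|move=> dd; right].
by have [d' [_ d'd]] := D_div d0; rewrite -[d]mul1r -{1}d'd -mulrA dd.
Qed.

Lemma fl_lideal (f : L) : fl (sub_mod (lideal_gen f)).
Proof. exact: fl_surj (pe_surj f) flL. Qed.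

(** In a product of division rings the image of [f] has coordinates 0 and 1, not all 0 by Nakayama.
    If two coordinates were 1, right multiplication by an element [y] separating them and its
    complement would both fail to be onto L f, whose endomorphism ring is local. *)
Lemma prim_kappa (f : L) : primitive_idem f ->
  exists k, f_ k f = 1 /\ forall l, l != k -> f_ l f = 0.
Proof.
move=> fp; have [ff /eqP f0 _] := fp; have iP := lideal_indec ff fp.
have fid l : f_ l f = 0 \/ f_ l f = 1.
  by apply: div_idem; rewrite -rmorphM ff.
have [k fk] : exists k, f_ k f <> 0.
  apply: contrapT => H; apply: f0; apply: (@J_nak _ _ _ _ f_ker L^o f f); last exact: esym.
  by move=> i; apply: contrapT => h; apply: H; exists i.
exists k; have fk1 : f_ k f = 1 by case: (fid k).
split=> // l lk; have [//|fl1] := fid l.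
have [u [uk ul]] := unit_coset f_surj k.
pose y := f * u * f.
have fy : f *: pe f y = pe f y by rewrite -linearZ; congr (pe f _); rewrite /GRing.scale /= /y !mulrA ff.
have [h hP] := lideal_univ fy.
have vh x : val (h x) = val x * y.
  have [a <-] := pe_surj f x; rewrite hP -linearZ !val_pe.
  have yf : y * f = y by rewrite /y -!mulrA ff.
  have fy' : f * y = y by rewrite /y !mulrA ff.
  by transitivity (a * (y * f)); [exact/esym/mulrA|rewrite yf -mulrA fy'].
have P1 : val (pe f 1) = f by rewrite val_pe mul1r.
have [x|/bij_injsurj[_ s]|/bij_injsurj[_ s]] := @local_end _ _ h (idfun \- h) (fl_lideal f) iP.
- by rewrite /= addrC subrK.
- have [z zE] := s (pe f 1); have := congr1 (fun t => f_ l (val t)) zE; rewrite /= vh P1.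
  by rewrite /y !rmorphM /= fl1 (ul l lk) !mulr0 mul0r mulr0 => /esym/eqP; rewrite oner_eq0.
have [z zE] := s (pe f 1); have := congr1 (fun t => f_ k (val t)) zE; rewrite P1.
have -> : val ((idfun \- h) z) = val z - val (h z) by exact: (linearB (val : {linear _ -> L^o})).
by rewrite vh rmorphB /y !rmorphM /= fk1 uk !mulr1 subrr => /esym/eqP; rewrite oner_eq0.
Qed.

Section Family.
Variables (I : finType) (eps : I -> L).
Hypothesis eps_prim : forall i, primitive_idem (eps i).
Hypothesis eps_orth : forall i j, i != j -> eps i * eps j = 0.
Hypothesis eps_sum : \sum_i eps i = 1.

Lemma eps_idem i : idem (eps i). Proof. by have [] := eps_prim i. Qed.

(* The component D_k of L / J in which eps_i does not vanish. *)
Definition kappa i := sval (cid (prim_kappa (eps_prim i))).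
Lemma kappaE i : f_ (kappa i) (eps i) = 1.
Proof. by rewrite /kappa; case: cid => k []. Qed.
Lemma kappa0 i l : l != kappa i -> f_ l (eps i) = 0.
Proof. by rewrite /kappa; case: cid => k [? H] /=; apply: H. Qed.
Lemma kappa_eps i j : i != j -> f_ (kappa i) (eps j) = 0.
Proof.
move=> ij; have := eps_orth ij; move=> /(congr1 (f_ (kappa i))).
by rewrite rmorphM rmorph0 /= kappaE mul1r.
Qed.

Lemma J_eps i x : J (x * eps i) <-> f_ (kappa i) x = 0.
Proof.
split=> [/(_ (kappa i))|h l]; first by rewrite rmorphM /= kappaE mulr1.
rewrite rmorphM /=; have [->|lk] := eqVneq l (kappa i); first by rewrite h mul0r.
by rewrite kappa0 // mulr0.
Qed.

Lemma top_simple i : simple_mod (top_mod (eps i)).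
Proof.
apply/simpleP; split.
  move=> /(_ (tm (eps_idem i) 1))/tm0/J_eps/eqP; by rewrite rmorph1 oner_eq0.
move=> P cP; have [|nP] := pselect (forall y, P y -> y = 0); [by left|right=> x].
have [a [Pa /eqP a0]] : exists a, P (tm (eps_idem i) a) /\ f_ (kappa i) a <> 0.
  apply: contra_notP nP => H y Py; have [a aE] := tm_surj (eps_idem i) y.
  rewrite -aE; apply/tm0/J_eps; apply: contrapT => a0; apply: H.
  by exists a; rewrite aE.
have [d [_ da]] := D_div a0; have [b bE] := f_surj1 f_surj d.
have P1 : P (tm (eps_idem i) 1).
  have -> : tm (eps_idem i) 1 = b *: tm (eps_idem i) a.
    apply/eqP; rewrite -subr_eq0 -linearZ -linearB; apply/eqP/tm0/J_eps.
    by rewrite rmorphB rmorphM rmorph1 /= bE da subrr.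
  exact: sclosedZ.
by have [c <-] := tm_surj (eps_idem i) x; rewrite tmE; apply: sclosedZ.
Qed.

Lemma top_inj i M (h : {linear top_mod (eps i) -> M}) :
  h (tm (eps_idem i) 1) <> 0 -> injective h.
Proof.
move=> h1; have /simpleP[_ s] := top_simple i.
have [k|k] := s _ (sclosed_ker h); first exact: injP.
by case: h1; apply: k.
Qed.

Lemma eps_span M (x : M) : x = \sum_i eps i *: x.
Proof. by rewrite -scaler_suml eps_sum scale1r. Qed.

Lemma simple_top i S (x : S) : simple_mod S -> eps i *: x <> 0 ->
  mod_iso (top_mod (eps i)) S.
Proof.
move=> sS x0; have [|a Ja|h hP] := @top_univ _ (eps_idem i) S (eps i *: x).
- by rewrite scalerA eps_idem.
- exact: J_simple f_ker _ _ _ sS Ja.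
apply: (@mod_isoP _ _ _ h).
  by apply: top_inj; rewrite hP scale1r.
have /simpleP[_ s] := sS; have [k|k y] := s _ (sclosed_im h); last exact: k.
by case: x0; apply: k; exists (tm (eps_idem i) 1); rewrite hP scale1r.
Qed.

(** An isomorphism writes [eps j] as a product with a factor [eps i], which vanishes in the
    component [kappa j] when [i] and [j] differ. *)
Lemma lideal_iso i j :
  mod_iso (sub_mod (lideal_gen (eps i))) (sub_mod (lideal_gen (eps j))) -> i = j.
Proof.
move=> iso; apply/eqP/negP => /negP ij; have [g [h [gh hg]]] := isoE iso.
have ei := eps_idem i; have ej := eps_idem j.
pose y : L := val (g (pe (eps i) 1)).
have yE : eps i * y = y.
  have e0 : g (eps i *: pe (eps i) 1) = eps i *: g (pe (eps i) 1) by rewrite linearZ.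
  by rewrite pe_idem // in e0; apply: (congr1 val (esym e0)).
have [a aE] := pe_surj (eps i) (h (pe (eps j) 1)).
have e1 : eps j = a * y.
  have /(congr1 val) := hg (pe (eps j) 1); rewrite val_pe mul1r -aE => <-.
  by rewrite peE linearZ.
have := congr1 (f_ (kappa j)) e1; rewrite -yE !rmorphM /= (@kappa_eps j i); last by rewrite eq_sym.
by rewrite mul0r mulr0 kappaE => /eqP; rewrite oner_eq0.
Qed.

Lemma reg_retract : retract L^o (dsum (fun i => sub_mod (lideal_gen (eps i)))).
Proof.
have [s sE] := dtup_ex (fun i => pe (eps i)).
have [r [rE _]] := dcotup_ex (fun i => (val : {linear sub_mod (lideal_gen (eps i)) -> L^o})).
exists s, r => x; rewrite rE.
transitivity (\sum_i (x : L) * eps i); last by rewrite -mulr_sumr eps_sum mulr1.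
by apply: eq_bigr => i _; rewrite sE /= val_pe.
Qed.

Lemma indec_proj X : fin_gen X -> projective_mod X -> indecomposable X ->
  exists i, mod_iso X (sub_mod (lideal_gen (eps i))).
Proof.
move=> fX pX iX; have [k r] := proj_fg_retract pX fX; have flX := fg_fl flL fX.
have [_ r1] := krs_prime flX iX r.
have [i ri] := krs_prime flX iX (retract_trans r1 reg_retract).
exists i; apply: retract_indec ri; first by case: iX.
exact: lideal_indec (eps_idem i) (eps_prim i).
Qed.
End Family.
End Basic.

(** * Grothendieck groups of relative injectives *)

(* Additive extension of a function v from a class I of relative injectives
   along finite coresolutions. Reversing ses gives the statement for relative
   projectives. *)
Section AdditiveExtension.
Variables (Ob : Type) (ses : Ob -> Ob -> Ob -> Prop) (iso : Ob -> Ob -> Prop).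
Variables (sum : Ob -> Ob -> Ob) (I : Ob -> Prop) (v : Ob -> rat).
Hypothesis I_iso : forall M N, iso M N -> I M -> I N /\ v M = v N.
Hypothesis ses_iso : forall M N J C, iso M N -> ses M J C -> ses N J C.
Hypothesis I_sum : forall M N, I M -> I N -> I (sum M N) /\ v (sum M N) = v M + v N.
Hypothesis schanuel_I : forall M J C J' C', I J -> I J' ->
  ses M J C -> ses M J' C' -> iso (sum J C') (sum J' C).
Hypothesis ses_sum : forall J M K C, I J -> ses M K C -> ses (sum J M) (sum J K) C.
Hypothesis horseshoe_I : forall A B C J A' K C', I J -> I K ->
  ses A B C -> ses A J A' -> ses C K C' ->
  exists B', ses B (sum J K) B' /\ ses A' B' C'.
Hypothesis split_I : forall A B C, I A -> I C -> ses A B C ->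
  I B /\ v B = v A + v C.
Hypothesis trivial_I : forall M, I M -> exists Z, [/\ ses M M Z, I Z & v Z = 0].

(** [z] is the alternating sum of [v] along a coresolution of [M] by [I]; it is a relation because
    such a coresolution is not unique. *)
Fixpoint euler d M (z : rat) : Prop :=
  match d with
  | 0 => I M /\ v M = z
  | d'.+1 => exists J C, [/\ I J, ses M J C & euler d' C (v J - z)]
  end.

Lemma euler_iso d M N z : iso M N -> euler d M z -> euler d N z.
Proof.
move=> mn; case: d => [|d] /=; first by move=> [/(I_iso mn)[? <-] ?].
by move=> [J [C [IJ S eC]]]; exists J, C; split=> //; apply: ses_iso mn S.
Qed.

Lemma eulerS d M z : euler d M z -> euler d.+1 M z.
Proof.
elim: d M z => [|d IH] M z /=; last first.
  by move=> [J [C [IJ S /IH eC]]]; exists J, C.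
move=> [IM <-]; have [Z [S IZ vZ]] := trivial_I IM.
by exists M, Z; split=> //; split=> //; rewrite vZ subrr.
Qed.
Lemma euler_le d d' M z : (d <= d')%N -> euler d M z -> euler d' M z.
Proof. by move=> dd h; rewrite -(subnK dd); elim: (d' - d)%N => // k; apply: eulerS. Qed.

Lemma euler_sum d J M z : I J -> euler d M z -> euler d (sum J M) (v J + z).
Proof.
move=> IJ; case: d => [|d] /=.
  by move=> [IM <-]; apply: I_sum.
move=> [K [C [IK S eC]]]; have [IJK vJK] := I_sum IJ IK.
exists (sum J K), C; split=> //; first exact: ses_sum.
by rewrite vJK opprD addrACA subrr add0r.
Qed.

(** Schanuel's lemma identifies [sum J C'] with [sum J' C], whose values are unique one step
    earlier. *)
Lemma euler_uniq d M z z' : euler d M z -> euler d M z' -> z = z'.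
Proof.
elim: d M z z' => [|d IH] M z z' /=; first by move=> [_ <-] [].
move=> [J [C [IJ S eC]]] [J' [C' [IJ' S' eC']]].
have := IH _ _ _ (euler_iso (schanuel_I IJ IJ' S S') (euler_sum IJ eC')) (euler_sum IJ' eC).
by rewrite addrCA => /addrI/addrI/oppr_inj.
Qed.

Lemma euler_ext d A B C a c : ses A B C -> euler d A a -> euler d C c -> euler d B (a + c).
Proof.
elim: d A B C a c => [|d IH] A B C a c S /=.
  by move=> [IA <-] [IC <-]; apply: split_I.
move=> [J [A' [IJ SA eA]]] [K [C' [IK SC eC]]].
have [B' [SB S']] := horseshoe_I IJ IK S SA SC; have [IJK vJK] := I_sum IJ IK.
exists (sum J K), B'; split=> //; rewrite vJK opprD addrACA.
exact: IH S' eA eC.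
Qed.

Lemma additive_ext (X : Ob -> Prop) : (forall M, X M -> exists d z, euler d M z) ->
  exists f : Ob -> rat,
    (forall A B C, X A -> X B -> X C -> ses A B C -> f B = f A + f C) /\
    (forall M, X M -> I M -> f M = v M).
Proof.
move=> H; have ex M : exists z, X M -> exists d, euler d M z.
  (* Outside [X] the value is arbitrary and set to 0. *)
  by have [/H[d [z h]]|nX] := pselect (X M); [exists z => _; exists d|exists 0].
pose f M := sval (cid (ex M)).
have fP M : X M -> exists d, euler d M (f M) by rewrite /f; case: cid.
have fu M d z : X M -> euler d M z -> f M = z.
  move=> /fP[d' h] h'; apply: (@euler_uniq (maxn d d') M).
    by apply: euler_le h; apply: leq_maxr.
  by apply: euler_le h'; apply: leq_maxl.
exists f; split=> [A B C /fP[a ha] XB /fP[c hc] S|M XM IM].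
  apply: (fu _ (maxn a c)) => //; apply: euler_ext S _ _.
    by apply: euler_le ha; apply: leq_maxl.
  by apply: euler_le hc; apply: leq_maxr.
exact: (fu _ 0%N).
Qed.
End AdditiveExtension.

Section Sides.
Variable R : pzRingType.
Hypothesis flR : fl R^o.
Implicit Types A B C F J K L M N P Q W X Y Z : lmodType R.
Let nR := fl_noeth flR.

Definition sesx A B C : Prop := exists (i : {linear A -> B}) (p : {linear B -> C}), sesm i p.

Lemma sesx_addl Q X Y Z : sesx X Y Z -> sesx (Q * X)%type (Q * Y)%type Z.
Proof.
move=> [i [p S]]; have [ii sp e] := S.
have [j jE] := pair_ex (fst : {linear (Q * X)%type -> Q}) (i \o snd).
exists j, (p \o snd); split=> [|z|[q y]].
- by apply: injP => -[q x]; rewrite jE /= => -[-> /(inj0 ii)->].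
- by have [y yE] := sp z; exists (0, y).
split=> /= [/e[x xE]|[[q' x]]]; first by exists (q, x); rewrite jE /= xE.
by rewrite jE => -[_ <-]; apply: ses0 S.
Qed.

Lemma sesx_addr Q X Y Z : sesx X Y Z -> sesx X (Q * Y)%type (Q * Z)%type.
Proof.
move=> [i [p S]]; have [ii sp e] := S.
have [j jE] := pair_ex (\0 : {linear X -> Q}) i.
have [q qE] := pair_ex (fst : {linear (Q * Y)%type -> Q}) (p \o snd).
exists j, q; split=> [|[x z]|[x y]].
- by apply: injP => x; rewrite jE => -[/(inj0 ii)].
- by have [y yE] := sp z; exists (x, y); rewrite qE /= yE.
rewrite qE /=; split=> [[-> /e[t tE]]|[t]]; first by exists t; rewrite jE tE.
by rewrite jE => -[<- <-]; congr (_, _); apply: (ses0 t S).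
Qed.

Lemma sesx_isol X X' Y Z : mod_iso X X' -> sesx X Y Z -> sesx X' Y Z.
Proof.
move=> /isoE[f [g [fg gf]]] [i [p [ii sp e]]]; exists (i \o g), p; split=> // [|y].
  by apply: inj_comp ii (can_inj gf).
by rewrite e; split=> -[x <-]; [exists (f x); rewrite /= fg|exists (g x)].
Qed.
Lemma sesx_isom X Y Y' Z : mod_iso Y Y' -> sesx X Y Z -> sesx X Y' Z.
Proof.
move=> /isoE[f [g [fg gf]]] [i [p [ii sp e]]]; exists (f \o i), (p \o g); split=> [|z|y].
- by apply: inj_comp (can_inj fg) ii.
- by have [y yE] := sp z; exists (f y); rewrite /= fg.
by rewrite /= e; split=> -[x xE]; exists x; rewrite /= ?xE // -(gf y) -xE fg.
Qed.
Lemma sesx_isor X Y Z Z' : mod_iso Z Z' -> sesx X Y Z -> sesx X Y Z'.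
Proof.
move=> /isoE[f [g [fg gf]]] [i [p S]]; exists i, (f \o p); exact: iso_ses fg gf S.
Qed.
Lemma sesx_id X Z : zero_mod Z -> sesx X X Z /\ sesx Z X X.
Proof.
move=> zZ; split; [exists idfun, \0|exists \0, idfun]; split.
- by move=> x y.
- by move=> z; exists 0; rewrite (zZ z) /=.
- by move=> x; split=> // _; exists x.
- by move=> x y _; rewrite (zZ x) (zZ y).
- by move=> x; exists x.
by move=> x; split=> [/= ->|[_ <-]] //; exists 0.
Qed.

Lemma surj_kernel_iso X X' Y Y' (q : {linear X -> Y}) (q' : {linear X' -> Y'})
   (t : {linear X -> X'}) : surj q -> surj q' -> surj t ->
   (forall x, q x = 0 <-> q' (t x) = 0) -> mod_iso Y Y'.
Proof.
move=> sq sq' st H; have [x /H|g gP] := @lin_fact _ _ _ _ q (q' \o t) sq; first by [].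
apply: (@mod_isoP _ _ _ g).
  by apply: injP => y; have [x <-] := sq y; rewrite gP => /H.
move=> y; have [x' <-] := sq' y; have [x <-] := st x'.
by exists (q x); rewrite gP.
Qed.

(** Extend [i'] to [g : J -> J'] and [i] to [g' : J' -> J]. The map [t], two shears and a swap,
    carries the copy of [M] in [J'] onto the one in [J], so the cokernels agree. *)
Lemma schanuel_inj M J C J' C' : sesx M J C -> sesx M J' C' ->
  ext1 C' J -> ext1 C J' -> mod_iso (J * C')%type (J' * C)%type.
Proof.
move=> [i [p S]] [i' [p' S']] E' E; have [ii sp e] := S; have [ii' sp' e'] := S'.
have [g gP] := E _ _ _ _ S i'; have [g' g'P] := E' _ _ _ _ S' i.
have [t tE] := pair_ex (snd \+ (g \o (fst \- (g' \o snd))) : {linear (J * J')%type -> J'})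
  (fst \- (g' \o snd)).
have [q qE] := pair_ex (fst : {linear (J * J')%type -> J}) (p' \o snd).
have [q' q'E] := pair_ex (fst : {linear (J' * J)%type -> J'}) (p \o snd).
apply: (@surj_kernel_iso _ _ _ _ q q' t) => [[x c]|[x c]|[y x]|[x y]].
- by have [y <-] := sp' c; exists (x, y); rewrite qE.
- by have [y <-] := sp c; exists (x, y); rewrite q'E.
- exists (x + g' (y - g x), y - g x); rewrite tE /=.
  by rewrite addrK subrK.
rewrite qE q'E tE /=; split=> [[-> /e'[m <-]]|[h /e[m mE]]].
  by rewrite g'P sub0r linearN gP subrr (_ : p _ = 0) // linearN (ses0 _ S) oppr0.
have yE : y = - i' m.
  by apply/eqP; rewrite -addr_eq0 -gP mE h.
have xE : x = i m + g' y by rewrite mE subrK.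
by rewrite xE yE !linearN g'P subrr (ses0 _ S') oppr0.
Qed.

(** An extension [u] of [a] to [B], together with the composite [B -> C -> K], embeds [B] in
    [J * K]. *)
Lemma horseshoe_inj A B C J A' K C' : sesx A B C -> sesx A J A' -> sesx C K C' ->
  ext1 C J -> exists B', sesx B (J * K)%type B' /\ sesx A' B' C'.
Proof.
move=> [i [p S]] [a [a' SA]] [c [c' SC]] E.
have [u uP] := E _ _ _ _ S a; have [ii sp e] := S.
have [ai sa' ea] := SA; have [ci sc' ec] := SC.
have [h hE] := pair_ex u (c \o p).
have hi : injective h.
  apply: injP => b; rewrite hE /= => -[ub /(inj0 ci)/e[x xb]].
  by rewrite -xb; rewrite -xb uP in ub; rewrite (inj0 ai ub) linear0.
have [B' [q Sh]] := ses_of_inj hi; have [_ sq eh] := Sh.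
exists B'; split; first by exists h, q.
have [l lE] := inl_ex J K.
have [y /ea[x <-]|s sP] := @lin_fact _ _ _ _ a' (q \o l) sa'.
  by apply/eh; exists (i x); rewrite hE uP /= (ses0 _ S) linear0 lE.
have [z /eh[b <-]|t tP] := @lin_fact _ _ _ _ q (c' \o snd) sq.
  by rewrite hE /=; apply: ses0 SC.
exists s, t; split=> [|z|z].
- apply: injP => y; have [x <-] := sa' y; rewrite sP /= => /eh[b].
  rewrite hE lE /= => -[ub /(inj0 ci)/e[w wb]].
  by rewrite -ub -wb uP; apply: ses0 SA.
- by have [k <-] := sc' z; exists (q (0, k)); rewrite tP.
have [[x k] <-] := sq z; rewrite tP /=; split=> [/ec[y yk]|[w]].
  have [b pb] := sp y; exists (a' (x - u b)); rewrite sP /=.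
  apply/eqP; rewrite -subr_eq0 -linearB; apply/eqP/eh; exists (- b).
  rewrite linearN hE lE /= pb yk; congr (_, _); rewrite /= ?sub0r //.
  by rewrite addrC addKr.
have [y <-] := sa' w; rewrite sP /= => /eqP; rewrite -subr_eq0 -linearB => /eqP/eh[b].
rewrite hE lE /= => -[_]; rewrite sub0r => /eqP; rewrite -eqr_oppLR -linearN => /eqP <-.
by rewrite -linearN; apply: ses0 SC.
Qed.

Definition pses A B C : Prop := [/\ pfin A, pfin B, pfin C & sesx A B C].
Definition ses_additive (f : lmodType R -> rat) : Prop :=
  forall A B C, pses A B C -> f B = f A + f C.

Section Additive.
Variables (f : lmodType R -> rat) (f_add : ses_additive f).
Lemma additive0 Z : zero_mod Z -> f Z = 0.
Proof.
move=> zZ; have pZ := pfin_zero zZ; have [S _] := sesx_id Z zZ.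
have : f Z + 0 = f Z + f Z by rewrite addr0; exact: f_add (And4 pZ pZ pZ S).
by move=> /addrI.
Qed.
Lemma additive_iso X Y : mod_iso X Y -> pfin X -> f X = f Y.
Proof.
move=> iso pX; have [Z zZ] := zero_mod_ex R; have pZ := pfin_zero zZ.
have [S _] := sesx_id X zZ; have pY := pfin_iso iso pX.
by rewrite (f_add (And4 pX pY pZ (sesx_isom iso S))) (additive0 zZ) addr0.
Qed.
Lemma additive_prod X Y : pfin X -> pfin Y -> f (X * Y)%type = f X + f Y.
Proof.
move=> pX pY; have [h hE] := inl_ex X Y; apply: f_add; split=> //; first exact: pfin_prod.
by exists h, snd; apply: ses_prod.
Qed.
Lemma additive_cores (I : lmodType R -> Prop) n M :
  (forall N, I N -> pfin N) -> (forall N, I N -> f N = 0) -> pfin M -> cores I n M -> f M = 0.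
Proof.
move=> IP fI; elim: n M => [|n IH] M pM /=; first exact: fI.
move=> [A [M' [i [q [IA S cM']]]]]; have pA := IP _ IA.
have pM' := pfin_quot S pM pA.
have : f A = f M + f M' by apply: f_add; split=> //; exists i, q.
by rewrite fI // (IH _ pM' cM') addr0 => <-.
Qed.
Lemma additive_proj0 M : (forall P, fin_gen P -> projective_mod P -> f P = 0) ->
  pfin M -> f M = 0.
Proof.
move=> fP [fM [n]]; elim: n M fM => [|n IH] M fM pM; first exact: fP.
have [K [F [i [q [S pF fF pK]]]]] := fg_syz fM pM.
have fK : fin_gen K by case: S => ii _ _; apply: nR ii fF.
have : f F = f K + f M.
  apply: f_add; split; [by split=> //; exists n|exact: pfin_proj|by split=> //; exists n.+1|].
  by exists i, q.
by rewrite fP // (IH K fK pK) add0r => <-.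
Qed.
End Additive.

Definition sum_invariant (I : lmodType R -> Prop) (v : lmodType R -> rat) :=
  (forall M N, mod_iso M N -> I M -> v M = v N) /\
  (forall M N, I M -> I N -> v (M * N)%type = v M + v N).

Lemma sum_invariant0 (I : lmodType R -> Prop) v Z :
  sum_invariant I v -> I Z -> zero_mod Z -> v Z = 0.
Proof.
move=> [vi vs] IZ zZ; have : v Z + 0 = v Z + v Z.
  by rewrite addr0 -vs //; apply: vi => //; apply/iso_sym/prod_iso0.
by move=> /addrI.
Qed.

Lemma additive_ext_inj (I : lmodType R -> Prop) v :
  (forall M, I M -> pfin M /\ forall X, pfin X -> ext1 X M) ->
  (forall Z, zero_mod Z -> I Z) -> (forall M N, I M -> I N -> I (M * N)%type) ->
  (forall M N, mod_iso M N -> I M -> I N) ->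
  (forall M, pfin M -> exists n, cores I n M) ->
  sum_invariant I v ->
  exists f, ses_additive f /\ forall M, I M -> f M = v M.
Proof.
move=> IP I0 Is Ii ex vP; have [vi vs] := vP.
have IE M X : I M -> pfin X -> ext1 X M by move=> /IP[_]; apply.
have Ipf M : I M -> pfin M by move=> /IP[].
have euler_ex M : pfin M -> exists d z, euler pses I v d M z.
  move=> pM; have [n] := ex M pM; elim: n M pM => [|n IH] M pM /=.
    by exists 0%N, (v M).
  move=> [A [M' [i [q [IA S cM']]]]].
  have pM' := pfin_quot S pM (Ipf _ IA); have [d [z dz]] := IH M' pM' cM'.
  exists d.+1, (v A - z), A, M'; split=> //; last by rewrite opprB addrC subrK.
  by split=> //; [exact: Ipf|exists i, q].
have [||||||||f [fa fv]] := @additive_ext _ pses (@mod_iso R) (fun M N => (M * N)%type : lmodType R) I v _ _ _ _ _ _ _ _ _ euler_ex.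
- by move=> M N iso IM; split; [apply: Ii iso IM|apply: vi].
- by move=> M N J C iso [pM pJ pC S]; split=> //; [exact: pfin_iso iso pM|exact: sesx_isol S].
- by move=> M N IM IN; split; [apply: Is|apply: vs].
- move=> M J C J' C' IJ IJ' [_ _ pC S] [_ _ pC' S'].
  by apply: (schanuel_inj S S'); apply: IE.
- move=> J M K C IJ [pM pK pC S]; have pJ := Ipf _ IJ.
  by split=> //; [exact: pfin_prod|exact: pfin_prod|exact: sesx_addl].
- move=> A B C J A' K C' IJ IK [pA pB pC S] [_ pJ pA' SA] [_ pK pC' SC].
  have [B' [S1 S2]] := horseshoe_inj S SA SC (IE _ _ IJ pC).
  have pB' : pfin B' by have [i [p]] := S1; move=> /pfin_quot; apply=> //; apply: pfin_prod.
  by exists B'; split; split=> //; apply: pfin_prod.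
- move=> A B C IA IC [pA pB pC [i [p S]]].
  have iso := ext1_iso (IE _ _ IA pC) S.
  split; first by apply: Ii (iso_sym iso) _; apply: Is.
  by rewrite -(vi _ _ (iso_sym iso)) ?vs ?[v C + _]addrC //; apply: Is.
- move=> M IM; have [Z zZ] := zero_mod_ex R; have IZ := I0 _ zZ.
  exists Z; split=> //; last exact: sum_invariant0 vP IZ zZ.
  by split; [exact: Ipf|exact: Ipf|exact: Ipf|exact: (proj1 (sesx_id M zZ))].
exists f; split=> [A B C S|M IM]; first by have [pA pB pC _] := S; apply: (fa A B C pA pB pC S).
exact: (fv M (Ipf _ IM)).
Qed.

Lemma horseshoe_proj A B C P A' Q C' : projective_mod Q ->
  sesx A B C -> sesx A' P A -> sesx C' Q C ->
  exists B', sesx B' (P * Q)%type B /\ sesx A' B' C'.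
Proof.
move=> pQ [i [p S]] [k [u Sk]] [l [w Sl]].
have [W [j [t [a [b [S1 S2]]]]]] := horseshoe pQ S Sk Sl.
by exists W; split; [exists j, t|exists a, b].
Qed.

Lemma additive_ext_proj v (I := fun P : lmodType R => fin_gen P /\ projective_mod P) :
  sum_invariant I v -> exists f, ses_additive f /\ forall M, I M -> f M = v M.
Proof.
move=> vP; have [vi vs] := vP.
have Is M N : I M -> I N -> I (M * N)%type.
  by move=> [fM pM] [fN pN]; split; [exact: fg_prod|exact: proj_prod].
have Ii M N : mod_iso M N -> I M -> I N.
  move=> iso [fM pM]; split; first exact: fg_iso iso fM.
  exact: proj_retract (iso_retract (iso_sym iso)) pM.
have Ipf M : I M -> pfin M by move=> [fM pM]; apply: pfin_proj.
have Iz Z : zero_mod Z -> I Z by move=> zZ; split; [exact: fg_zero|exact: proj_zero].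
pose ses A B C := pses C B A.
have euler_ex M : pfin M -> exists d z, euler ses I v d M z.
  move=> [fM [n]]; elim: n M fM => [|n IH] M fM pM; first by exists 0%N, (v M).
  have [K [F [i [q [S pF fF pK]]]]] := fg_syz fM pM.
  have fK : fin_gen K by case: S => ii _ _; apply: nR ii fF.
  have [d [z dz]] := IH K fK pK.
  exists d.+1, (v F - z), F, K; split=> //; last by rewrite opprB addrC subrK.
  split; [by split=> //; exists n|exact: pfin_proj|by split=> //; exists n.+1|by exists i, q].
have [||||||||f [fa fv]] := @additive_ext _ ses (@mod_iso R) (fun M N => (M * N)%type : lmodType R) I v _ _ _ _ _ _ _ _ _ euler_ex.
- by move=> M N iso IM; split; [apply: Ii iso IM|apply: vi].
- by move=> M N J C iso [pC pJ pM S]; split=> //; [exact: pfin_iso iso pM|exact: sesx_isor S].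
- by move=> M N IM IN; split; [apply: Is|apply: vs].
- move=> M J C J' C' [_ pJ] [_ pJ'] [_ _ _ [i [q S]]] [_ _ _ [i' [q' S']]].
  exact: schanuel pJ' pJ S' S.
- move=> J M K C IJ [pC pK pM S]; have pJ := Ipf _ IJ.
  by split=> //; [exact: pfin_prod|exact: pfin_prod|exact: sesx_addr].
- move=> A B C J A' K C' IJ IK [pC pB pA S] [pA' pJ _ SA] [pC' pK _ SC].
  have [B' [S1 S2]] := horseshoe_proj (proj2 IJ) S SC SA.
  have {}S1 := sesx_isom (prod_isoC K J) S1.
  have pB' : pfin B' by have [i [p]] := S1; move=> /(pfin_sub nR); apply=> //; apply: pfin_prod.
  by exists B'; split; split=> //; apply: pfin_prod.
- move=> A B C IA IC [pC pB pA [i [p S]]].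
  have iso := ext1_iso (ext1_proj (proj2 IA)) S.
  split; first by apply: Ii (iso_sym iso) _; apply: Is.
  by rewrite -(vi _ _ (iso_sym iso)) ?vs //; apply: Is.
- move=> M IM; have [Z zZ] := zero_mod_ex R; have IZ := Iz _ zZ.
  exists Z; split=> //; last exact: sum_invariant0 vP IZ zZ.
  by split; [exact: Ipf|exact: Ipf|exact: Ipf|exact: (proj2 (sesx_id M zZ))].
exists f; split=> [A B C S|M IM]; last exact: (fv M (Ipf _ IM)).
by have [pA pB pC _] := S; rewrite (fa C B A) // addrC.
Qed.
End Sides.

(** * Multiplicities of indecomposable summands as functions *)

Section Multiplicity.
Variable R : pzRingType.
Implicit Types M N X Y Z : lmodType R.

(** The value 0 also stands for the absence of a finite multiplicity; for nonzero [X] this does not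
    occur on modules of finite length. *)
Definition multv X M : rat :=
  if pselect (exists a, mult X a M) is left h then (sval (cid h))%:R else 0.

Lemma multvE X M a : fl X -> indecomposable X -> mult X a M -> multv X M = a%:R.
Proof.
move=> fX iX m; rewrite /multv; case: pselect => [h|[]]; last by exists a.
by case: cid => b /= m'; rewrite (mult_uniq fX iX m m').
Qed.

Lemma multv_invariant (I : lmodType R -> Prop) X : fl X -> indecomposable X ->
  (forall M, I M -> fl M) -> sum_invariant I (multv X).
Proof.
move=> fX iX If; have nX := proj1 iX; split=> M N.
  move=> iso /If fM; have [a m] := mult_ex fM nX.
  by rewrite (multvE fX iX m) (multvE fX iX (mult_iso iso m)).
move=> /If fM /If fN; have [a m] := mult_ex fM nX; have [b m'] := mult_ex fN nX.
by rewrite (multvE fX iX m) (multvE fX iX m') (multvE fX iX (mult_prod fX iX m m')) natrD.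
Qed.

Lemma multv_self X : fl X -> indecomposable X -> multv X X = 1.
Proof.
move=> fX iX; have [Z zZ] := zero_mod_ex R; rewrite (@multvE _ _ 1%N) //.
exists Z; split; first exact: iso_sym (prod_iso0 X zZ).
by move=> /retract_zero/(_ zZ); case: iX.
Qed.

Lemma multv_none X M : fl X -> indecomposable X -> ~ retract X M -> multv X M = 0.
Proof. by move=> fX iX r; rewrite (@multvE _ _ 0%N). Qed.
End Multiplicity.

(** * Dual bases of additive functions and their cardinality *)

Section Bases.
Variable R : pzRingType.
Hypothesis flR : fl R^o.
Implicit Types A B C F K L M N P Q W X Y Z : lmodType R.
Let nR := fl_noeth flR.

(** [psi j] extends the multiplicity of [X j]. The difference [g] of [f] and its expansion vanishes
    on every [X i], hence on [I] by decomposition into indecomposables, hence on Pfin by the fourth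
    hypothesis. *)
Lemma additive_basis (I : lmodType R -> Prop) (KX : finType) (X : KX -> lmodType R) :
  (forall M, I M -> pfin M) -> (forall M N, retract M N -> I N -> I M) ->
  (forall v, sum_invariant I v -> exists f, ses_additive f /\ forall M, I M -> f M = v M) ->
  (forall f, ses_additive f -> (forall M, I M -> f M = 0) -> forall M, pfin M -> f M = 0) ->
  (forall i, I (X i) /\ indecomposable (X i)) ->
  (forall i j, mod_iso (X i) (X j) -> i = j) ->
  (forall Y, I Y -> indecomposable Y -> exists i, mod_iso Y (X i)) ->
  exists psi : KX -> lmodType R -> rat,
    [/\ forall j, ses_additive (psi j), forall j M, I M -> psi j M = multv (X j) M,
      forall i j, psi i (X j) = (i == j)%:R &
      forall f, ses_additive f -> forall M, pfin M -> f M = \sum_j psi j M * f (X j)].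
Proof.
move=> Ip Ir ext van IX dX exX.
have If M : I M -> fl M by move=> /Ip[fM _]; apply: fg_fl.
have fX i : fl (X i) by apply: If; case: (IX i).
have ex j : exists f, ses_additive f /\ forall M, I M -> f M = multv (X j) M.
  by apply: ext; apply: multv_invariant => //; case: (IX j).
pose psi j := sval (cid (ex j)).
have pa j : ses_additive (psi j) by rewrite /psi; case: cid => ? [].
have pE j M : I M -> psi j M = multv (X j) M.
  by move=> IM; rewrite /psi; case: cid => f [? H]; apply: H.
have pX i j : psi i (X j) = (i == j)%:R.
  have [Ij ij] := IX j; have [Ii ii] := IX i; rewrite pE //.
  have [->|nij] := eqVneq i j; first exact: multv_self.
  apply: multv_none => // r; move/eqP: nij; apply; apply: dX.
  by apply: retract_indec r; [case: ii|].
exists psi; split=> // f fa M pM.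
pose g N := f N - \sum_j psi j N * f (X j).
have ga : ses_additive g.
  move=> A B C S; rewrite /g (fa _ _ _ S) addrACA -opprD; congr (_ - _).
  by rewrite -big_split; apply: eq_bigr => j _; rewrite (pa j _ _ _ S) mulrDl.
suff : g M = 0 by move=> /eqP; rewrite subr_eq0 => /eqP.
apply: (van g ga) pM => N IN {M}.
suff [] : pfin N /\ g N = 0 by [].
apply: (@krs_closure _ (fun M => pfin M /\ g M = 0)) (If _ IN) _.
- by move=> Z zZ; split; [exact: pfin_zero|exact: additive0 ga _ zZ].
- by move=> Y Z [pY gY] [pZ gZ]; split; [exact: pfin_prod|rewrite (additive_prod ga) // gY gZ addr0].
- by move=> Y Z iso [pY gY]; split; [exact: pfin_iso iso pY|rewrite -(additive_iso ga iso)].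
move=> Y iY rY; have IY := Ir _ _ rY IN; split; first exact: Ip.
have [i iso] := exX _ IY iY; rewrite (additive_iso ga iso (Ip _ IY)) /g.
rewrite (bigD1 i) //= pX eqxx mul1r big1 ?addr0 ?subrr // => j ji.
by rewrite pX (negPf ji) mul0r.
Qed.

(** The matrices expressing each family in terms of the other are mutually inverse, which forces
    them to be square. *)
Lemma basis_count (KX KP : finType) (X : KX -> lmodType R) (P : KP -> lmodType R)
  (psi : KX -> lmodType R -> rat) (chi : KP -> lmodType R -> rat) :
  (forall i, pfin (X i)) -> (forall i, pfin (P i)) ->
  (forall j, ses_additive (psi j)) -> (forall j, ses_additive (chi j)) ->
  (forall i j, psi i (X j) = (i == j)%:R) -> (forall i j, chi i (P j) = (i == j)%:R) ->
  (forall f, ses_additive f -> forall M, pfin M -> f M = \sum_j psi j M * f (X j)) ->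
  (forall f, ses_additive f -> forall M, pfin M -> f M = \sum_j chi j M * f (P j)) ->
  #|KX| = #|KP|.
Proof.
move=> pX pP pa ca pXE cPE pB cB.
pose A := \matrix_(i < #|KX|, j < #|KP|) psi (enum_val i) (P (enum_val j)).
pose B := \matrix_(j < #|KP|, i < #|KX|) chi (enum_val j) (X (enum_val i)).
have AB : A *m B = 1%:M.
  apply/matrixP => i l; rewrite !mxE -(inj_eq enum_val_inj) -pXE (cB _ (pa _) _ (pX _)).
  by rewrite (reindex _ (onW_bij _ (enum_val_bij KP))); apply: eq_bigr => j _; rewrite !mxE mulrC.
have BA : B *m A = 1%:M.
  apply/matrixP => i l; rewrite !mxE -(inj_eq enum_val_inj) -cPE (pB _ (ca _) _ (pP _)).
  by rewrite (reindex _ (onW_bij _ (enum_val_bij KX))); apply: eq_bigr => j _; rewrite !mxE mulrC.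
by apply/eqP; rewrite eqn_leq (mulmx1_min AB) (mulmx1_min BA).
Qed.

Section RelativeInjectives.
Variable C0 : lmodType R -> Prop.
Hypothesis C0_pfin : forall M, C0 M -> pfin M.
Hypothesis C0_ext : forall M, C0 M -> forall X, pfin X -> ext1 X M.
Hypothesis C0_zero : forall Z, zero_mod Z -> C0 Z.
Hypothesis C0_prod : forall M N, C0 M -> C0 N -> C0 (M * N)%type.
Hypothesis C0_retract : forall M N, retract M N -> C0 N -> C0 M.

Lemma cores_iso n M N : mod_iso M N -> cores C0 n M -> cores C0 n N.
Proof.
move=> iso; case: n => [|n]; first exact/C0_retract/iso_retract/iso_sym.
move=> [A [M' [i [q [CA S cM']]]]]; have [j [p S']] : sesx N A M'.
  by apply: sesx_isol iso _; exists i, q.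
by exists A, M', j, p.
Qed.

Lemma coresS n M : cores C0 n M -> cores C0 n.+1 M.
Proof.
elim: n M => [|n IH] M; last first.
  by move=> [A [M' [i [q [CA S /IH cM']]]]]; exists A, M', i, q.
move=> CM; have [Z zZ] := zero_mod_ex R; have [[i [q S]] _] := sesx_id M zZ.
by exists M, Z, i, q; split=> //; apply: C0_zero.
Qed.

Lemma cores_ext n A B C : pfin C -> sesx A B C ->
  cores C0 n A -> cores C0 n C -> cores C0 n B.
Proof.
elim: n A B C => [|n IH] A B C pC S.
  move=> CA CC; have [i [p {}S]] := S; have iso := ext1_iso (C0_ext CA pC) S.
  exact: C0_retract (iso_retract iso) (C0_prod CC CA).
move=> [J [A' [i [p [CJ SA cA]]]]] [K [C' [j [q [CK SC cC]]]]].
have SA' : sesx A J A' by exists i, p.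
have SC' : sesx C K C' by exists j, q.
have [B' [[s [t S1]] S2]] := horseshoe_inj S SA' SC' (C0_ext CJ pC).
exists (J * K)%type, B', s, t; split=> //; first exact: C0_prod.
exact: IH (pfin_quot SC pC (C0_pfin CK)) S2 cA cC.
Qed.

(** [M'] is [J / M], and the cokernel of [N] in it is that of [M * N] in [J]. *)
Lemma ses_prod_quot M N J C : sesx (M * N)%type J C ->
  exists M', sesx M J M' /\ sesx N M' C.
Proof.
move=> [i [q S]]; have [ii sq e] := S.
have [a aE] := inl_ex M N; have [b bE] := inr_ex M N.
have ai : injective (i \o a) by apply: inj_comp ii _ => x y; rewrite !aE => -[].
have [M' [p Sp]] := ses_of_inj ai; have [_ sp ep] := Sp.
have [x /ep[m <-]|t tP] := @lin_fact _ _ _ _ p q sp; first exact: ses0 S.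
exists M'; split; first by exists (i \o a), p.
exists (p \o i \o b), t; split=> [|c|y].
- apply: injP => n /= /ep[m] /= /ii; rewrite aE bE => -[_ ->] //.
- by have [x <-] := sq c; exists (p x).
have [x <-] := sp y; rewrite tP; split=> [/e[[m n] <-]|[n nE]].
  exists n; have -> : (m, n) = a m + b n.
    by rewrite aE bE; congr (_, _); rewrite /= ?addr0 ?add0r.
  by rewrite /= !linearD (_ : p (i (a m)) = 0) ?add0r //; apply/ep; exists m.
by rewrite -tP -nE /= tP; apply: ses0 S.
Qed.

(* Summands of modules with finite C0-coresolution: closed under cosyzygies,
   since if M x N -> J has cokernel C' then M x (J/M) is an extension of C' by
   M x N. *)
Lemma proj_cores d s : (forall X, pfin X -> pd d X) -> cores C0 s R^o ->
  forall P, fin_gen P -> projective_mod P -> cores C0 d P.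
Proof.
move=> bd cR; pose B M := pfin M /\ exists N, pfin N /\ exists n, cores C0 n (M * N)%type.
suff H N : B N -> cores C0 d N.
  move=> P fP pP; apply: H; split; first exact: pfin_proj.
  have [k r] := proj_fg_retract pP fP.
  have /retractP[N iso] := r; exists N.
  have pF : pfin (dsum (fun _ : 'I_k => R^o)).
    by apply: pfin_proj; [exact: fg_free|exact: proj_free].
  split.
    apply: pfin_retract pF; apply: retract_trans (retract_snd P N) _.
    exact: iso_retract (iso_sym iso).
  exists s; apply: cores_iso iso _.
  suff [] : pfin (dsum (fun _ : 'I_k => R^o)) /\ cores C0 s (dsum (fun _ : 'I_k => R^o)) by [].
  have pR : pfin R^o by apply: pfin_proj; [exact: fg_reg|exact: proj_reg].
  apply: (@dsum_ind _ (fun M => pfin M /\ cores C0 s M)) => [Z zZ|X Y [pX cX] [pY cY]|X Y iso' [pX cX]|//].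
  - split; first exact: pfin_zero.
    by elim: (s) => [|s' IH]; [exact: C0_zero|exact: coresS].
  - split; first exact: pfin_prod.
    by have [h hE] := inl_ex X Y; apply: (cores_ext pY _ cX cY); exists h, snd; apply: ses_prod.
  by split; [exact: pfin_iso iso' pX|exact: cores_iso iso' cX].
apply: (@cores_ex _ C0 B) => // [M []//|M [pM [N' [pN' [n cMN]]]]].
have mono k l X : (k <= l)%N -> cores C0 k X -> cores C0 l X.
  by move=> kl h; rewrite -(subnK kl); elim: (l - k)%N => // ?; apply: coresS.
(* Padding to positive length guarantees that there is a first term [J]. *)
have {cMN} : cores C0 n.+1 (M * N')%type by apply: mono cMN.
move=> cMN; have [J [C' [i [q [CJ S cC']]]]] := cMN.
have [M' [S1 S2]] := ses_prod_quot (ex_intro _ i (ex_intro _ q S)).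
have pJ := C0_pfin CJ; have [a [b Sa]] := S1.
have pM' := pfin_quot Sa pM pJ.
have pC' := pfin_quot S (pfin_prod pM pN') pJ.
exists J, M', a, b; split=> //; last exact: C0_ext.
split=> //; exists M; split=> //; exists n.+1; apply: cores_iso (prod_isoC _ _) _.
by apply: cores_ext pC' (sesx_addl M S2) cMN (coresS cC').
Qed.
End RelativeInjectives.

Section Count.
Definition extinj M := pfin M /\ forall X, pfin X -> ext1 X M.

Lemma extinj_retract M N : retract M N -> extinj N -> extinj M.
Proof.
move=> r [pN eN]; split; first exact: pfin_retract r pN.
by move=> X pX; apply: ext1_retractN r (eN _ pX).
Qed.
Lemma extinj_prod M N : extinj M -> extinj N -> extinj (M * N)%type.
Proof.
move=> [pM eM] [pN eN]; split=> [|X pX]; first exact: pfin_prod.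
move=> Y Z i q S f; have [g gP] := eM X pX _ _ _ _ S (fst \o f).
have [g' g'P] := eN X pX _ _ _ _ S (snd \o f).
have [h hE] := pair_ex g g'; exists h => y; rewrite hE gP g'P /=.
by case: (f y).
Qed.
Lemma extinj_zero Z : zero_mod Z -> extinj Z.
Proof.
move=> zZ; split=> [|X _ Y W i q S f]; first exact: pfin_zero.
by exists \0 => y; rewrite (zZ (f y)).
Qed.

Variables (d s : nat) (KX KP : finType) (P : KP -> lmodType R) (X : KX -> lmodType R).
Variable C0 : lmodType R -> Prop.
Hypothesis bd : forall M, pfin M -> pd d M.
Hypothesis P_proj : forall i, [/\ fin_gen (P i), projective_mod (P i) & indecomposable (P i)].
Hypothesis P_iso : forall i j, mod_iso (P i) (P j) -> i = j.
Hypothesis P_all : forall Y, fin_gen Y -> projective_mod Y -> indecomposable Y ->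
  exists i, mod_iso Y (P i).
Hypothesis X_ext : forall i, extinj (X i) /\ indecomposable (X i).
Hypothesis X_iso : forall i j, mod_iso (X i) (X j) -> i = j.
Hypothesis X_all : forall Y, extinj Y -> indecomposable Y -> exists i, mod_iso Y (X i).
Hypothesis ext_emb : forall M, pfin M -> exists (J M' : lmodType R),
  extinj J /\ sesx M J M'.

Lemma extinj_cores M : pfin M -> cores extinj d M.
Proof.
apply: (@cores_ex _ extinj (@pfin R)) => // [A B|N pN]; first exact: extinj_retract.
have [J [M' [eJ [i [q S]]]]] := ext_emb pN; have [pJ EJ] := eJ.
by exists J, M', i, q; split=> //; apply: pfin_quot S pN pJ.
Qed.

Lemma extinj_basis : exists psi : KX -> lmodType R -> rat,
    [/\ forall j, ses_additive (psi j), forall j M, extinj M -> psi j M = multv (X j) M,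
      forall i j, psi i (X j) = (i == j)%:R &
      forall f, ses_additive f -> forall M, pfin M -> f M = \sum_j psi j M * f (X j)].
Proof.
apply: (@additive_basis extinj) => //; first by move=> M [].
- exact: extinj_retract.
- move=> v; apply: additive_ext_inj => //.
  + exact: extinj_zero.
  + exact: extinj_prod.
  + by move=> M N /iso_sym/iso_retract; apply: extinj_retract.
  + by move=> M pM; exists d; apply: extinj_cores.
move=> f fa fI M pM; apply: (additive_cores fa _ fI pM (extinj_cores pM)).
by move=> N [].
Qed.

Lemma extinj_count : #|KX| = #|KP|.
Proof.
have [psi [pa _ pX pB]] := extinj_basis.
have [|||||||chi [ca _ cP cB]] := @additive_basis (fun P => fin_gen P /\ projective_mod P) KP P.
- by move=> M [fM pM]; apply: pfin_proj.
- by move=> M N r [fN pN]; split; [exact: fg_retract r fN|exact: proj_retract r pN].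
- by move=> v; apply: additive_ext_proj.
- by move=> f fa fP M; apply: (additive_proj0 flR fa) => Q fQ pQ; apply: fP.
- by move=> i; have [] := P_proj i.
- exact: P_iso.
- by move=> Y [fY pY]; apply: P_all.
apply: (basis_count _ _ pa ca pX cP pB cB) => i; first by have [[]] := X_ext i.
by have [fP pP _] := P_proj i; apply: pfin_proj.
Qed.

(** If [X j] were outside [C0], its multiplicity would vanish on [C0]; so [psi j] would vanish on
    projectives by their coresolutions, hence on all of Pfin. But it is 1 on [X j]. *)
Lemma extinj_tilting : (forall M, C0 M -> extinj M) ->
  (forall Z, zero_mod Z -> C0 Z) -> (forall M N, C0 M -> C0 N -> C0 (M * N)%type) ->
  (forall M N, retract M N -> C0 N -> C0 M) -> cores C0 s R^o ->
  forall j, C0 (X j).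
Proof.
move=> Ce Cz Cp Cr cR j; apply: contrapT => nC.
have Cpf M : C0 M -> pfin M by move=> /Ce[].
have Cext M : C0 M -> forall X, pfin X -> ext1 X M by move=> /Ce[].
have [psi [pa pE pX _]] := extinj_basis.
have : psi j (X j) = 0.
  apply: (additive_proj0 flR (pa j)); last by have [[]] := X_ext j.
  move=> Q fQ pQ.
  have cQ := proj_cores Cpf Cext Cz Cp Cr bd cR fQ pQ.
  apply: (additive_cores (pa j) Cpf _ (pfin_proj fQ pQ) cQ) => M CM.
  rewrite pE; last exact: Ce.
  have [[[fX _] _] iX] := X_ext j.
  by apply: multv_none => //; [exact: fg_fl flR _ fX|move=> r; apply: nC; apply: Cr r CM].
by rewrite pX eqxx => /eqP; rewrite oner_eq0.
Qed.
End Count.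
End Bases.

(** * The corner functor *)

Section CornerFunctor.
Variables (L : pzRingType) (e : L) (he : idem e).
Local Notation B := (corner he).
Local Notation cor M := (corner_mod M he).
Implicit Types M N X Y Z T F : lmodType L.

Lemma cval0 M : val (0 : cor M) = 0. Proof. by []. Qed.
Lemma cvalD M (x y : cor M) : val (x + y) = val x + val y. Proof. by []. Qed.
Lemma cvalZ M (b : B) (x : cor M) : val (b *: x) = val b *: val x. Proof. by []. Qed.
Lemma cval_e M (x : cor M) : e *: val x = val x.
Proof. exact/eqP/(valP x). Qed.
Lemma cval_eb M (b : L) (x : cor M) : (e * b * e) *: val x = e *: (b *: val x).
Proof. by rewrite -!scalerA cval_e. Qed.

Lemma cel_subproof M (x : M) : corner_mod_pred e (e *: x).
Proof. by rewrite /corner_mod_pred scalerA he. Qed.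
Definition cel M (x : M) : cor M := Sub (e *: x) (cel_subproof x).
Lemma val_cel M (x : M) : val (cel x) = e *: x. Proof. by []. Qed.
Lemma cel_val M (x : cor M) : cel (val x) = x.
Proof. by apply: val_inj; rewrite val_cel cval_e. Qed.
Lemma celD M (x y : M) : cel (x + y) = cel x + cel y.
Proof. by apply: val_inj; rewrite cvalD !val_cel scalerDr. Qed.
Lemma cel_e M (x : M) : cel (e *: x) = cel x.
Proof. by apply: val_inj; rewrite !val_cel scalerA he. Qed.
Lemma cel0 M : cel (0 : M) = 0.
Proof. by apply: val_inj; rewrite val_cel scaler0. Qed.

Lemma ceb_subproof (b : L) : corner_pred e (e * b * e).
Proof. by rewrite /corner_pred !mulrA he -!mulrA he. Qed.
Definition ceb (b : L) : B := Sub (e * b * e) (ceb_subproof b).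
Lemma val_ceb b : val (ceb b) = e * b * e. Proof. by []. Qed.
Lemma celZ M (b : L) (x : cor M) : cel (b *: val x) = ceb b *: x.
Proof. by apply: val_inj; rewrite cvalZ val_cel val_ceb cval_eb. Qed.

Lemma cmap_ex M N (f : {linear M -> N}) :
  exists g : {linear cor M -> cor N}, forall x, val (g x) = f (val x).
Proof.
pose g (x : cor M) : cor N := cel (f (val x)).
have gE x : val (g x) = f (val x) by rewrite val_cel -linearZ /= cval_e.
have gL : linear g.
  by move=> b x y; apply: val_inj; rewrite cvalD cvalZ !gE cvalD cvalZ linearP.
by exists (mkL gL).
Qed.
Definition cmap M N (f : {linear M -> N}) : {linear cor M -> cor N} := sval (cid (cmap_ex f)).
Lemma val_cmap M N (f : {linear M -> N}) x : val (cmap f x) = f (val x).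
Proof. by rewrite /cmap; case: cid. Qed.
Lemma cmap_cel M N (f : {linear M -> N}) x : cmap f (cel x) = cel (f x).
Proof. by apply: val_inj; rewrite val_cmap !val_cel linearZ. Qed.

Lemma cor_ses X Y Z (i : {linear X -> Y}) (q : {linear Y -> Z}) :
  sesm i q -> sesm (cmap i) (cmap q).
Proof.
move=> [ii sq ex]; split=> [|z|y].
- apply: injP => x /(congr1 val); rewrite val_cmap cval0 => /(inj0 ii) x0.
  by apply: val_inj; rewrite x0.
- by have [y yE] := sq (val z); exists (cel y); rewrite cmap_cel yE cel_val.
split=> [/(congr1 val)|[x <-]].
  rewrite val_cmap cval0 => /ex[x xE]; exists (cel x).
  by rewrite cmap_cel xE cel_val.
by apply: val_inj; rewrite !val_cmap cval0; apply/ex; exists (val x).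
Qed.

Lemma cor_retract X Y : retract X Y -> retract (cor X) (cor Y).
Proof.
move=> [s [r rs]]; exists (cmap s), (cmap r) => x.
by apply: val_inj; rewrite !val_cmap rs.
Qed.
Lemma cor_iso X Y : mod_iso X Y -> mod_iso (cor X) (cor Y).
Proof.
move=> /isoE[f [g [fg gf]]]; apply: (@can_iso _ _ _ (cmap f) (cmap g)) => x;
by apply: val_inj; rewrite !val_cmap ?fg ?gf.
Qed.
Lemma cor_zero Z : zero_mod Z -> zero_mod (cor Z).
Proof. by move=> zZ x; apply: val_inj; rewrite (zZ (val x)). Qed.
Lemma cor_prod X Y : mod_iso (cor (X * Y)%type) (cor X * cor Y)%type.
Proof.
have [h hE] := inl_ex X Y; have [h' h'E] := inr_ex X Y.
have S := cor_ses (ses_prod hE).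
apply: iso_trans (prod_isoC _ _); apply: (ses_split (s := cmap h') S) => y.
by apply: val_inj; rewrite !val_cmap h'E.
Qed.
Lemma cor_dsum k (A : 'I_k -> lmodType L) : mod_iso (cor (dsum A)) (dsum (fun i => cor (A i))).
Proof.
elim: k A => [|k IH] A.
  by apply: zero_iso; [apply: cor_zero; apply: dsum0_zero|apply: dsum0_zero].
apply: iso_trans (cor_iso (dsum_recl A)) _; apply: iso_trans (cor_prod _ _) _.
by apply: iso_trans (prod_iso (iso_refl _) (IH _)) _; apply/iso_sym/dsum_recl.
Qed.

Section FreeCover.
Let Pe : lmodType L := sub_mod (lideal_gen e).
Let u : cor Pe := cel (pe e 1).

Lemma val_cgen : val u = pe e 1.
Proof. by rewrite val_cel pe_idem. Qed.

(** e (L e) is the corner ring itself, free of rank one on the element [e]. *)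
Lemma ccoord_ex : exists c : {linear cor Pe -> B^o}, (forall y, y = (c y : B) *: u) /\ c u = 1.
Proof.
pose c (y : cor Pe) : B^o := ceb (val (val y)).
have cL : linear c.
  move=> b y z; apply: val_inj; rewrite /c val_ceb.
  have -> : val (val (b *: y + z)) = val b * val (val y) + val (val z) by [].
  have -> : val (b *: (ceb (val (val y)) : B^o) + (ceb (val (val z)) : B^o)) =
    val b * (e * val (val y) * e) + e * val (val z) * e by [].
  by rewrite mulrDr mulrDl !mulrA cornerl cornerr.
exists (mkL cL); split=> [y|]; apply: val_inj; last first.
  by rewrite val_ceb val_cgen val_pe mul1r he he.
have -> : val ((mkL cL y : B) *: u) = (e * val (val y) * e) *: val u by [].
rewrite val_cgen -!scalerA pe_idem // -[val (val y) *: _]peE pe_val //.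
by rewrite cval_e.
Qed.
Definition ccoord : {linear cor Pe -> B^o} := sval (cid ccoord_ex).
Lemma ccoordE y : y = (ccoord y : B) *: u.
Proof. by rewrite {1}/ccoord; case: cid => c []. Qed.
Lemma ccoord_gen : ccoord u = 1.
Proof. by rewrite /ccoord; case: cid => c []. Qed.

Variable k : nat.
Let F : lmodType L := dsum (fun _ : 'I_k => Pe).
Let w (i : 'I_k) : cor F := cmap (din i) u.
Let c (i : 'I_k) : {linear cor F -> B^o} := ccoord \o cmap (dpr i).

Lemma ccoordsE (y : cor F) : y = \sum_i (c i y : B) *: w i.
Proof.
transitivity (\sum_i cmap (din i) (cmap (dpr i) y)).
  apply: val_inj; rewrite (big_morph val (@cvalD _) (@cval0 _)) [LHS]dsumE.
  by apply: eq_bigr => i _; rewrite !val_cmap.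
by apply: eq_bigr => i _; rewrite /w -linearZ /c /= -ccoordE.
Qed.
Lemma ccoords_gen i j : c i (w j) = (i == j)%:R.
Proof.
rewrite /c /w /=; have [->|ij] := eqVneq i j.
  by rewrite -[RHS]ccoord_gen; congr (ccoord _); apply: val_inj; rewrite !val_cmap dinK.
have -> : cmap (dpr i) (cmap (din j) u) = 0.
  by apply: val_inj; rewrite !val_cmap din0.
exact: linear0.
Qed.

Lemma corF_proj : projective_mod (cor F).
Proof.
have [s sE] := dtup_ex c.
have cw i : exists h : {linear B^o -> cor F}, forall b : B, h b = b *: w i by apply: cyc_ex.
pose h i := sval (cid (cw i)); have hE i (b : B) : h i b = b *: w i by rewrite /h; case: cid.
have [r [rE _]] := dcotup_ex h.
apply: proj_retract (@proj_free B k); exists s, r => y; rewrite rE [RHS]ccoordsE.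
by apply: eq_bigr => i _; rewrite hE sE.
Qed.

Lemma corF_map (N : lmodType B) (x : 'I_k -> N) :
  exists q : {linear cor F -> N}, forall y, q y = \sum_i (c i y : B) *: x i.
Proof.
have cw i : exists h : {linear B^o -> N}, forall b : B, h b = b *: x i by apply: cyc_ex.
pose h i := sval (cid (cw i)); have hE i (b : B) : h i b = b *: x i by rewrite /h; case: cid.
have [s sE] := dtup_ex c; have [r [rE _]] := dcotup_ex h.
exists (r \o s) => y; rewrite /= rE; apply: eq_bigr => i _; rewrite hE sE //.
Qed.

(** Maps L e -> N are the elements of e N, so any choice of values on the basis of e F comes from a
    map on F. *)
Lemma corF_lift N (x : 'I_k -> cor N) :
  exists h : {linear F -> N}, forall y, cmap h y = \sum_i (c i y : B) *: x i.
Proof.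
have ex i : exists h : {linear Pe -> N}, forall a : L, h (pe e a) = a *: val (x i).
  by apply: lideal_univ; apply: cval_e.
pose h i := sval (cid (ex i)).
have hE i (a : L) : h i (pe e a) = a *: val (x i) by rewrite /h; case: cid.
have [t [_ tE]] := dcotup_ex h; exists t => y.
rewrite {1}[y]ccoordsE linear_sum; apply: eq_bigr => i _; rewrite linearZ /=; congr (_ *: _).
by apply: val_inj; rewrite !val_cmap tE val_cgen hE scale1r.
Qed.

(** F is generated over L by the basis [w] of e F. *)
Lemma corF_faithful N (f g : {linear F -> N}) : (forall y, cmap f y = cmap g y) -> f =1 g.
Proof.
move=> fg y; rewrite [y]dsumE !linear_sum; apply: eq_bigr => i _.
have [a <-] := pe_surj e (dpr i y); rewrite peE !linearZ /=; congr (_ *: _).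
by have := congr1 val (fg (w i)); rewrite !val_cmap val_cgen.
Qed.
End FreeCover.
End CornerFunctor.

Lemma DeltaP (L : pzRingType) (e : L) (M : lmodType L) (x : M) :
  x \in Delta e M <-> forall a : L, (e * a) *: x = 0.
Proof. by split=> [/asboolP|h]; last exact/asboolP. Qed.

(** * Finite generation and projective dimension across the corner *)

Section CornerPfin.
Variables (L : pzRingType) (e : L) (he : idem e).
Local Notation B := (corner he).
Local Notation cor M := (corner_mod M he).
Implicit Types M N X Y Z T F : lmodType L.
Hypothesis nL : noeth L.
Let Pe : lmodType L := sub_mod (lideal_gen e).
Let Fe k : lmodType L := dsum (fun _ : 'I_k => Pe).

Lemma Fe_fg k : fin_gen (Fe k).
Proof. by apply: fg_dsum => _; apply: lideal_fg. Qed.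
Lemma Fe_proj k : projective_mod (Fe k).
Proof. by apply: proj_dsum => _; apply: lideal_proj. Qed.

(** The predicate is the largest submodule of [M] whose image under [e] lies in [P]; it carries
    submodules of e M back to [M]. *)
Lemma sclosed_cor M (P : cor M -> Prop) : sclosed P ->
  sclosed (fun z : M => forall b : L, P (cel he (b *: z))).
Proof.
move=> cP; split=> [b|a x y Px Py b]; first by rewrite scaler0 cel0; case: cP.
by rewrite scalerDr celD scalerA; apply: sclosedD.
Qed.

(** The submodule [N] generated by e M is finitely generated, and finitely many elements of e M
    suffice for it. Multiplication by [e] shows that they generate e M over the corner ring. *)
Lemma cor_fg M : fin_gen M -> fin_gen (cor M).
Proof.
move=> fM; pose N (y : M) := forall Q : M -> Prop, sclosed Q -> (forall x : cor M, Q (val x)) -> Q y.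
have cN : sclosed N.
  split=> [Q [] //|a x y Nx Ny Q cQ H].
  by have [_ QD] := cQ; apply: QD; [apply: Nx|apply: Ny].
have [K [i [ii iN]]] := sub_ex cN; have /fgP[s sP] := nL ii fM.
pose fs (y : M) := exists t : seq (cor M), forall Q : M -> Prop, sclosed Q ->
  (forall x, x \in t -> Q (val x)) -> Q y.
have cfs : sclosed fs.
  split=> [|a x y [t tP] [t' t'P]]; first by exists [::] => Q [].
  exists (t ++ t') => Q cQ H; have [_ QD] := cQ; apply: QD.
    by apply: tP => // z zt; apply: H; rewrite mem_cat zt.
  by apply: t'P => // z zt; apply: H; rewrite mem_cat zt orbT.
have Nfs y : N y -> fs y.
  move=> Ny; apply: (Ny _ cfs) => x; exists [:: x] => Q cQ H.
  by apply: H; rewrite mem_head.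
have [t tP] : exists t : seq (cor M), forall Q : M -> Prop, sclosed Q ->
    (forall x, x \in t -> Q (val x)) -> forall k, k \in s -> Q (i k).
  elim: (s) => [|k s' [t tP]]; first by exists [::].
  have [t' t'P] : fs (i k) by apply: Nfs; apply/iN; exists k.
  exists (t' ++ t) => Q cQ H l; rewrite inE => /predU1P[->|ls].
    by apply: t'P => // z zt; apply: H; rewrite mem_cat zt.
  by apply: tP => // z zt; apply: H; rewrite mem_cat zt orbT.
apply/fgP; exists t => P cP Pt y.
have cQ := sclosed_cor cP.
have Qi k : (fun z : M => forall b : L, P (cel he (b *: z))) (i k).
  apply: (sP _ (sclosed_preim i cQ)) => l ls; apply: (tP _ cQ _ l ls) => x xt b.
  by rewrite celZ; apply: sclosedZ => //; apply: Pt.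
have /iN[k kE] : N (val y) by move=> Q _; apply.
by have := Qi k 1; rewrite kE scale1r cel_val.
Qed.

Lemma cor_cover M : fin_gen (cor M) ->
  exists k (h : {linear Fe k -> M}), surj (cmap he h).
Proof.
move=> [s sP]; have [h hE] := corF_lift (fun i : 'I_(size s) => s`_i).
exists (size s), h => y; have [b ->] := sP y.
exists (\sum_(i < size s) (b i : B) *: (cmap he (din i) (cel he (pe e 1)) : cor (Fe (size s)))).
rewrite linear_sum; apply: eq_bigr => i _; rewrite linearZ hE; congr (_ *: _).
rewrite (bigD1 i) //= big1 => [|j ji].
  have /= -> := ccoords_gen he i i; rewrite eqxx scale1r addr0 //.
by have /= -> := ccoords_gen he j i; rewrite (negPf ji) scale0r.
Qed.

Hypothesis torsion_pdf : forall X, fin_gen X -> torsion e X -> pdf X.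

(** The hypotheses on [h] make its kernel and cokernel torsion, hence of finite projective
    dimension. *)
Lemma pdf_transfer X M (h : {linear X -> M}) : fin_gen X -> fin_gen M ->
  (forall x, h x = 0 -> e *: x = 0) -> surj (cmap he h) -> pdf X -> pdf M.
Proof.
move=> fX fM hk hs pX; have [I [u [v [su vi vu]]]] := im_fact h.
have [K [k Sk]] := ses_of_surj su; have [Q [q Sq]] := ses_of_inj vi.
have [ki _ ek] := Sk; have [_ sq eq_] := Sq.
have pK : pdf K.
  apply: torsion_pdf; first exact: nL ki fX.
  move=> x; apply: (inj0 ki); rewrite linearZ; apply: hk.
  by rewrite -vu (ses0 x Sk) linear0.
apply: (pdf_ext Sq); first exact: pdf_quot Sk pK pX.
apply: torsion_pdf; first exact: fg_surj sq fM.
move=> y; have [m <-] := sq y; rewrite -linearZ; apply/eq_.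
have [x xE] := hs (cel he m); exists (u (val x)).
by rewrite vu -val_cmap xE val_cel.
Qed.

Lemma cor_ker X M (h : {linear X -> M}) (K : lmodType L) (k : {linear K -> X}) :
  injective k -> (forall x, h x = 0 <-> exists z, k z = x) -> surj (cmap he h) ->
  sesm (cmap he k) (cmap he h).
Proof.
move=> ki kh hs; split=> // [|y].
  by apply: injP => x /(congr1 val); rewrite val_cmap => /(inj0 ki) x0; apply: val_inj; rewrite x0.
split=> [/(congr1 val)|[x <-]].
  by rewrite val_cmap => /kh[x xE]; exists (cel he x); rewrite cmap_cel xE cel_val.
by apply: val_inj; rewrite !val_cmap; apply/kh; exists (val x).
Qed.

(** For a cover [h] of e M by e F, the kernel [K] of [h] has e K as a syzygy of e M. By induction
    [K], and thus the image of [h], has finite projective dimension, and [pdf_transfer] passes from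
    the image to [M]. *)
Lemma cor_pdf n M : fin_gen M -> pd n (cor M) -> pdf M.
Proof.
elim: n M => [|n IH] M fM pM; have [k [h hs]] := cor_cover (cor_fg fM); last first.
  have [K [i [ii iP]]] := sub_ex (sclosed_ker h).
  have S := cor_ker ii iP hs; have fK := nL ii (@Fe_fg k).
  have pK := IH K fK (pd_syz pM (@corF_proj _ _ he k) S).
  have [I [u [v [su vi vu]]]] := im_fact h.
  have Su : sesm i u.
    split=> // x; rewrite -iP -vu; split=> [->|/(inj0 vi)//]; exact: linear0.
  have pI := pdf_quot Su pK (pdf_proj (@Fe_proj k)).
  apply: (@pdf_transfer I M v) => //.
  - exact: fg_surj su (@Fe_fg k).
  - by move=> x /(inj0 vi)->; rewrite scaler0.
  - move=> y; have [x <-] := hs y; exists (cel he (u (val x))).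
    by rewrite cmap_cel vu -val_cmap cel_val.
(* The splitting of e F -> e M is induced by an endomorphism of F. *)
have [s sK] := proj_split pM hs.
have [p pE] := corF_lift (fun i : 'I_k => s (cmap he h (cmap he (din i) (cel he (pe e 1))))).
have pS y : cmap he p y = s (cmap he h y).
  rewrite pE {2}[y](ccoordsE y) !linear_sum /=; apply: eq_bigr => i _.
  by rewrite !linearZ.
have pp : p \o p =1 p.
  apply: (@corF_faithful _ _ he k _ (p \o p) p) => y; apply: val_inj.
  by rewrite val_cmap /= -!val_cmap !pS sK.
have hp : h \o p =1 h.
  apply: (@corF_faithful _ _ he k _ (h \o p) h) => y; apply: val_inj.
  by rewrite val_cmap /= -!val_cmap !pS sK.
have [I [u [v [su vi vu]]]] := im_fact p.
have uv x : u (v x) = x.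
  by have [y <-] := su x; apply: vi; rewrite vu vu; apply: pp.
have rI : retract I (Fe k) by exists v, u.
apply: (@pdf_transfer I M (h \o v)) => //.
- exact: fg_retract rI (@Fe_fg k).
- move=> x hx; apply: vi; rewrite linear0 linearZ.
  have -> : v x = p (v x) by rewrite -vu uv.
  rewrite -linearZ -val_cel -val_cmap pS.
  have -> : cmap he h (cel he (v x)) = 0 by rewrite cmap_cel -/((h \o v) x) hx cel0.
  by rewrite linear0.
- move=> y; have [x <-] := hs y; exists (cel he (u (val x))).
  by rewrite cmap_cel /= vu -[RHS]cel_val val_cmap; congr cel; apply: hp.
exact/pdf_proj/(proj_retract rI)/Fe_proj.
Qed.

(* Every finitely generated module N over the corner ring is e X for the
   torsion-free quotient X of a free cover F by the largest submodule whose image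
   in N vanishes. *)
Lemma corner_lift (N : lmodType B) : fin_gen N ->
  exists k (X K : lmodType L) (i : {linear K -> Fe k}) (p : {linear Fe k -> X}),
    [/\ sesm i p, torsion_free e X & mod_iso (cor X) N].
Proof.
move=> [s sP]; have [q qE] := @corF_map _ _ he (size s) N (fun i => s`_i).
have sq : surj q.
  move=> y; have [b ->] := sP y.
  exists (\sum_(i < size s) (b i : B) *: (cmap he (din i) (cel he (pe e 1)) : cor (Fe (size s)))).
  rewrite linear_sum; apply: eq_bigr => i _; rewrite linearZ qE; congr (_ *: _).
  rewrite (bigD1 i) //= big1 => [|j ji].
    have /= -> := ccoords_gen he i i; rewrite eqxx scale1r addr0 //.
  by have /= -> := ccoords_gen he j i; rewrite (negPf ji) scale0r.
have [X [p [sp pP]]] := quo_ex (sclosed_cor (sclosed_ker q)).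
have [K [i S]] := ses_of_surj sp.
exists (size s), X, K, i, p; split=> //.
  move=> x /DeltaP ex; have [y yE] := sp x.
  rewrite -yE; apply/pP => b; rewrite -cel_e scalerA.
  have : p ((e * b) *: y) = 0 by rewrite linearZ yE; apply: ex.
  by move=> /pP/(_ 1); rewrite scale1r.
have scp : surj (cmap he p).
  by move=> x; have [y yE] := sp (val x); exists (cel he y); rewrite cmap_cel yE cel_val.
apply: (@surj_kernel_iso _ _ _ _ _ (cmap he p) q idfun scp sq) => [y|y]; first by exists y.
split=> [/(congr1 val)|/= qy].
  by rewrite val_cmap => /pP/(_ 1); rewrite scale1r cel_val.
by apply: val_inj; rewrite val_cmap; apply/pP => b; rewrite celZ linearZ /= qy scaler0.
Qed.

(** Write the ambient module as e X. A submodule of it is e Y for the largest [Y] in [X] with e Y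
    inside it, and [Y] is finitely generated over L. *)
Lemma corner_noeth : noeth B.
Proof.
move=> M N i ii fM; have [k [X [K [j [p [S tX iso]]]]]] := corner_lift fM.
have fX : fin_gen X by have [_ sp _] := S; apply: fg_surj sp (@Fe_fg k).
have [f [g [fg gf]]] := isoE iso.
have cQ := sclosed_cor (sclosed_im (g \o i)).
have [Y [v [vi vP]]] := sub_ex cQ; have fY := nL vi fX.
have [y|h hP] := @lin_lift _ _ _ _ (g \o i) (cmap he v) (inj_comp (can_inj gf) ii).
  have /(_ 1)[z zE] : forall b, exists z, (g \o i) z = cel he (b *: v (val y)) by apply/vP; exists (val y).
  by exists z; rewrite [LHS]zE scale1r -val_cmap cel_val.
apply: (@fg_surj _ _ _ h) (cor_fg fY) => z.
have [w wE] : exists w, v w = val (g (i z)).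
  by apply/vP => b; exists (ceb he b *: z); rewrite linearZ celZ.
exists (cel he w); apply: ii; apply: (can_inj gf); rewrite [LHS]hP.
by rewrite cmap_cel wE cel_val.
Qed.
End CornerPfin.

(** * Torsion-free modules and the corner ring *)

Section GiraudExt.
Variables (L : pzRingType) (e : L) (he : idem e).
Local Notation B := (corner he).
Local Notation cor M := (corner_mod M he).
Implicit Types M N X Y Z T F : lmodType L.

Lemma sclosed_Delta M : sclosed (fun x : M => forall a : L, (e * a) *: x = 0).
Proof.
split=> [a|a x y Dx Dy b]; first exact: scaler0.
by rewrite scalerDr scalerA -mulrA Dx Dy addr0.
Qed.

Lemma torsion_freeP T : torsion_free e T <->
  forall x : T, (forall a : L, (e * a) *: x = 0) -> x = 0.
Proof. by split=> tf x => [h|/DeltaP]; [apply/tf/DeltaP|apply: tf]. Qed.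

Lemma torsion_surj X Y (q : {linear X -> Y}) : surj q -> torsion e X -> torsion e Y.
Proof. by move=> sq tX y; have [x <-] := sq y; rewrite -linearZ tX linear0. Qed.
Lemma torsion_inj X Y (i : {linear X -> Y}) : injective i -> torsion e Y -> torsion e X.
Proof. by move=> ii tY x; apply: (inj0 ii); rewrite linearZ; apply: tY. Qed.
Lemma torsion_free_inj X Y (i : {linear X -> Y}) :
  injective i -> torsion_free e Y -> torsion_free e X.
Proof.
move=> ii /torsion_freeP tY; apply/torsion_freeP => x h; apply: (inj0 ii).
by apply: tY => a; rewrite -linearZ h linear0.
Qed.

(* Complements of F in f.g. pieces of an extension consist of torsion elements,
   so they glue to a global complement. *)
Lemma ext1_torsion F : torsion_free e F ->
  (forall X, fin_gen X -> torsion e X -> ext1 X F) ->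
  forall X, torsion e X -> ext1 X F.
Proof.
move=> /torsion_freeP tF E X tX; apply: split_ext1 => Z i q S; have [ii sq ex] := S.
(* The retraction sends [z] to the [f] for which [z - i f] is annihilated by e L: local splittings
   give existence, torsion-freeness gives uniqueness. *)
have [z|f h|a x y x' y' h1 h2 b|r rP] :=
  @rel_linear _ Z F (fun z f => forall a : L, (e * a) *: (z - i f) = 0).
- have [c cE] := cyc_ex (q z); have [C [u [v [su vi vu]]]] := im_fact c.
  have tC := torsion_inj vi tX.
  have [W [a [b [j [S' fq bj ex' ji]]]]] := pull_ses v S.
  have [r rK] := ext1_split (E _ (fg_surj su (@fg_reg L)) tC) S'.
  have [|w [aw bw]] := ex' (u 1) z; first by rewrite vu cE scale1r.
  exists (r w) => t; rewrite -bj -bw -linearB -linearZ /=.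
  suff -> : (e * t) *: (w - j (r w)) = 0 by rewrite linear0.
  have [_ _ eS] := S'.
  have /eS[f fE] : a ((e * t) *: (w - j (r w))) = 0.
    by rewrite linearZ /= -scalerA; apply: tC.
  have : r (j f) = 0 by rewrite fE linearZ /= linearB /= rK subrr scaler0.
  by rewrite rK -fE => ->; rewrite linear0.
- apply: tF => a; apply: (inj0 ii); rewrite linearZ; have := h a.
  by rewrite sub0r scalerN => /eqP; rewrite oppr_eq0 => /eqP.
- have -> : a *: x + y - i (a *: x' + y') = a *: (x - i x') + (y - i y').
    by rewrite linearP scalerBr opprD addrACA.
  by rewrite scalerDr h2 addr0 scalerA -mulrA h1.
exists r => f; apply/esym/rP => a; by rewrite subrr scaler0.
Qed.

Section Lift.
Variable T : lmodType L.
Hypothesis T_free : torsion_free e T.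

(** The values of [s - t] are annihilated by e L, so they vanish in the torsion-free [T]. *)
Lemma cor_faithful X (s t : {linear X -> T}) :
  (forall y : cor X, s (val y) = t (val y)) -> s =1 t.
Proof.
move=> st x; apply/eqP; rewrite -subr_eq0; apply/eqP; move/torsion_freeP: T_free; apply=> a.
have E (u : {linear X -> T}) : (e * a) *: u x = u (val (cel he (a *: x))).
  by rewrite val_cel !linearZ /= scalerA.
by rewrite scalerBr !E st subrr.
Qed.

Hypothesis T_ext : forall X, torsion e X -> ext1 X T.

(* A map g : e X -> e T extends to L (e X) since T is torsion-free, and further
   to X because X / L (e X) is torsion. *)
Lemma cor_full X (g : {linear cor X -> cor T}) :
  exists t : {linear X -> T}, forall y, t (val y) = val (g y).
Proof.
(* [w] is a possible value at [x]: e L acts on it as [g] prescribes on e L x. Torsion-freeness makes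
   it unique. *)
pose P (x : X) (w : T) := forall b : L, val (g (cel he (b *: x))) = e *: (b *: w).
have P0 w : P 0 w -> w = 0.
  move=> h; move/torsion_freeP: T_free; apply=> a.
  by rewrite -scalerA -h scaler0 cel0 linear0.
have PD a x y x' y' : P x x' -> P y y' -> P (a *: x + y) (a *: x' + y').
  move=> h h' b; rewrite scalerDr celD linearD cvalD scalerA h h'.
  by rewrite [in RHS]scalerDr !scalerA scalerDr !scalerA.
have Pe (y : cor X) : P (val y) (val (g y)).
  by move=> b; rewrite celZ linearZ cvalZ val_ceb cval_eb.
have cD : sclosed (fun x => exists w, P x w).
  split=> [|a x y [w Pw] [w' Pw']]; last by exists (a *: w + w'); apply: PD.
  by exists 0 => b; rewrite !scaler0 cel0 linear0.
have [K [i [ii iP]]] := sub_ex cD.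
have [k|w|a x y x' y'|h hP] := @rel_linear _ K T (fun k w => P (i k) w).
- by apply/iP; exists k.
- by rewrite linear0; apply: P0.
- by rewrite linearP; apply: PD.
have [Q [q S]] := ses_of_inj ii; have [_ sq ex] := S.
have tQ : torsion e Q.
  move=> y; have [x <-] := sq y; rewrite -linearZ; apply/ex/iP.
  by rewrite -val_cel; exists (val (g (cel he x))); apply: Pe.
have [t tP] := T_ext tQ S h; exists t => y.
have /iP[k kE] : exists w, P (val y) w by exists (val (g y)); apply: Pe.
by rewrite -kE tP; apply/esym/hP; rewrite kE; apply: Pe.
Qed.
End Lift.
End GiraudExt.

Section CornerExt.
Variables (L : pzRingType) (e : L) (he : idem e).
Local Notation B := (corner he).
Local Notation cor M := (corner_mod M he).
Implicit Types M N X Y Z T F : lmodType L.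
Hypothesis nL : noeth L.
Hypothesis torsion_pdf : forall X, fin_gen X -> torsion e X -> pdf X.
Variable c : nat.
Hypothesis pd_comp : pd c (cor (sub_mod (lideal_gen (1 - e)))).

(** L is the sum of L e, whose corner is free, and L (1 - e), whose corner has projective dimension
    at most [c]. *)
Lemma pd_cor_reg : pd c (cor L^o).
Proof.
have S : sesm (val : {linear sub_mod (lideal_gen e) -> L^o}) (pe (1 - e)).
  split=> [|y|y]; [exact: sub_mod_inj|exact: pe_surj|].
  rewrite -sub_mod_im lideal_genP pe0 mulrBr mulr1.
  split=> [/eqP|[a ->]]; last by rewrite -mulrA he subrr.
  by rewrite subr_eq0 => /eqP yE; exists y.
apply: pd_ext (cor_ses he S) _ pd_comp; apply: (@pd_le _ 0%N) => //.
apply: proj_retract (@corF_proj _ _ he 1); apply: cor_retract.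
exact: (@dsum_retract _ _ (fun _ : 'I_1 => sub_mod (lideal_gen e)) ord0).
Qed.

Lemma pd_cor_proj P : fin_gen P -> projective_mod P -> pd c (cor P).
Proof.
move=> fP pP; have [k r] := proj_fg_retract pP fP.
apply: pd_retract (cor_retract he r) _.
apply: (@dsum_ind _ (fun M => pd c (cor M))) => [Z zZ|X Y pX pY|X Y iso|_].
- by apply: (@pd_le _ 0%N) => //; apply: proj_zero; apply: cor_zero.
- have [h hE] := inl_ex X Y; exact: pd_ext (cor_ses he (ses_prod hE)) pX pY.
- exact: pd_iso (cor_iso he iso).
exact: pd_cor_reg.
Qed.

Lemma pd_cor n M : fin_gen M -> pd n M -> pd (n + c) (cor M).
Proof.
elim: n M => [|n IH] M fM pM; first exact: pd_cor_proj.
have [K [F [i [q [S pF fF pK]]]]] := fg_syz fM pM.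
have fK : fin_gen K by have [ii _ _] := S; apply: nL ii fF.
apply: pd_quot (cor_ses he S) (IH K fK pK) _; apply: (@pd_le _ c); first by rewrite leqW ?leq_addl.
exact: pd_cor_proj.
Qed.

Lemma cor_pfin M : pfin M -> pfin (cor M).
Proof. by move=> [fM [n pM]]; split; [exact: cor_fg|exists (n + c)%N; apply: pd_cor]. Qed.

Lemma cor_pfin_lift (N : lmodType B) : pfin N -> 
  exists k (X K : lmodType L) (i : {linear K -> dsum (fun _ : 'I_k => sub_mod (lideal_gen e))})
    (p : {linear dsum (fun _ : 'I_k => sub_mod (lideal_gen e)) -> X}),
    [/\ sesm i p, torsion_free e X, mod_iso (cor X) N & pfin X].
Proof.
move=> [fN [n pN]]; have [k [X [K [i [p [S tX iso]]]]]] := corner_lift fN.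
exists k, X, K, i, p; split=> //.
have fX : fin_gen X by have [_ sp _] := S; apply: fg_surj sp (@Fe_fg L e k).
split=> //; apply: (cor_pdf (n := n) nL torsion_pdf fX).
exact: pd_iso (iso_sym iso) pN.
Qed.

Lemma cor_pd_bound d : (forall X, pfin X -> pd d X) ->
  forall N : lmodType B, pfin N -> pd (d + c) N.
Proof.
move=> bd N /cor_pfin_lift[k [X [K [i [p [S _ iso pX]]]]]].
by apply: pd_iso iso _; apply: pd_cor; [case: pX|apply: bd].
Qed.

(** [N] is e X, presented by the projective e F with kernel e K. A map e K -> e T lifts to K -> T,
    extends to F because Ext^1(X, T) = 0, and is cut down to e F. *)
Lemma cor_ext1 T : torsion_free e T -> (forall X, torsion e X -> ext1 X T) ->
  (forall X, pfin X -> ext1 X T) -> forall N : lmodType B, pfin N -> ext1 N (cor T).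
Proof.
move=> tT ET EP N /cor_pfin_lift[k [X [K [i [p [S _ iso pX]]]]]].
apply: ext1_retractX (iso_retract (iso_sym iso)) _.
apply: ext1_pres (@corF_proj _ _ he k) (cor_ses he S) _ => f.
have [t tE] := cor_full tT ET f; have [g gP] := EP _ pX _ _ _ _ S t.
exists (cmap he g) => y; apply: val_inj.
by rewrite !val_cmap gP tE.
Qed.
End CornerExt.

(** * Basic modules and minimal approximations *)

Section AddClass.
Variable R : pzRingType.
Implicit Types M N S U W X Y Z : lmodType R.

Lemma dsum_const_cat M a b :
  mod_iso (dsum (fun _ : 'I_a => M) * dsum (fun _ : 'I_b => M))%type
    (dsum (fun _ : 'I_(a + b) => M)).
Proof.
elim: a => [|a IH].
  by apply: iso_trans (prod_isoC _ _) _; apply: prod_iso0; apply: dsum0_zero.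
apply: iso_trans (prod_iso (dsum_recl _) (iso_refl _)) _.
apply: iso_trans (iso_sym (prod_isoA _ _ _)) _.
apply: iso_trans (prod_iso (iso_refl _) IH) _.
exact: iso_sym (@dsum_recl R (a + b) (fun=> M)).
Qed.

Lemma add_retract M X Y : retract X Y -> add_class M Y -> add_class M X.
Proof. by move=> r /add_classP[k r']; apply/add_classP; exists k; apply: retract_trans r r'. Qed.
Lemma add_iso M X Y : mod_iso X Y -> add_class M X -> add_class M Y.
Proof. by move=> /iso_sym/iso_retract; apply: add_retract. Qed.
Lemma add_zero M Z : zero_mod Z -> add_class M Z.
Proof.
move=> zZ; apply/add_classP; exists 0%N; exists \0, \0 => x /=.
by rewrite (zZ x).
Qed.
Lemma add_prod M X Y : add_class M X -> add_class M Y -> add_class M (X * Y)%type.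
Proof.
move=> /add_classP[a ra] /add_classP[b rb]; apply/add_classP; exists (a + b)%N.
exact: retract_trans (prod_retract ra rb) (iso_retract (dsum_const_cat M a b)).
Qed.
Lemma add_self M X : retract X M -> add_class M X.
Proof.
move=> r; apply/add_classP; exists 1%N; apply: retract_trans r _.
exact: (@dsum_retract R _ (fun _ : 'I_1 => M) ord0).
Qed.
Lemma add_dsum M k (A : 'I_k -> lmodType R) : (forall i, add_class M (A i)) -> add_class M (dsum A).
Proof. by apply: dsum_ind; [exact: add_zero|exact: add_prod|exact: add_iso]. Qed.
Lemma add_trans M N X : add_class M X -> add_class N M -> add_class N X.
Proof. by move=> /add_classP[k r] h; apply: add_retract r _; apply: add_dsum. Qed.
Lemma add_indec M X : fl X -> indecomposable X -> add_class M X -> retract X M.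
Proof. by move=> fX iX /add_classP[k /(krs_prime fX iX)[]]. Qed.

(** Begin with the zero map and add one component for a simple submodule of the kernel; each
    component strictly shortens the kernel. *)
Lemma cogen_embed U W : fl U ->
  (forall S (s : {linear S -> U}), injective s -> simple_mod S ->
     exists (g : {linear U -> W}) x, g (s x) <> 0) ->
  exists k (h : {linear U -> dsum (fun _ : 'I_k => W)}), injective h.
Proof.
move=> [n0 fU] H.
suff G n (K : lmodType R) (i : {linear K -> U}) (V : lmodType R) (h : {linear U -> V}) : injective i ->
    (forall x, h x = 0 <-> exists z, i z = x) -> flen n K -> add_class W V ->
    exists k (h : {linear U -> dsum (fun _ : 'I_k => W)}), injective h.
  have [Z zZ] := zero_mod_ex R.
  apply: (G n0 U idfun Z \0) => // [x|]; last exact: add_zero.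
  by split=> // _; exists x.
elim: n K i V h => [|n IH] K i V h ii hP fK aV.
  have /add_classP[k [s [r rs]]] := aV; exists k, (s \o h).
  apply: inj_comp (can_inj rs) _; apply: injP => x /hP[z <-].
  by rewrite (fK z) linear0.
have [zK|nK] := pselect (zero_mod K).
  by apply: (IH K i V h) => //; apply: flen_le (leq0n n) _.
have [|S [s [si sS]]] := simple_sub _ nK; first by exists n.+1.
have [g [x gx]] := H S (i \o s) (inj_comp ii si) sS.
have [h' h'E] := pair_ex h g.
have [K' [i' [i'i i'P]]] := sub_ex (sclosed_ker h').
have [z|j jP] := @lin_lift _ _ _ _ i i' ii.
  apply/hP; have : h' (i' z) = 0 by apply/i'P; exists z.
  by rewrite h'E => -[].
apply: (IH K' i' (V * W)%type h') => //.
  apply: (flen_proper (i := j) _ _ fK).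
    by apply: injP => z jz; apply: (inj0 i'i); rewrite -jP jz linear0.
  move=> sj; have [z zE] := sj (s x); apply: gx; rewrite /= -zE jP.
  have : h' (i' z) = 0 by apply/i'P; exists z.
  by rewrite h'E => -[].
by apply: add_prod => //; apply: add_self; apply: retract_refl.
Qed.

(** Split off all [X i] and [S j]. An indecomposable summand of the remainder [W] would be
    isomorphic to one of them and occur twice in [T]. *)
Lemma basic_decomposition T k l (X : 'I_k -> lmodType R) (S : 'I_l -> lmodType R) :
  fl T -> basic_mod T ->
  (forall i, indecomposable (X i) /\ retract (X i) T) ->
  (forall i, indecomposable (S i) /\ retract (S i) T) ->
  (forall i j, mod_iso (X i) (X j) -> i = j) -> (forall i j, mod_iso (S i) (S j) -> i = j) ->
  (forall i j, ~ mod_iso (X i) (S j)) ->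
  (forall Y, indecomposable Y -> retract Y T ->
     (exists i, mod_iso Y (X i)) \/ exists i, mod_iso Y (S i)) ->
  mod_iso T (dsum X * dsum S)%type.
Proof.
move=> fT bT iX iS dX dS XS all.
have fr Y : retract Y T -> fl Y by move=> r; apply: fl_retract r fT.
have fX i : fl (X i) by apply: fr; case: (iX i).
have fS i : fl (S i) by apply: fr; case: (iS i).
have /retractP[M isoM] : retract (dsum X) T.
  apply: distinct_retract => // i; last by case: (iX i).
  by split=> //; case: (iX i).
have SM i : retract (S i) M.
  have [iSi rS] := iS i.
  have [r|//] := krs_prime2 (fS i) iSi (retract_trans rS (iso_retract isoM)).
  have [j rj] := krs_prime (fS i) iSi r; case: (XS j i); apply: iso_sym.
  by apply: retract_indec rj; [case: iSi|case: (iX j)].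
have /retractP[W isoW] : retract (dsum S) M.
  by apply: distinct_retract => // i; split=> //; case: (iS i).
have isoT : mod_iso T ((dsum X * dsum S) * W)%type.
  apply: iso_trans isoM _; apply: iso_trans (prod_iso (iso_refl _) isoW) _.
  exact: prod_isoA.
have [zW|nW] := pselect (zero_mod W); first exact: iso_trans isoT (prod_iso0 _ zW).
have fW : fl W by apply: fr; apply: retract_trans (retract_snd _ W) (iso_retract (iso_sym isoT)).
have [Y [Y' [isoY iY]]] := indec_ex fW nW.
have rYW : retract Y W by apply/retractP; exists Y'.
have dbl Z : mod_iso Y Z -> retract Z (dsum X * dsum S)%type -> False.
  move=> YZ rZ; have iZ := indec_iso YZ iY; apply: (bT Z iZ); apply/retractP.
  have rZW := retract_trans (iso_retract (iso_sym YZ)) rYW.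
  exact: retract_trans (prod_retract rZ rZW) (iso_retract (iso_sym isoT)).
have rYT : retract Y T.
  by apply: retract_trans rYW (retract_trans (retract_snd _ W) (iso_retract (iso_sym isoT))).
have [[i h]|[i h]] := all Y iY rYT.
  by case: (dbl _ h); apply: retract_trans (@dsum_retract _ _ X i) (retract_fst _ _).
by case: (dbl _ h); apply: retract_trans (@dsum_retract _ _ S i) (retract_snd _ _).
Qed.
End AddClass.

(** * Minimal approximations of injective modules *)

Section MinimalApproximations.
Variables (L : pzRingType) (e : L).
Implicit Types M N S U W X Y Z : lmodType L.
Hypothesis nL : noeth L.
Hypothesis torsion_pdf : forall X, fin_gen X -> torsion e X -> pdf X.
Variables (A E : lmodType L) (phi : {linear A -> E}).
Hypothesis phi_min : min_Pfin_approx phi.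

Lemma approx_pfin : pfin A.
Proof. by have [[/PfinP]] := phi_min. Qed.
Lemma approx_lift Y (f : {linear Y -> E}) : pfin Y ->
  exists g : {linear Y -> A}, forall y, phi (g y) = f y.
Proof.
by move=> /PfinP pY; have [[_ /(_ Y f pY)[g gP]]] := phi_min; exists g => y; rewrite gP.
Qed.
Lemma approx_inj (u : {linear A -> A}) : (forall x, phi (u x) = phi x) ->
  exists v : {linear A -> A}, cancel u v.
Proof.
move=> h; have [_ /(_ u h)] := phi_min; move=> /bij_injsurj[ui us].
by have [v [vK _]] := bij_inv ui us; exists v.
Qed.

(* Minimality lets one divide A by any submodule of finite projective dimension
   killed by phi. *)
Lemma approx_Delta_inj (x : A) : (forall a : L, (e * a) *: x = 0) -> phi x = 0 -> x = 0.
Proof.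
have [fA pA] := approx_pfin.
have cK := sclosed_cap (@sclosed_Delta _ e A) (sclosed_ker phi).
have [K [i [ii iP]]] := sub_ex cK; have [Q [q S]] := ses_of_inj ii; have [_ sq eq_] := S.
have tK : torsion e K.
  move=> k; apply: (inj0 ii); have [h _] : (forall a : L, (e * a) *: i k = 0) /\ phi (i k) = 0.
    by apply/iP; exists k.
  by rewrite linearZ -(h 1) mulr1.
have fK := nL ii fA; have pK : pfin K by split=> //; apply: torsion_pdf.
have pQ := pfin_quot S pK (conj fA pA).
have [z /eq_[k <-]|f fP] := @lin_fact _ _ _ _ q phi sq.
  by have [] : (forall a : L, (e * a) *: i k = 0) /\ phi (i k) = 0 by apply/iP; exists k.
have [g gP] := approx_lift f pQ.
have [|v vK] := @approx_inj (g \o q); first by move=> z; rewrite /= gP fP.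
move=> Dx px; rewrite -[x]vK /= (_ : q x = 0) ?linear0 //; apply/eq_/iP.
by split.
Qed.

(* Wakamatsu's lemma *)
Lemma approx_extinj : injective_mod E -> extinj A.
Proof.
move=> iE; split=> [|X pX]; first exact: approx_pfin.
apply: split_ext1 => Z i q S; have pZ := pfin_ext S approx_pfin pX.
(* [phi] extends to [Z] by injectivity of [E], and the extension lifts through [phi] since [Z] lies
   in Pfin; minimality makes the restriction of the lift to [A] invertible. *)
have [ii _ _] := S; have [f fP] := iE _ _ i phi ii.
have [g gP] := approx_lift f pZ.
have [|v vK] := @approx_inj (g \o i); first by move=> x; rewrite /= gP fP.
by exists (v \o g) => x; apply: vK.
Qed.
End MinimalApproximations.

(* Endomorphisms of e T lift to T, so matrix units for a square summand of e T
   give a square summand of T. *)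
Lemma basic_corner (L : pzRingType) (e : L) (he : idem e) (T : lmodType L) :
  fl T -> basic_mod T -> torsion_free e T -> (forall X, torsion e X -> ext1 X T) ->
  basic_mod (corner_mod T he).
Proof.
move=> fT bT tT eT X [nX _] /retractP[s [r rs]].
have [i1 i1E] := inl_ex X X; have [i2 i2E] := inr_ex X X.
have [s1 [s2 [r1 [r2 [r1s1 r2s1 r1s2 r2s2]]]]] :
    exists (s1 s2 : {linear X -> corner_mod T he}) (r1 r2 : {linear corner_mod T he -> X}),
    [/\ cancel s1 r1, forall x, r2 (s1 x) = 0, forall x, r1 (s2 x) = 0 & cancel s2 r2].
  by exists (s \o i1), (s \o i2), (fst \o r), (snd \o r); split=> x /=; rewrite rs ?i1E ?i2E.
have [q11 q11E] := cor_full tT eT (s1 \o r1); have [q12 q12E] := cor_full tT eT (s1 \o r2).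
have [q21 q21E] := cor_full tT eT (s2 \o r1).
have q1111 x : q11 (q11 x) = q11 x.
  apply: (@cor_faithful _ _ he _ tT _ (q11 \o q11) q11) => y.
  by rewrite /= !q11E /= r1s1.
have q1121 x : q11 (q21 x) = 0.
  apply: (@cor_faithful _ _ he _ tT _ (q11 \o q21) \0) => y.
  by rewrite /= q21E q11E /= r1s2 linear0.
have q1211 x : q12 (q11 x) = 0.
  apply: (@cor_faithful _ _ he _ tT _ (q12 \o q11) \0) => y.
  by rewrite /= q11E q12E /= r2s1 linear0.
have q1221 x : q12 (q21 x) = q11 x.
  apply: (@cor_faithful _ _ he _ tT _ (q12 \o q21) q11) => y.
  by rewrite /= q21E q12E q11E /= r2s2.
have [I [u [v [su vi vu]]]] := im_fact q11.
have uv x : u (v x) = x by have [y <-] := su x; apply: vi; rewrite !vu.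
(* The image [I] of the idempotent [q11] occurs twice in [T]: as it stands, and moved by [q21],
   which [q12] undoes. *)
have rII : retract (I * I)%type T.
  have [a aE] := copair_ex v (q21 \o v).
  have [b bE] := pair_ex u (u \o q12); exists a, b => -[x y]; rewrite aE bE /=.
  have u21 z : u (q21 z) = 0 by apply: vi; rewrite vu q1121 linear0.
  have [z zy] := su y; have [w wx] := su x.
  rewrite !linearD uv u21 addr0; congr (_, _).
  rewrite -wx vu q1211 linear0 add0r q1221 -vu uv //.
have nI : ~ zero_mod I.
  move=> zI; apply: nX => x; apply: (inj0 (can_inj r1s1)); apply: val_inj.
  have : q11 (val (s1 x)) = 0 by rewrite -vu (zI (u _)) linear0.
  by rewrite q11E /= r1s1.
have fI : fl I.
  by apply: fl_retract fT; apply: retract_trans (retract_fst I I) rII.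
have [Y [Y' [iso iY]]] := indec_ex fI nI.
have rY : retract Y I by apply/retractP; exists Y'.
by apply: (bT Y iY); apply/retractP; apply: retract_trans (prod_retract rY rY) rII.
Qed.

(** * The tilting module *)

Section Main.
Variables (L : pzRingType) (n : nat) (D : 'I_n -> nzRingType).
Variable f_ : forall i, {rmorphism L -> D i}.
Hypothesis D_div : forall i, division_ring (D i).
Hypothesis f_surj : forall d : (forall i, D i), exists x, forall i, f_ i x = d i.
Hypothesis f_ker : forall x : L, x \in jacobson L <-> forall i, f_ i x = 0.
Hypothesis flL : fl L^o.
Variables (e : L) (e_idem : idem e) (m p : nat) (eps : 'I_(m + p) -> L).
Hypothesis eps_prim : forall i, primitive_idem (eps i).
Hypothesis eps_orth : forall i j, i != j -> eps i * eps j = 0.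
Hypothesis sum_e : e = \sum_(i < m) eps (lshift p i).
Hypothesis sum_1e : 1 - e = \sum_(i < p) eps (rshift m i).
Hypothesis pdim_top : pdim_finite (top_mod (1 - e)).
Implicit Types M N S U W X Y Z : lmodType L.
Local Notation J := (J f_).
Local Notation kap := (kappa D_div f_surj f_ker flL eps_prim).
Local Notation S_ i := (top_mod (eps i)).
Let ei i : idem (eps i) := eps_idem eps_prim i.
Local Notation t i := (tm f_ker (ei i)).
Let nL : noeth L := fl_noeth flL.

Lemma eps_sum : \sum_i eps i = 1.
Proof. by rewrite big_split_ord /= -sum_e -sum_1e addrC subrK. Qed.

Lemma e_eps i : e * eps (lshift p i) = eps (lshift p i).
Proof.
rewrite sum_e mulr_suml (bigD1 i) //= (eps_idem eps_prim) big1 ?addr0 // => j ji.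
by apply: eps_orth; rewrite eq_lshift.
Qed.

Lemma kappa_e j : f_ (kap (rshift m j)) e = 0.
Proof.
rewrite sum_e rmorph_sum big1 // => i _; apply: kappa_eps => //.
by rewrite eq_rlshift.
Qed.

Lemma tm_eps i : eps i *: t i 1 = t i 1.
Proof.
rewrite -tmE; apply/eqP; rewrite -subr_eq0 -linearB; apply/eqP/tm0.
by rewrite mulrBl mul1r ei subrr => l; rewrite rmorph0.
Qed.

Lemma tm_neq0 i : t i 1 <> 0.
Proof.
move=> /tm0/(J_eps D_div f_surj f_ker flL eps_prim)/eqP.
by rewrite rmorph1 oner_eq0.
Qed.

Lemma tops i : simple_mod (S_ i). Proof. exact (top_simple D_div f_surj f_ker flL eps_prim i). Qed.

Lemma top_torsion j : torsion e (S_ (rshift m j)).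
Proof.
move=> x; have [b <-] := tm_surj f_ker (ei (rshift m j)) x.
rewrite -linearZ; apply/(tm0 f_ker (ei _) (e * b))/(J_eps D_div f_surj f_ker flL eps_prim).
by rewrite rmorphM /= kappa_e mul0r.
Qed.

Lemma top_nontorsion i : ~ torsion e (S_ (lshift p i)).
Proof.
move=> /(_ (t (lshift p i) 1)); rewrite -[X in e *: X]tm_eps scalerA e_eps tm_eps.
exact: tm_neq0.
Qed.

Lemma simple_torsion S : simple_mod S -> torsion e S -> exists j, mod_iso (S_ (rshift m j)) S.
Proof.
move=> sS tS; have [/nonzero_ex[x x0] _] := sS.
have [i xi] : exists i, eps i *: x <> 0.
  apply: contrapT => H; apply: x0; rewrite (eps_span eps_sum x) big1 // => i _.
  by apply: contrapT => h; apply: H; exists i.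
have iso := simple_top D_div f_surj f_ker flL eps_prim sS xi.
case: (split_ordP i) xi iso => j -> xi iso; last by exists j.
by case: xi; rewrite -e_eps -scalerA tS.
Qed.

Lemma simple_nontorsion S : simple_mod S -> ~ torsion e S -> exists i, mod_iso (S_ (lshift p i)) S.
Proof.
move=> sS; apply: contra_notP => H x; rewrite sum_e scaler_suml big1 // => i _.
apply: contrapT => h; apply: H; exists i.
exact (simple_top D_div f_surj f_ker flL eps_prim sS h).
Qed.

Lemma top_iso i j : mod_iso (S_ i) (S_ j) -> i = j.
Proof.
move=> /isoE[g [h [gh _]]]; apply/eqP/negP => /negP ij.
have gi : injective g := can_inj gh.
apply: (@tm_neq0 i); apply: (inj0 gi); rewrite -tm_eps linearZ /=.
have [b <-] := tm_surj f_ker (ei j) (g (t i 1)).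
rewrite -linearZ; apply/(tm0 f_ker (ei j) (eps i * b))/(J_eps D_div f_surj f_ker flL eps_prim).
by rewrite rmorphM /= kappa_eps ?mul0r // eq_sym.
Qed.

Lemma idem_1e : idem (1 - e).
Proof. by rewrite /idem mulrBr mulr1 mulrBl mul1r e_idem subrr subr0. Qed.

(** The generator goes to [eps i] times the generator of the larger top, and the way back exists
    because [1 - e] fixes torsion modules pointwise. *)
Lemma top_retract j : retract (S_ (rshift m j)) (top_mod (1 - e)).
Proof.
set i := rshift m j; pose t1 := tm f_ker idem_1e.
have [|a Ja|s sE] := @top_univ _ _ _ _ f_ker _ (ei i) _ (eps i *: t1 1).
- by rewrite scalerA ei.
- exact (top_J f_ker idem_1e _ Ja).
have [|a Ja|r rE] := @top_univ _ _ _ _ f_ker _ idem_1e _ (t i 1).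
- by rewrite scalerBl scale1r (top_torsion (t i 1)) subr0.
- exact (top_J f_ker (ei i) _ Ja).
exists s, r => x; have [a <-] := tm_surj f_ker (ei i) x.
by rewrite sE !linearZ /= rE scale1r tm_eps -tmE.
Qed.

(** Induction on length: a simple torsion submodule is a summand of the top of L (1 - e), which has
    finite projective dimension. *)
Lemma torsion_pdf X : fin_gen X -> torsion e X -> pdf X.
Proof.
have [d /pdim_le_pd pd1] := pdim_top.
move=> /(fg_fl flL)[k]; elim: k X => [|k IH] X fX tX; first exact/pdf_proj/proj_zero.
have [zX|nX] := pselect (zero_mod X); first exact/pdf_proj/proj_zero.
have [|S [s [si sS]]] := simple_sub _ nX; first by exists k.+1.
have [j iso] := simple_torsion sS (torsion_inj si tX).
have [Q [q Sq]] := ses_of_inj si; have [_ sq eq_] := Sq.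
apply: (pdf_ext Sq).
  apply: pdf_retract (iso_retract (iso_sym iso)) _.
  by apply: pdf_retract (top_retract j) _; exists d.
apply: IH (torsion_surj sq tX); apply: fX sq _.
have [/nonzero_ex[x x0] _] := sS; exists (s x); split=> [/(inj0 si)//|].
exact: ses0 Sq.
Qed.

(* Delta (soc M), as soc M is the annihilator of J in M. *)
Definition DJ M (x : M) := (forall a, J a -> a *: x = 0) /\ (forall a : L, (e * a) *: x = 0).

Lemma sclosed_DJ M : sclosed (@DJ M).
Proof.
split=> [|a x y [Jx Dx] [Jy Dy]]; first by split=> a *; rewrite scaler0.
split=> [b Jb|b]; rewrite scalerDr scalerA.
  by rewrite Jx ?Jy ?addr0 //; apply: JMr.
by rewrite -mulrA Dx Dy addr0.
Qed.

Lemma DJ_map M N (f : {linear M -> N}) x : DJ x -> DJ (f x).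
Proof.
move=> [Jx Dx]; split=> [a Ja|a]; first by rewrite -linearZ /= Jx // linear0.
by rewrite -linearZ /= Dx linear0.
Qed.

Lemma DJ_top j (x : S_ (rshift m j)) : DJ x.
Proof.
split=> a *; first exact: (top_J f_ker (ei _)).
by rewrite -scalerA; apply: top_torsion.
Qed.

Lemma DJ_ex M : fl M -> ~ torsion_free e M -> exists x : M, DJ x /\ x <> 0.
Proof.
move=> fM ntf; have [K [i [ii iP]]] := sub_ex (@sclosed_Delta _ e M).
have nK : ~ zero_mod K.
  move=> zK; apply: ntf; apply/torsion_freeP => x /iP[k <-].
  by rewrite (zK k) linear0.
have [S [s [si sS]]] := simple_sub (fl_inj ii fM) nK.
have [/nonzero_ex[x x0] _] := sS.
exists (i (s x)); split; last by move=> /(inj0 ii)/(inj0 si).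
split=> [a Ja|]; last by apply/iP; exists (s x).
by rewrite -!linearZ (J_simple f_ker x sS Ja) !linear0.
Qed.

(** Replaces the nested subtypes of [Delta_soc] by any injection with image [DJ]. Elements
    annihilated by J lie in the socle because each nonzero [eps i *: x] generates a copy of a simple
    top. *)
Lemma Delta_soc_iso M N (j : {linear N -> M}) : injective j ->
  (forall x, DJ x <-> exists y, j y = x) -> mod_iso (Delta_soc e M) N.
Proof.
move=> ji jP.
have socP (x : M) : x \in socle M <-> forall a, J a -> a *: x = 0.
  split=> [/smod_infP h a Ja|Jx].
    have cJ : sclosed (fun y : M => forall a, J a -> a *: y = 0).
      split=> [b _|b y z Jy Jz c Jc]; first exact: scaler0.
      by rewrite scalerDr scalerA Jy ?Jz ?addr0 //; apply: JMr.
    have [NJ NJP] := smod_of_ex cJ.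
    have /NJP : x \in NJ; last by apply.
    apply: h => S sS y Sy; apply/NJP => c Jc.
    by have := J_simple f_ker (Sub y Sy : sub_mod S) sS Jc => /(congr1 val).
  apply/smod_infP => K HK; rewrite (eps_span eps_sum x).
  apply: (sclosed_sum _ (smod_sclosed K)) => i _.
  have [->|x0] := pselect (eps i *: x = 0); first exact: rpred0.
  have [|a Ja|h hE] := @top_univ _ _ _ _ f_ker _ (ei i) _ (eps i *: x).
  - by rewrite scalerA ei.
  - by rewrite scalerA Jx //; apply: JMr.
  have hi : injective h by apply: (top_inj D_div f_surj flL); rewrite hE scale1r.
  have [S SP] := smod_of_ex (sclosed_im h).
  apply: (HK S); last by apply/SP; exists (t i 1); rewrite hE scale1r.
  apply: simple_iso (tops i).
  have [z|g gP] := @lin_lift _ _ _ _ (val : {linear sub_mod S -> M}) h (@sub_mod_inj _ _ _).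
    by apply/sub_mod_im/SP; exists z.
  apply: (@mod_isoP _ _ _ g).
    by apply: injP => z gz; apply: (inj0 hi); rewrite -gP gz linear0.
  move=> y; have /SP[z zE] := valP y; exists z; apply: (@sub_mod_inj _ _ _).
  by rewrite gP zE.
pose v : {linear Delta_soc e M -> M} := (val : {linear sub_mod (socle M) -> M}) \o
  (val : {linear Delta_soc e M -> sub_mod (socle M)}).
have vi : injective v by apply: inj_comp (@sub_mod_inj _ _ _) (@sub_mod_inj _ _ _).
have vP x : DJ x <-> exists y, v y = x.
  split=> [[Jx Dx]|[y <-]].
    have /sub_mod_im[z zE] : x \in socle M by apply/socP.
    have /sub_mod_im[y yE] : z \in Delta e (sub_mod (socle M)).
      by apply/DeltaP => a; apply: (@sub_mod_inj _ _ _); rewrite [LHS]linearZ [RHS]linear0 zE; apply: Dx.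
    by exists y; rewrite -zE -yE.
  split.
    by apply/socP; apply/sub_mod_im; exists (val y).
  have /DeltaP h : val y \in Delta e (sub_mod (socle M)) by apply/sub_mod_im; exists y.
  move=> a; have := congr1 (val : {linear sub_mod (socle M) -> M}) (h a).
  by rewrite linearZ linear0.
have [x|g gP] := @lin_lift _ _ _ _ j v ji; first by apply/jP/vP; exists x.
apply: (@mod_isoP _ _ _ g).
  by apply: injP => x gx; apply: (inj0 vi); rewrite -gP gx linear0.
move=> y; have /vP[x xE] : DJ (j y) by apply/jP; exists y.
by exists x; apply: ji; rewrite gP.
Qed.

Variables (E A : 'I_(m + p) -> lmodType L) (iota : forall i, {linear S_ i -> E i}).
Hypothesis E_env : forall i, injective_envelope (iota i).
Variable phi : forall i, {linear A i -> E i}.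
Hypothesis A_approx : forall i, min_Pfin_approx (phi i).
Local Notation A' := (dsum (fun i : 'I_m => A (lshift p i))).

Lemma iota_inj i : injective (iota i). Proof. by case: (E_env i). Qed.
Lemma E_inj i : injective_mod (E i). Proof. by case: (E_env i). Qed.

Lemma E_essential i (P : E i -> Prop) y : sclosed P -> P y -> y <> 0 ->
  exists x, P (iota i x) /\ x <> 0.
Proof.
move=> cP Py y0; have [_ _ ess] := E_env i; have [N NP] := smod_of_ex cP.
apply: contrapT => H; apply: y0; apply: (ess N); last exact/NP.
move=> x /NP Px; apply: contrapT => x0; apply: H; exists x; split=> // xE.
by apply: x0; rewrite xE linear0.
Qed.

Lemma A_extinj i : extinj (A i).
Proof. exact (approx_extinj (A_approx i) (@E_inj i)). Qed.
Lemma A_pfin i : pfin (A i). Proof. by case: (A_extinj i). Qed.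

Lemma top_pfin j : pfin (S_ (rshift m j)).
Proof.
have fT : fin_gen (S_ (rshift m j)) by exact (top_fg f_ker (ei _)).
by split=> //; apply: torsion_pdf (@top_torsion j).
Qed.

(** A torsion element not killed by [phi] would produce one in E(S_i), and by essentiality a nonzero
    one in S_i; being simple, S_i would be torsion. *)
Lemma A_torsion_free i : torsion_free e (A (lshift p i)).
Proof.
apply/torsion_freeP => x Dx.
apply: (approx_Delta_inj nL torsion_pdf (A_approx _) Dx); apply: contrapT => px.
have Dpx : forall a : L, (e * a) *: phi _ x = 0.
  by move=> a; rewrite -linearZ Dx linear0.
have [s [Ds s0]] := E_essential (@sclosed_Delta _ e _) Dpx px.
have /simpleP[_ sS] := tops (lshift p i).
have [h|h] := sS _ (@sclosed_Delta _ e _).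
  apply: s0; apply: h => a; apply: (inj0 (@iota_inj _)).
  by rewrite linearZ; apply: Ds.
by apply: (@top_nontorsion i) => y; have := h y 1; rewrite mulr1.
Qed.

(** Each nonzero [eps l *: y] generates a simple submodule, which meets S_i by essentiality and so
    lies in it. *)
Lemma soc_E i (y : E i) : (forall a, J a -> a *: y = 0) -> exists x, iota i x = y.
Proof.
move=> Jy; rewrite (eps_span eps_sum y).
apply: (sclosed_sum _ (sclosed_im (iota i))) => l _.
have [->|y0] := pselect (eps l *: y = 0); first by exists 0; rewrite linear0.
have [|a Ja|h hE] := @top_univ _ _ _ _ f_ker _ (ei l) _ (eps l *: y).
- by rewrite scalerA ei.
- by rewrite scalerA Jy //; apply: JMr.
have h1 : h (t l 1) = eps l *: y by rewrite hE scale1r.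
have [|s [[z zE] s0]] := E_essential (sclosed_im h) (ex_intro _ (t l 1) h1).
  by [].
have /simpleP[_ sS] := tops l.
have [k|k] := sS _ (sclosed_preim h (sclosed_im (iota i))).
  case: s0; apply: (inj0 (@iota_inj i)); rewrite -zE (k z) ?linear0 //.
  by exists s.
by have := k (t l 1); rewrite h1.
Qed.

(** S_i lies in Pfin, so its inclusion in E(S_i) lifts to [g]. Conversely [phi] maps [DJ] into the
    socle S_i of E(S_i) and is injective on Delta(A_i). *)
Lemma A_top j : exists g : {linear S_ (rshift m j) -> A (rshift m j)},
  injective g /\ forall x, DJ x <-> exists y, g y = x.
Proof.
set i := rshift m j; have [g gP] := approx_lift (A_approx i) (iota i) (top_pfin j).
have gi : injective g.
  by apply: injP => y gy; apply: (inj0 (@iota_inj i)); rewrite -gP gy linear0.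
exists g; split=> // x; split=> [[Jx Dx]|[y <-]]; last exact/DJ_map/DJ_top.
have [|s sE] := @soc_E i (phi i x).
  by move=> a Ja; rewrite -linearZ /= Jx // linear0.
exists s; apply/eqP; rewrite -subr_eq0; apply/eqP.
apply: (approx_Delta_inj nL torsion_pdf (A_approx i)); last first.
  by rewrite linearB gP sE subrr.
have [_ Ds] := DJ_map g (@DJ_top j s).
by move=> a; rewrite scalerBr Ds Dx subrr.
Qed.

Lemma torsion_free_dsum (I : finType) (F : I -> lmodType L) :
  (forall i, torsion_free e (F i)) -> torsion_free e (dsum F).
Proof.
move=> tF; apply/torsion_freeP => x Dx; apply: dsum_eq => i; rewrite linear0.
by move/torsion_freeP: (tF i); apply=> a; rewrite -linearZ Dx linear0.
Qed.
Lemma torsion_free_prod X Y : torsion_free e X -> torsion_free e Y ->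
  torsion_free e (X * Y)%type.
Proof.
move=> /torsion_freeP tX /torsion_freeP tY; apply/torsion_freeP => -[x y] Dxy.
by congr (_, _); [apply: tX|apply: tY] => a; have := Dxy a => -[].
Qed.
Lemma torsion_free_retract X Y : retract X Y -> torsion_free e Y -> torsion_free e X.
Proof. by move=> [s [r rs]]; apply: (@torsion_free_inj _ _ _ _ s); apply: can_inj rs. Qed.

(* DJ (A_i) is simple. *)
Lemma A_split j X Y : mod_iso (A (rshift m j)) (X * Y)%type ->
  torsion_free e X \/ torsion_free e Y.
Proof.
move=> iso; apply: contrapT => /not_orP[nX nY].
have fA : fl (A (rshift m j)) by apply: fg_fl flL _ _; case: (A_pfin (rshift m j)).
have fXY := fl_iso iso fA.
have [x [DJx x0]] := DJ_ex (fl_retract (retract_fst X Y) fXY) nX.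
have [y [DJy y0]] := DJ_ex (fl_retract (retract_snd X Y) fXY) nY.
have [f [h [fh hf]]] := isoE iso; have [g [gi gP]] := A_top j.
have [a aE] := inl_ex X Y; have [b bE] := inr_ex X Y.
have /gP[z zE] := DJ_map (h \o a) DJx; have /gP[w wE] := DJ_map (h \o b) DJy.
have /simpleP[_ sS] := tops (rshift m j).
have [k|k] := sS _ (sclosed_cyc w).
  apply: y0; have : h (b y) = 0 by rewrite -[LHS]wE (k w) ?linear0 //; exists 1; rewrite scale1r.
  by move=> /(inj0 (can_inj hf)); rewrite bE => -[].
have [c cE] := k z; apply: x0.
have hab : h (a x) = h (c *: b y) by rewrite linearZ -[LHS]zE -[h (b y)]wE cE linearZ.
by have := congr1 fst (can_inj hf hab); rewrite aE bE /= scaler0.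
Qed.

(** Keep splitting and set torsion-free factors aside until the other factor is indecomposable; by
    [A_split] one of two factors is always torsion-free. All of [DJ] then sits in [S]. *)
Lemma A_decomposition j : exists S U, [/\ mod_iso (A (rshift m j)) (S * U)%type,
  indecomposable S, torsion_free e U & exists g : {linear S_ (rshift m j) -> S},
    injective g /\ forall x, DJ x <-> exists y, g y = x].
Proof.
have fA : fl (A (rshift m j)) by apply: fg_fl flL _ _; case: (A_pfin (rshift m j)).
have [g [gi gP]] := A_top j.
have nA : ~ torsion_free e (A (rshift m j)).
  move=> tA; have [/nonzero_ex[x x0] _] := tops (rshift m j).
  apply: x0; apply: (inj0 gi); move/torsion_freeP: tA; apply.
  by have /gP[] : exists y, g y = g x by exists x.
suff [S [U [iso iS tU]]] : exists S U, [/\ mod_iso (A (rshift m j)) (S * U)%type,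
    indecomposable S & torsion_free e U].
  exists S, U; split=> //; have [f [h [fh hf]]] := isoE iso.
  have f2 y : (f (g y)).2 = 0.
    move/torsion_freeP: tU; apply; have /gP/(DJ_map (snd \o f))[_] : exists z, g z = g y by exists y.
    by [].
  exists (fst \o f \o g); split=> [|x].
    apply: injP => y /= f1; apply: (inj0 gi); apply: (inj0 (can_inj fh)).
    by case: (f (g y)) f1 (f2 y) => ? ? /= -> ->.
  split=> [DJx|[y <-]]; last first.
    by apply: (DJ_map (fst \o f)); apply/gP; exists y.
  have [a aE] := inl_ex S U; have /gP[y yE] := DJ_map (h \o a) DJx.
  by exists y; rewrite /= yE /= hf aE.
have [Z zZ] := zero_mod_ex L.
have [k fk] := fA.
suff H l X Y : flen l X -> mod_iso (A (rshift m j)) (X * Y)%type -> torsion_free e Y ->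
    exists S U, [/\ mod_iso (A (rshift m j)) (S * U)%type, indecomposable S & torsion_free e U].
  apply: (H k _ Z fk (iso_sym (prod_iso0 _ zZ))).
  by apply/torsion_freeP => z _; apply: zZ.
elim: l X Y => [|l IH] X Y fX iso tY.
  case: nA; apply: torsion_free_retract (iso_retract iso) (torsion_free_prod _ tY).
  by apply/torsion_freeP => z _; apply: fX.
have [zX|nX] := pselect (zero_mod X).
  by apply: (IH X Y) => //; apply: flen_le (leq0n l) _.
have [iX|] := pselect (indecomposable X); first by exists X, Y.
move=> niX; have [X1 [X2 [iso' n1 n2]]] : exists X1 X2 : lmodType L,
    [/\ mod_iso X (X1 * X2)%type, ~ zero_mod X1 & ~ zero_mod X2].
  apply: contra_notP niX => H; split=> // U V isoUV.
  by apply: contrapT => /not_orP[nU nV]; apply: H; exists U, V.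
have iso2 : mod_iso (A (rshift m j)) (X1 * (X2 * Y))%type.
  apply: iso_trans iso _; apply: iso_trans (prod_iso iso' (iso_refl Y)) _.
  exact: iso_sym (prod_isoA _ _ _).
have iso1 : mod_iso (A (rshift m j)) (X2 * (X1 * Y))%type.
  apply: iso_trans iso _.
  apply: iso_trans (prod_iso (iso_trans iso' (prod_isoC _ _)) (iso_refl Y)) _.
  exact: iso_sym (prod_isoA _ _ _).
have [t1|t2] := A_split iso2.
  apply: (IH X2 (X1 * Y)%type) => //; last exact: torsion_free_prod.
  exact: flen_summand (iso_trans iso' (prod_isoC _ _)) n1 fX.
exact: (IH X1 (X2 * Y)%type) (flen_summand iso' n2 fX) iso2 t2.
Qed.

Lemma extinj_dsum k (F : 'I_k -> lmodType L) : (forall i, extinj (F i)) -> extinj (dsum F).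
Proof.
move=> eF; split=> [|X pX]; first by apply: pfin_dsum => i; case: (eF i).
by apply: ext1_dsumN => i; case: (eF i) => _; apply.
Qed.

Lemma extinj_add M X : extinj M -> add_class M X -> extinj X.
Proof.
by move=> eM /add_classP[k r]; apply: extinj_retract r _; apply: extinj_dsum.
Qed.

Lemma A'_extinj : extinj A'. Proof. by apply: extinj_dsum => i; apply: A_extinj. Qed.
Lemma AA_extinj : extinj (dsum A). Proof. by apply: extinj_dsum => i; apply: A_extinj. Qed.
Lemma A'_torsion_free : torsion_free e A'.
Proof. by apply: torsion_free_dsum => i; apply: A_torsion_free. Qed.

Lemma add_torsion_free M X : torsion_free e M -> add_class M X -> torsion_free e X.
Proof.
by move=> tM /add_classP[k r]; apply: torsion_free_retract r _; apply: torsion_free_dsum.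
Qed.

(** Injectivity of E(S_i) extends S -> E(S_i) to [U], and the approximation lifts the extension to
    A_i. *)
Lemma simple_detect i U S (s : {linear S -> U}) : pfin U -> injective s ->
  mod_iso (S_ i) S -> exists (g : {linear U -> A i}) x, g (s x) <> 0.
Proof.
move=> pU si iso; have [f [h [fh hf]]] := isoE iso.
have [k kP] := @E_inj i _ _ s (iota i \o h) si.
have [g gP] := approx_lift (A_approx i) k pU.
exists g, (f (t i 1)) => g0; apply: (@tm_neq0 i); apply: (inj0 (@iota_inj i)).
by have := gP (s (f (t i 1))); rewrite g0 linear0 kP /= fh.
Qed.

Lemma embed_free U : pfin U -> torsion_free e U ->
  exists k (h : {linear U -> dsum (fun _ : 'I_k => A')}), injective h.
Proof.
move=> pU tU; apply: cogen_embed => [|S s si sS]; first by apply: fg_fl flL _ _; case: pU.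
have [|i iso] := simple_nontorsion sS.
  move=> tS; have [/nonzero_ex[x x0] _] := sS; apply: x0; apply: (inj0 si).
  move/torsion_freeP: tU; apply=> a; rewrite -linearZ -scalerA.
  by rewrite tS linear0.
have [g [x gx]] := simple_detect pU si iso.
exists (din i \o g), x => /(congr1 (dpr i)) /=; rewrite dinK linear0.
exact: gx.
Qed.

Lemma embed_all U : pfin U ->
  exists k (h : {linear U -> dsum (fun _ : 'I_k => dsum A)}), injective h.
Proof.
move=> pU; apply: cogen_embed => [|S s si sS]; first by apply: fg_fl flL _ _; case: pU.
have [i iso] : exists i, mod_iso (S_ i) S.
  have [/(simple_torsion sS)[j]|/(simple_nontorsion sS)[j]] := pselect (torsion e S).
    by exists (rshift m j).
  by exists (lshift p j).
have [g [x gx]] := simple_detect pU si iso.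
exists (din i \o g), x => /(congr1 (dpr i)) /=; rewrite dinK linear0.
exact: gx.
Qed.

(** The cokernel of [h] lies in Pfin, so the embedding splits. *)
Lemma extinj_embed M W k (h : {linear M -> dsum (fun _ : 'I_k => W)}) :
  injective h -> extinj M -> pfin W -> add_class W M.
Proof.
move=> hi [pM eM] pW; have [Q [q S]] := ses_of_inj hi.
have pQ := pfin_quot S pM (pfin_dsum (fun _ => pW)).
by have [r rK] := ext1_split (eM Q pQ) S; apply/add_classP; exists k, h, r.
Qed.

Lemma extinj_free_add M : extinj M -> torsion_free e M -> add_class A' M.
Proof.
move=> eM tM; have [k [h hi]] := embed_free (proj1 eM) tM.
exact: extinj_embed hi eM (proj1 A'_extinj).
Qed.
Lemma extinj_all_add M : extinj M -> add_class (dsum A) M.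
Proof.
move=> eM; have [k [h hi]] := embed_all (proj1 eM).
exact: extinj_embed hi eM (proj1 AA_extinj).
Qed.

Lemma extinj_emb M : pfin M -> exists X Y, extinj X /\ sesx M X Y.
Proof.
move=> pM; have [k [h hi]] := embed_all pM; have [Q [q S]] := ses_of_inj hi.
exists (dsum (fun _ : 'I_k => dsum A)), Q; split; last by exists h, q.
by apply: extinj_dsum => _; apply: AA_extinj.
Qed.

Lemma torsion_ext1 W : extinj W -> torsion_free e W -> forall X, torsion e X -> ext1 X W.
Proof.
move=> [_ eW] tW; apply: (ext1_torsion tW) => X fX tX.
by apply: eW; split=> //; apply: torsion_pdf.
Qed.

Lemma giraud_extinj W : extinj W -> torsion_free e W -> giraud e W.
Proof. by move=> eW tW; split=> // X /(torsion_ext1 eW tW)/ext1_Ext_zero1. Qed.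

(** Each corner module e X with torsion-free [X] in Pfin embeds in a power of e A' with a cokernel
    of the same class, so [cores_ex] applies. The bound [d + c] adds the cost [c] of e L (1 - e) to
    the bound [d] over L. *)
Lemma corner_tilting W c d : extinj W -> torsion_free e W -> add_class W A' ->
  (forall X, pfin X -> pd d X) -> pd c (corner_mod (sub_mod (lideal_gen (1 - e))) e_idem) ->
  strong_tilting (corner_mod W e_idem).
Proof.
move=> eW tW aW bd pc; have nB := @corner_noeth L e e_idem nL.
have E1 (N : lmodType (corner e_idem)) : pfin N -> ext1 N (corner_mod W e_idem).
  exact (@cor_ext1 L e e_idem nL torsion_pdf W tW (torsion_ext1 eW tW) (proj2 eW) N).
have pW : pfin (corner_mod W e_idem) := cor_pfin nL pc (proj1 eW).
have EZ (N : lmodType (corner e_idem)) : pfin N -> forall i, (1 <= i)%N -> Ext_zero i N (corner_mod W e_idem).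
  exact (pfin_Ext_zero nB E1).
split; last by move=> M /PfinP; apply: EZ.
split; [exact/PfinP|exact: EZ|].
suff /cores_coresolution cR : cores (add_class (corner_mod W e_idem)) (d + c) (corner e_idem)^o.
  by exists (d + c)%N.
apply: (cores_ex (B := @pfin (corner e_idem)) nB (cor_pd_bound nL torsion_pdf pc bd)) => //.
- exact: add_retract.
- move=> N pN; have [k0 [X [K [i0 [p0 [_ tX iso pX]]]]]] := cor_pfin_lift nL torsion_pdf pN.
  have [k [h hi]] := embed_free pX tX; have [Q [q Sq]] := ses_of_inj hi.
  have pQ := pfin_quot Sq pX (pfin_dsum (fun _ => proj1 A'_extinj)).
  have [ci cs ce] := cor_ses e_idem Sq; have [u [v [uv vu]]] := isoE iso.
  exists (corner_mod (dsum (fun _ : 'I_k => A')) e_idem), (corner_mod Q e_idem),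
    (cmap e_idem h \o v), (cmap e_idem q); split.
  + split=> [||y]; [exact: inj_comp ci (can_inj vu)|exact: cs|].
    by rewrite ce; split=> [[x <-]|[x <-]]; [exists (u x); rewrite /= uv|exists (v x)].
  + have /add_classP[l r] := @add_dsum _ W k (fun _ => A') (fun _ => aW).
    apply/add_classP; exists l; apply: retract_trans (cor_retract e_idem r) _.
    exact: iso_retract (cor_dsum e_idem (fun _ : 'I_l => W)).
  + exact (cor_pfin nL pc pQ).
  + have eA : extinj (dsum (fun _ : 'I_k => A')) by apply: extinj_dsum => _; apply: A'_extinj.
    have tA : torsion_free e (dsum (fun _ : 'I_k => A')).
      by apply: torsion_free_dsum => _; apply: A'_torsion_free.
    move=> Y pY; exact (@cor_ext1 L e e_idem nL torsion_pdf _ tA (torsion_ext1 eA tA) (proj2 eA) Y pY).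
- exact: pfin_proj (@fg_reg _) (@proj_reg _).
Qed.

(** * The decomposition of the tilting module *)

Section Decomposition.
Variables S U : 'I_p -> lmodType L.
Hypothesis dec : forall j, [/\ mod_iso (A (rshift m j)) (S j * U j)%type,
  indecomposable (S j), torsion_free e (U j) & exists g : {linear S_ (rshift m j) -> S j},
    injective g /\ forall x, DJ x <-> exists y, g y = x].

Lemma S_extinj j : extinj (S j).
Proof.
have [iso _ _ _] := dec j; apply: extinj_retract (A_extinj (rshift m j)).
exact: retract_trans (retract_fst _ _) (iso_retract (iso_sym iso)).
Qed.

Lemma U_add j : add_class A' (U j).
Proof.
have [iso _ tU _] := dec j; apply: extinj_free_add tU.
apply: extinj_retract (A_extinj (rshift m j)).
exact: retract_trans (retract_snd _ _) (iso_retract (iso_sym iso)).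
Qed.

Lemma S_Delta_soc j : mod_iso (Delta_soc e (S j)) (S_ (rshift m j)).
Proof. by have [_ _ _ [g [gi gP]]] := dec j; apply: (Delta_soc_iso gi). Qed.

(** Delta of the socle of [S j] is a simple module that recovers the index. *)
Lemma S_iso j1 j2 : mod_iso (S j1) (S j2) -> j1 = j2.
Proof.
move=> /isoE[f [h [fh hf]]]; have [_ _ _ [g [gi gP]]] := dec j2.
apply: (@rshift_inj m p); apply: top_iso; apply: iso_trans (iso_sym (S_Delta_soc j1)) _.
apply: (@Delta_soc_iso _ _ (h \o g)) => [|x]; first exact: inj_comp (can_inj hf) gi.
split=> [/(DJ_map f)/gP[y yE]|[y <-]]; first by exists y; rewrite /= yE fh.
by apply: (DJ_map h); apply/gP; exists y.
Qed.

Lemma S_not_free j : ~ torsion_free e (S j).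
Proof.
move=> tS; have [_ _ _ [g [gi gP]]] := dec j.
have [/nonzero_ex[x x0] _] := tops (rshift m j).
apply: x0; apply: (inj0 gi); move/torsion_freeP: tS; apply.
by have /gP[] : exists y, g y = g x by exists x.
Qed.

Variables (k : nat) (X : 'I_k -> lmodType L).
Hypothesis X_reps : add_indec_reps A' X.

Definition ext_fam (a : 'I_k + 'I_p) : lmodType L :=
  match a with inl i => X i | inr j => S j end.

Lemma X_free i : torsion_free e (X i).
Proof. by have [/(_ i)[_ aX] _ _] := X_reps; apply: add_torsion_free A'_torsion_free aX. Qed.

Lemma ext_famP a : extinj (ext_fam a) /\ indecomposable (ext_fam a).
Proof.
case: a => [i|j] /=; last by split; [exact: S_extinj|case: (dec j)].
by have [/(_ i)[iX aX] _ _] := X_reps; split=> //; apply: extinj_add A'_extinj aX.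
Qed.

Lemma ext_fam_iso a b : mod_iso (ext_fam a) (ext_fam b) -> a = b.
Proof.
have [_ Xi _] := X_reps; case: a b => [i|i] [j|j] /=.
- by move/Xi => ->.
- by move/iso_sym/iso_retract/torsion_free_retract => /(_ (@X_free i))/S_not_free.
- by move/iso_retract/torsion_free_retract => /(_ (@X_free j))/S_not_free.
- by move/S_iso => ->.
Qed.

Lemma ext_fam_all Y : extinj Y -> indecomposable Y -> exists a, mod_iso Y (ext_fam a).
Proof.
move=> eY iY; have [[fY _] _] := eY; have flY := fg_fl flL fY; have [_ _ X_all] := X_reps.
have free : add_class A' Y -> exists a, mod_iso Y (ext_fam a).
  by move=> /(X_all _ iY)[i]; exists (inl i).
have r := add_indec flY iY (extinj_all_add eY).
have [i ri] := krs_prime flY iY r.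
case: (split_ordP i) ri => j -> ri.
  by apply: free; apply: add_self; apply: retract_trans ri (dsum_retract (fun i => A (lshift p i)) j).
have [iso iS tU _] := dec j.
have [rS|rU] := krs_prime2 flY iY (retract_trans ri (iso_retract iso)).
  by exists (inr j); apply: retract_indec rS => //; case: iY.
by apply: free; apply: extinj_free_add eY _; apply: torsion_free_retract rU tU.
Qed.

Variables (d : nat) (bd : forall M, pfin M -> pd d M).

(** The [k] representatives and the [p] modules [S j] are together as many as the [m + p]
    indecomposable projectives L eps_i; cancel [p]. *)
Lemma reps_count : k = m.
Proof.
have := @extinj_count L flL d _ _ (fun i => sub_mod (lideal_gen (eps i))) ext_fam bd.
rewrite card_sum !card_ord => H; apply: (@addIn p); apply: H.
- move=> i; split; [exact: lideal_fg|exact: (lideal_proj (ei i))|exact (lideal_indec (ei i) (eps_prim i))].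
- exact (lideal_iso D_div f_surj f_ker flL eps_prim eps_orth).
- exact (indec_proj flL eps_prim eps_sum).
- exact: ext_famP.
- exact: ext_fam_iso.
- exact: ext_fam_all.
- exact: extinj_emb.
Qed.

Variable T : lmodType L.
Hypotheses (T_ext : extinj T) (T_basic : basic_mod T).
Hypothesis T_cores : exists s, cores (add_class T) s L^o.

Lemma ext_fam_retract a : retract (ext_fam a) T.
Proof.
have [[[fa _] _] ia] := ext_famP a; have [s cT] := T_cores.
apply: add_indec (fg_fl flL fa) ia _.
apply: (extinj_tilting (C0 := add_class T) flL bd ext_famP ext_fam_iso ext_fam_all extinj_emb _ _ _ _ cT).
- by move=> M; apply: extinj_add T_ext.
- by move=> Z; apply: add_zero.
- by move=> M N; apply: add_prod.
- by move=> M N; apply: add_retract.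
Qed.

Lemma tilt_decomposition : mod_iso T (dsum X * dsum S)%type.
Proof.
have [Xa Xi _] := X_reps; have [[fT _] _] := T_ext.
apply: basic_decomposition (fg_fl flL fT) T_basic _ _ Xi S_iso _ _.
- by move=> i; have [_] := ext_famP (inl i); split=> //; apply: (ext_fam_retract (inl i)).
- by move=> j; have [_] := ext_famP (inr j); split=> //; apply: (ext_fam_retract (inr j)).
- by move=> i j /(@ext_fam_iso (inl i) (inr j)).
move=> Y iY rY; have [[i|j] iso] := ext_fam_all (extinj_retract rY T_ext) iY.
  by left; exists i.
by right; exists j.
Qed.

Lemma reps_add : add_class (dsum X) A'.
Proof.
have [_ _ X_all] := X_reps; have [[fA _] _] := A'_extinj.
apply: krs_closure (fg_fl flL fA) _ => [Z||Y Z|Y iY rY].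
- exact: add_zero.
- exact: add_prod.
- exact: add_iso.
have [i iso] := X_all Y iY (add_self rY); apply: add_self.
exact: retract_trans (iso_retract iso) (dsum_retract X i).
Qed.

Lemma reps_extinj : extinj (dsum X).
Proof. by apply: extinj_dsum => i; have [] := ext_famP (inl i). Qed.

Lemma reps_free : torsion_free e (dsum X).
Proof. exact: torsion_free_dsum X_free. Qed.

Lemma reps_corner_basic : basic_mod (corner_mod (dsum X) e_idem).
Proof.
have [[fX _] _] := reps_extinj.
apply: basic_corner (fg_fl flL fX) _ reps_free (torsion_ext1 reps_extinj reps_free).
move=> Y iY /retractP r; apply: (T_basic iY); apply/retractP.
apply: retract_trans r _; apply: retract_trans (retract_fst _ (dsum S)) _.
exact: iso_retract (iso_sym tilt_decomposition).
Qed.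

(** The torsion-free factor contributes nothing, and in the other one [DJ] is computed componentwise
    by the maps of [dec]. *)
Lemma tilt_Delta_soc : mod_iso (Delta_soc e T) (dsum (fun j : 'I_p => S_ (rshift m j))).
Proof.
have [f [h [fh hf]]] := isoE tilt_decomposition.
have [b bE] := inr_ex (dsum X) (dsum S).
pose V j : lmodType L := S_ (rshift m j).
have gx j : {g : {linear V j -> S j} | injective g /\ forall x, DJ x <-> exists y, g y = x}.
  by apply: cid; case: (dec j).
have [G GE] : exists G : {linear dsum V -> dsum S},
    forall x j, dpr j (G x) = sval (gx j) (dpr j x).
  have [G GE] := @dtup_ex _ _ _ (dsum V) (fun j => sval (gx j) \o dpr j).
  by exists G => x j; rewrite GE.
apply: (@Delta_soc_iso _ _ (h \o b \o G)) => [|x].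
  apply: injP => y /= hy; apply: dsum_eq => j; rewrite linear0.
  have [gi _] := svalP (gx j); apply: (inj0 gi).
  have /(congr1 snd) /= G0 : b (G y) = 0 by apply: (inj0 (can_inj hf)).
  by rewrite -[LHS]GE (_ : G y = 0) ?linear0 // -[LHS]/((0 : dsum X, G y).2) -bE.
split=> [DJx|[y <-]]; last first.
  apply: (DJ_map (h \o b)); rewrite (dsumE (G y)); apply: (sclosed_sum _ (@sclosed_DJ _)) => j _.
  apply: DJ_map; rewrite GE; apply: (DJ_map (sval (gx j))); exact: DJ_top.
have f1 : (f x).1 = 0.
  by move/torsion_freeP: reps_free; apply; have [_] := DJ_map (fst \o f) DJx.
have y_ j : {y | sval (gx j) y = dpr j (f x).2}.
  apply: cid; have [_ gP] := svalP (gx j); apply/gP.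
  exact: (DJ_map (dpr j \o snd \o f) DJx).
exists (\sum_j din j (sval (y_ j))) => /=; rewrite -[RHS]fh; congr (h _).
rewrite bE [RHS]surjective_pairing f1; congr (_, _); apply: dsum_eq => j.
rewrite GE /= linear_sum (bigD1 j) //= dinK big1 ?addr0; last first.
  by move=> i ij; rewrite din0 // eq_sym.
exact: (svalP (y_ j)).
Qed.

Lemma reps_properties c : pd c (corner_mod (sub_mod (lideal_gen (1 - e))) e_idem) ->
  [/\ dsummand (dsum X) T, giraud e (dsum X),
      strong_tilting (corner_mod (dsum X) e_idem) &
      basic_mod (corner_mod (dsum X) e_idem)].
Proof.
move=> pc; split.
- by exists (dsum S); apply: tilt_decomposition.
- exact: giraud_extinj reps_extinj reps_free.
- exact: corner_tilting reps_extinj reps_free reps_add bd pc.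
- exact: reps_corner_basic.
Qed.
End Decomposition.

Lemma decomposition_ex : exists S U : 'I_p -> lmodType L, forall j,
  [/\ mod_iso (A (rshift m j)) (S j * U j)%type, indecomposable (S j), torsion_free e (U j) &
      exists g : {linear S_ (rshift m j) -> S j},
        injective g /\ forall x, DJ x <-> exists y, g y = x].
Proof.
have [S H] := choice A_decomposition; have [U dec] := choice H.
by exists S, U.
Qed.

Lemma reps_ex d : (forall M, pfin M -> pd d M) ->
  exists X : 'I_m -> lmodType L, add_indec_reps A' X.
Proof.
move=> bd; have [S [U dec]] := decomposition_ex; have [[fA _] _] := A'_extinj.
have [k [X [Xr Xi Xa]]] := indec_reps (fg_fl flL fA).
have reps : add_indec_reps A' X.
  split=> // [i|Y iY aY]; first by have [iX rX] := Xr i; split=> //; apply: add_self.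
  have [[fY _] _] := extinj_add A'_extinj aY; have flY := fg_fl flL fY.
  exact: Xa iY flY (add_indec flY iY aY).
(* Removing repetitions among the summands gives some number [k] of representatives; only the count
   identifies it with [m]. *)
have km := reps_count dec reps bd; subst k.
by exists X.
Qed.
End Main.

Lemma tilt_extinj (R : pzRingType) (T : lmodType R) : strong_tilting T -> extinj T.
Proof.
move=> [[/PfinP pT _ _] ET]; split=> // X pX.
by apply: Ext_zero_ext1 (ET X _ 1%N isT); [case: ((PfinP X).2 pX)|apply/PfinP].
Qed.

Lemma tilt_cores (R : pzRingType) (T : lmodType R) :
  tilting T -> exists s, cores (add_class T) s R^o.
Proof.
move=> [_ _ [s [C [CT Cz]]]]; exists s.
by apply: coresolution_cores CT Cz => X Y; apply: add_iso.
Qed.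

Theorem proposition5p2 (L : pzRingType)
    (L_artin : artin_algebra L) (L_basic : basic_ring L)
    (e : L) (e_idem : idem e)
    (pdim_top : pdim_finite (top_mod (1 - e)))
    (pdim_corner :
      pdim_finite (corner_mod (sub_mod (lideal_gen (1 - e))) e_idem))
    (corner_fin : Pfin_contravariantly_finite (corner e_idem))
    (m p : nat) (eps : 'I_(m + p) -> L)
    (eps_prim : forall i, primitive_idem (eps i))
    (eps_orth : forall i j, i != j -> eps i * eps j = 0)
    (sum_e : e = \sum_(i < m) eps (lshift p i))
    (sum_1e : 1 - e = \sum_(i < p) eps (rshift m i))
    (E A : 'I_(m + p) -> lmodType L)
    (iota : forall i, {linear top_mod (eps i) -> E i})
    (E_env : forall i, injective_envelope (iota i))
    (phi : forall i, {linear A i -> E i})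
    (A_approx : forall i, min_Pfin_approx (phi i))
    (T : lmodType L) (T_tilt : strong_tilting T) (T_basic : basic_mod T) :
  let A' := dsum (fun i : 'I_m => A (lshift p i)) in
  [/\ exists T_ : 'I_m -> lmodType L, add_indec_reps A' T_,
      forall T_ : 'I_m -> lmodType L, add_indec_reps A' T_ ->
        let T' := dsum T_ in
        [/\ dsummand T' T,
            giraud e T',
            strong_tilting (corner_mod T' e_idem),
            basic_mod (corner_mod T' e_idem) &
            exists S_ U_ : 'I_p -> lmodType L,
              mod_iso T (T' * dsum S_)%type /\
              forall i : 'I_p,
                [/\ mod_iso (A (rshift m i)) (S_ i * U_ i)%type,
                    mod_iso (Delta_soc e (S_ i)) (top_mod (eps (rshift m i))) &
                    add_class T' (U_ i)]] &
      mod_iso (Delta_soc e T)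
        (dsum (fun i : 'I_p => top_mod (eps (rshift m i))))].
Proof.
have [n [D [f_ [D_div f_surj f_ker]]]] := L_basic.
have flL : fl L^o := fl_reg D_div f_surj f_ker (artin_dcc L_artin).
have [c /pdim_le_pd pc] := pdim_corner; have nL := fl_noeth flL.
have T_ext := tilt_extinj T_tilt; have [s T_cores] := tilt_cores (proj1 T_tilt).
(* The length [s] of the coresolution of L serves as the uniform bound [d] of the counting
   lemmas. *)
have bd : forall M : lmodType L, pfin M -> pd s M.
  apply: (pd_bound nL _ T_cores) => M aM.
  by have [] := extinj_add T_ext aM.
have [S [U dec]] := decomposition_ex D_div f_surj f_ker flL e_idem eps_prim eps_orth
  sum_e sum_1e pdim_top E_env A_approx.
(* One fixed family of representatives serves the first and the last claim; the middle one is shown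
   for every family. *)
have [T0 T0_reps] := reps_ex D_div f_surj f_ker flL e_idem eps_prim eps_orth
  sum_e sum_1e pdim_top E_env A_approx bd.
move=> A'; split; first by exists T0.
- move=> T_ T_reps T'.
  have [] := reps_properties D_div f_surj f_ker flL eps_prim eps_orth
    sum_e sum_1e pdim_top E_env A_approx dec T_reps bd T_ext T_basic (ex_intro _ s T_cores) pc.
  split=> //; exists S, U; split.
    exact: (tilt_decomposition D_div f_surj f_ker flL e_idem eps_prim eps_orth
      sum_e sum_1e pdim_top E_env A_approx dec T_reps bd T_ext T_basic (ex_intro _ s T_cores)).
  move=> i; split; first by case: (dec i).
    exact (S_Delta_soc D_div f_surj f_ker flL eps_prim sum_e sum_1e dec i).
  apply: add_trans _ (reps_add flL E_env A_approx T_reps).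
  exact (U_add D_div f_surj f_ker flL eps_prim sum_e E_env A_approx dec i).
exact: (tilt_Delta_soc D_div f_surj f_ker flL e_idem eps_prim eps_orth
  sum_e sum_1e pdim_top E_env A_approx dec T0_reps bd T_ext T_basic (ex_intro _ s T_cores)).
Qed.
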